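(* Let $f\in H^{s}(\mathbb{R})$ with $s\ge \frac14$. Then $$\lim_{t\to 0}U(t)f(x)=f(x)$$ almost everywhere with respect to $x$.
   Context: $U(t)$ is the solution operator of the free Ostrovsky equation $u_t+\partial_x^3u\pm\partial_x^{-1}u=0$, $u(x,0)=f(x)$, that is $$U(t)f=\frac{1}{\sqrt{2\pi}}\int_{\mathbb{R}}e^{ix\xi+it(\xi^3\pm\frac1\xi)}\mathscr{F}_xf(\xi)\,d\xi ,$$ where either sign in $\pm$ is allowed (the same sign in the equation and in the phase). The Fourier transform is $\mathscr{F}_xf(\xi)=\frac{1}{\sqrt{2\pi}}\int_{\mathbb{R}}e^{-ix\xi}f(x)\,dx$. $H^s(\mathbb{R})$ is the space of tempered distributions $f$ with $\|f\|_{H^s(\mathbb{R})}=\|\langle\xi\rangle^s\mathscr{F}_xf\|_{L^2_\xi(\mathbb{R})}<\infty$, where $\langle\xi\rangle^s=(1+\xi^2)^{s/2}$. *)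

(* Defs.v *)
From HB Require Import structures.
From mathcomp Require Import all_boot all_order all_algebra.
From mathcomp Require Import all_classical all_reals all_analysis.
From mathcomp Require Import complex.
Import numFieldNormedType.Exports.

Set Implicit Arguments.
Unset Strict Implicit.
Unset Printing Implicit Defensive.

Import Order.TTheory GRing.Theory Num.Theory.
Local Open Scope classical_set_scope.
Local Open Scope complex_scope.
Local Open Scope ring_scope.

Section Ostrovsky.
Variable R : realType.
Local Notation C := R[i].
Local Notation mu := (@lebesgue_measure R).
Implicit Types (f g : R -> C) (phi : R -> C) (T : (R -> C) -> C).

Definition Cmeasurable f :=
  measurable_fun setT (fun x => complex.Re (f x)) /\
  measurable_fun setT (fun x => complex.Im (f x)).

Definition Cintegrable (D : set R) f :=
  mu.-integrable D (fun x => (complex.Re (f x))%:E) /\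
  mu.-integrable D (fun x => (complex.Im (f x))%:E).

(* Only meaningful when f is integrable on D: Rintegral is total and returns a
   junk value otherwise. *)
Definition Cintegral (D : set R) f : C :=
  (\int[mu]_(x in D) complex.Re (f x)) +i* (\int[mu]_(x in D) complex.Im (f x)).

Definition cis (a : R) : C := cos a +i* sin a.

Definition Cderive1n (n : nat) f (x : R) : C :=
  derive1n n (fun y => complex.Re (f y)) x +i* derive1n n (fun y => complex.Im (f y)) x.

Definition Csmooth f := forall (n : nat) (x : R),
  derivable (derive1n n (fun y => complex.Re (f y))) x 1 /\
  derivable (derive1n n (fun y => complex.Im (f y))) x 1.

Definition schwartz_values (k n : nat) phi : set R :=
  range (fun x => `|x| ^+ k * Normc.normc (Cderive1n n phi x)).

Definition schwartz phi :=
  Csmooth phi /\ forall k n : nat, has_ubound (schwartz_values k n phi).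

Definition schwartz_seminorm (k n : nat) phi : R :=
  sup (schwartz_values k n phi).

(* A tempered distribution is carried by a total functional on R -> C, but only
   its values on Schwartz functions are ever constrained or used. *)
Definition tempered T :=
  [/\ forall (a : C) phi psi, schwartz phi -> schwartz psi ->
        T (fun x => a * phi x + psi x) = a * T phi + T psi
    & exists (m : nat) (K : R), forall phi, schwartz phi ->
        Normc.normc (T phi) <=
          K * \sum_(k < m) \sum_(n < m) schwartz_seminorm k n phi].

Definition fourier_test phi (xi : R) : C :=
  ((Num.sqrt (2 * pi))^-1)%:C *
    Cintegral setT (fun x => cis (- (x * xi)) * phi x).

Definition fourier T : (R -> C) -> C := fun phi => T (fourier_test phi).

(* T is the regular distribution phi |-> \int g phi. *)
Definition represents T g :=
  Cmeasurable g /\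
  forall phi, schwartz phi ->
    Cintegrable setT (fun x => g x * phi x) /\
    T phi = Cintegral setT (fun x => g x * phi x).

(* A function representing T, unique up to a null set; the zero function when
   there is none. *)
Definition density T : R -> C := xget (fun=> 0) [set g | represents T g].

Definition japanese_bracket (s xi : R) : R := (1 + xi ^+ 2) `^ (s / 2).

Definition sobolev (s : R) T :=
  [/\ tempered T,
      exists g, represents (fourier T) g
    & ('N[mu]_(2%:E)[(fun xi => (japanese_bracket s xi *
         Normc.normc (density (fourier T) xi))%:E)] < +oo)%E].

(* The sign in the phase is (-1) ^+ b. *)
Definition ostrovsky_phase (b : bool) (t x xi : R) : R :=
  x * xi + t * (xi ^+ 3 + (-1) ^+ b * xi^-1).

Definition ostrovsky_trunc (b : bool) T (t x N : R) : C :=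
  ((Num.sqrt (2 * pi))^-1)%:C *
    Cintegral `[- N, N]
      (fun xi => cis (ostrovsky_phase b t x xi) * density (fourier T) xi).

(* For s <= 1/2 the Fourier transform of an element of H^s need not be
   integrable, so the integral over R defining U(t) is the limit of the
   integrals over [-N, N]; it coincides with the Lebesgue integral whenever the
   latter exists. *)
Definition ostrovsky_U (b : bool) (t : R) T (x : R) : C :=
  lim (ostrovsky_trunc b T t x N @[N --> +oo] : set_system (C^o)).

Definition ostrovsky_U_defined (b : bool) (t : R) T (x : R) :=
  cvg (ostrovsky_trunc b T t x N @[N --> +oo] : set_system (C^o)).

End Ostrovsky.

(* Main.v *)
(* Write the density of the Fourier transform of T as u + i v. Up to a constant, the
   truncated solution is a pair of real oscillatory integrals osc of u and v
   over [-N, N]. Following Kenig and Ruiz, van der Corput estimates give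
   |int_[-N,N] w cos (x xi + t (xi^3 +- 1/xi))| <= C |x|^(-1/2) for 0 < |x| <= 1,
   uniformly in t and N, with w(xi) = max(1, |xi|)^(-1/2). For points x_i of a grid
   of step 1/n and arbitrary (t_i, N_i), a finite TT* argument with Schur's test
   turns this into sum_i osc(t_i, x_i, N_i)^2 <= C n int (u^2 + v^2) / w, and
   averaging over translates of the grid bounds the maximal function
   sup_(t,N) osc^2 in L^1 on unit intervals, without any measurable selection of
   t and N. The right-hand side is finite because s >= 1/4.

   Applied to the tails of u and v, the maximal estimate shows that for almost
   every x the integrals converge as N -> oo uniformly in t, so their limit is
   continuous at t = 0. Its value at t = 0 represents T: by Fourier inversion every
   Schwartz function is the Fourier transform of one, and the maximal function
   allows dominated convergence in the pairing with a Schwartz function. Finally a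
   representative is unique up to a null set, by testing against Gaussians. *)
Require Import Defs.
From mathcomp Require Import all_boot all_order all_algebra.
From mathcomp Require Import all_classical all_reals all_analysis.
From mathcomp Require Import measurable_realfun complex ring lra.
Import numFieldNormedType.Exports.
Import Order.TTheory GRing.Theory Num.Theory.
Local Open Scope classical_set_scope.
Local Open Scope complex_scope.
Local Open Scope ring_scope.

Set Implicit Arguments.
Unset Strict Implicit.
Unset Printing Implicit Defensive.

(** * Oscillatory integrals *)

(** The exponent 1/2 of the weight makes the kernel bound free of [t]. The phase derivative is close
    to x + 3 t xi^2, so for x > 0 > t it vanishes at a frequency of size r = sqrt (x / |t|). A
    second derivative estimate there gives (|t| r)^(-1/2), and the amplitude r^(-1/2) turns this
    into (|t| r^2)^(-1/2) = x^(-1/2). The singular term 1/xi is large only for |xi| <= 1, where the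
    integral is bounded by the length of the interval.

    On a grid of step 1/n the kernel between the points i and j is of size (n / |i - j|)^(1/2), so a
    row sums to O(n). The diagonal entry is at most 2 L when every N_i is at most L, hence also O(n)
    once n >= 2 L. Averaging over translates divides by n, and the resulting constant does not
    depend on L, which may then tend to infinity.

    The maximal estimate holds on unit intervals, uniformly in their position; the integrable factor
    [rho] turns it into a single estimate on the line. It is used both for almost everywhere
    convergence and for dominating the pairing with Schwartz functions. *)

Section RealIntegrable.
Context d (T : measurableType d) (R : realType).
Variables (mu : {measure set T -> \bar R}) (D : set T) (mD : measurable D).
Implicit Types (f g h : T -> R) (k : R).

Definition rintegrable f := mu.-integrable D (EFin \o f).

Lemma rintegrable_measurable f : rintegrable f -> measurable_fun D f.
Proof. by move=> /(measurable_int mu)/measurable_EFinP. Qed.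

Lemma EFin_Rintegral f : rintegrable f ->
  (\int[mu]_(x in D) (f x)%:E = (\int[mu]_(x in D) f x)%:E)%E.
Proof. by move=> fi; rewrite /Rintegral fineK//; exact: integrable_fin_num. Qed.

Lemma rintegrableD f g : rintegrable f -> rintegrable g ->
  rintegrable (fun x => f x + g x).
Proof. by move=> fi gi; exact: (integrableD mD fi gi). Qed.

Lemma rintegrableZl k f : rintegrable f -> rintegrable (fun x => k * f x).
Proof. by move=> fi; exact: (integrableZl mD k fi). Qed.

Lemma rintegrableN f : rintegrable f -> rintegrable (fun x => - f x).
Proof. by move=> fi; exact: (integrableN fi). Qed.

Lemma rintegrableB f g : rintegrable f -> rintegrable g ->
  rintegrable (fun x => f x - g x).
Proof. by move=> fi gi; apply: rintegrableD => //; exact: rintegrableN. Qed.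

Lemma rintegrable_norm f : rintegrable f -> rintegrable (fun x => `|f x|).
Proof. exact: integrable_norm. Qed.

Lemma rintegrable_le f g : measurable_fun D f ->
  (forall x, D x -> `|f x| <= g x) -> rintegrable g -> rintegrable f.
Proof.
move=> mf fg; apply: le_integrable => //; first exact/measurable_EFinP.
by move=> x Dx; rewrite /= lee_fin (le_trans (fg x Dx)) ?ler_norm.
Qed.

Lemma rintegrable_sum (I : Type) (s : seq I) (P : pred I) (h : I -> T -> R) :
  (forall i, P i -> rintegrable (h i)) ->
  rintegrable (fun x => \sum_(i <- s | P i) h i x).
Proof.
move=> hi; rewrite /rintegrable.
rewrite (_ : _ \o _ = fun x => (\sum_(i <- s | P i) (h i x)%:E)%E).
  by apply: integrable_sum => // i /hi.
by apply/funext => x /=; rewrite sumEFin.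
Qed.

Lemma Rintegral_sum (I : Type) (s : seq I) (P : pred I) (h : I -> T -> R) :
  (forall i, P i -> rintegrable (h i)) ->
  \int[mu]_(x in D) (\sum_(i <- s | P i) h i x) =
  \sum_(i <- s | P i) \int[mu]_(x in D) h i x.
Proof.
move=> hi; elim: s => [|i s ih].
  under eq_Rintegral do rewrite big_nil.
  by rewrite big_nil Rintegral_cst// mul0r.
under eq_Rintegral do rewrite big_cons.
rewrite big_cons; case: ifPn => Pi; last exact: ih.
by rewrite RintegralD// ?ih//; [exact: hi|exact: rintegrable_sum].
Qed.

Lemma rintegrableMl h f k : measurable_fun D h -> (forall x, D x -> `|h x| <= k) ->
  rintegrable f -> rintegrable (fun x => h x * f x).
Proof.
move=> mh hk fi; apply: (@rintegrable_le _ (fun x => k * `|f x|)).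
- by apply: measurable_funM => //; exact: rintegrable_measurable.
- by move=> x Dx; rewrite normrM ler_wpM2r// hk.
- exact/rintegrableZl/rintegrable_norm.
Qed.

Lemma rintegrableMr h f k : measurable_fun D h -> (forall x, D x -> `|h x| <= k) ->
  rintegrable f -> rintegrable (fun x => f x * h x).
Proof.
move=> mh hk fi; under eq_fun do rewrite mulrC; exact: (rintegrableMl mh hk fi).
Qed.

Lemma le_norm_Rintegral f g : rintegrable f -> rintegrable g ->
  (forall x, D x -> `|f x| <= g x) ->
  `|\int[mu]_(x in D) f x| <= \int[mu]_(x in D) g x.
Proof.
move=> fi gi fg; apply: (le_trans (le_normr_Rintegral _ _)) => //.
by apply: le_Rintegral => //; exact: rintegrable_norm.
Qed.

Lemma Rintegral_subset (A : set T) f : measurable A -> A `<=` D ->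
  rintegrable f -> (forall x, 0 <= f x) ->
  \int[mu]_(x in A) f x <= \int[mu]_(x in D) f x.
Proof.
move=> mA AD fi f0; have fiA : mu.-integrable A (EFin \o f) by exact: integrableS fi.
apply: fine_le; [exact: integrable_fin_num|exact: integrable_fin_num|].
apply: ge0_subset_integral => //; first exact/measurable_EFinP/rintegrable_measurable.
by move=> x _; rewrite lee_fin.
Qed.

End RealIntegrable.
Arguments rintegrable {d T R} mu D f.
Arguments rintegrable_le {d T R mu D} mD {f} g.
Arguments rintegrableMl {d T R mu D} mD {h f} k.
Arguments rintegrableMr {d T R mu D} mD {h f} k.

(** * Calculus on compact intervals and the first derivative test *)

Section Calculus.
Variable R : realType.
Local Notation mu := (@lebesgue_measure R).
Implicit Types (f g F A th : R -> R) (a b c p q x y : R).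

Lemma is_derive_continuous f x (d : R) : is_derive x 1 f d -> {for x, continuous f}.
Proof.
by move=> [df _]; apply: differentiable_continuous; apply/derivable1_diffP.
Qed.

Lemma itv_within_continuous f a b :
  {in `[a, b], forall x, {for x, continuous f}} -> {within `[a, b], continuous f}.
Proof.
move=> cf; apply: continuous_in_subspaceT => x; rewrite inE /= => xab.
by apply: cf.
Qed.

Lemma itv_integrable f a b :
  {in `[a, b], forall x, {for x, continuous f}} ->
  rintegrable mu `[a, b] f.
Proof.
move=> cf; apply: continuous_compact_integrable; first exact: segment_compact.
exact: itv_within_continuous.
Qed.

Lemma Rintegral_derive F f a b : a <= b ->
  {in `[a, b], forall x, is_derive x 1 F (f x)} ->
  {in `[a, b], forall x, {for x, continuous f}} ->
  \int[mu]_(x in `[a, b]) f x = F b - F a.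
Proof.
rewrite le_eqVlt => /predU1P[<- _ _|ab dF cf].
  by rewrite set_itv1 Rintegral_set1 subrr.
have cF : {in `[a, b], forall x, {for x, continuous F}}.
  by move=> x xab; apply: is_derive_continuous (dF x xab).
have aab : a \in `[a, b] by rewrite in_itv/= lexx ltW.
have bab : b \in `[a, b] by rewrite in_itv/= lexx ltW.
rewrite /Rintegral (@continuous_FTC2 _ f F)//.
- exact: itv_within_continuous.
- split.
  + by move=> x xab; have [] := dF x (subset_itv_oo_cc xab).
  + by apply: cvg_at_right_filter; exact: cF.
  + by apply: cvg_at_left_filter; exact: cF.
- move=> x xab; rewrite derive1E.
  by have [_ ->] := dF x (subset_itv_oo_cc xab).
Qed.

Lemma Rintegral_itv_split f a c b : a <= c -> c <= b ->
  rintegrable mu `[a, b] f ->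
  \int[mu]_(x in `[a, b]) f x =
  \int[mu]_(x in `[a, c]) f x + \int[mu]_(x in `[c, b]) f x.
Proof.
move=> ac cb fi.
have /eqP := @Rintegral_itvB _ f (BLeft a) (BRight b) c fi ac cb.
rewrite subr_eq => /eqP ->; rewrite addrC; congr (_ + _).
rewrite Rintegral_itv_obnd_cbnd//.
by apply: integrableS fi => // x /=; rewrite !in_itv/= => /andP[/ltW cx ->]; rewrite (le_trans ac cx).
Qed.

(** Uniform over all compact intervals inside the region [P], so that a region can be cut at a point
    [c] wherever [c] lies relative to the interval of integration. *)
Definition int_bounded f (P : R -> Prop) (B : R) :=
  forall p q, p <= q -> (forall x, p <= x <= q -> P x) ->
  `|\int[mu]_(x in `[p, q]) f x| <= B.

Lemma int_bounded_split f (P : R -> Prop) c (B1 B2 : R) : 0 <= B1 -> 0 <= B2 ->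
  (forall x, P x -> {for x, continuous f}) ->
  int_bounded f (fun x => P x /\ x <= c) B1 ->
  int_bounded f (fun x => P x /\ c <= x) B2 ->
  int_bounded f P (B1 + B2).
Proof.
move=> B10 B20 cf b1 b2 p q pq pP.
have [qc|cq] := leP q c.
  rewrite (le_trans (b1 p q pq _)) ?lerDl// => x /[dup] /pP Px /andP[_ xq].
  by split => //; exact: le_trans qc.
have [cp|pc] := leP c p.
  rewrite (le_trans (b2 p q pq _)) ?lerDr// => x /[dup] /pP Px /andP[px _].
  by split => //; exact: le_trans px.
rewrite (@Rintegral_itv_split f p c q (ltW pc) (ltW cq)); last first.
  by apply: itv_integrable => x; rewrite in_itv/= => /pP; exact: cf.
apply: (le_trans (ler_normD _ _)); apply: lerD.
- apply: b1 => [|x /andP[px xc]]; first exact: ltW.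
  by split=> //; apply: pP; rewrite px (le_trans xc (ltW cq)).
- apply: b2 => [|x /andP[cx xq]]; first exact: ltW.
  by split=> //; apply: pP; rewrite xq (le_trans (ltW pc) cx).
Qed.

(* The error term of the integration by parts is dominated by the derivative of
   the monotone function [D], so no absolute integral has to be computed. *)
Lemma van_der_corput1 A A' th th' th'' (a b l sg : R) : a <= b -> 0 < l ->
  `|sg| = 1 ->
  {in `[a, b], forall x, is_derive x 1 A (A' x)} ->
  {in `[a, b], forall x, {for x, continuous A'}} ->
  {in `[a, b], forall x, is_derive x 1 th (th' x)} ->
  {in `[a, b], forall x, is_derive x 1 th' (th'' x)} ->
  {in `[a, b], forall x, {for x, continuous th''}} ->
  {in `[a, b], forall x, [/\ 0 <= A x, A x <= A a & A' x <= 0]} ->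
  {in `[a, b], forall x, l <= th' x /\ 0 <= sg * th'' x} ->
  `|\int[mu]_(x in `[a, b]) (A x * cos (th x))| <= 4 * A a / l.
Proof.
move=> ab l0 sg1 dA cA' dth dth' cth'' hA hth.
have aab : a \in `[a, b] by rewrite in_itv/= lexx.
have bab : b \in `[a, b] by rewrite in_itv/= lexx ab.
have th'0 x : x \in `[a, b] -> 0 < th' x.
  by move=> /hth[/(lt_le_trans l0)].
pose H := fun x => A x * sin (th x) / th' x.
(* [H] is the boundary term and [r] the error of the integration by parts. The two terms of [D]
   match those of [r]: the part with [A'] is at most [- A' / l], and the part with [th''] is at most
   [A a * (sg * th'') / th' ^+ 2], the derivative of [- sg * A a / th']. *)
pose D := fun x => - A x / l - sg * A a / th' x.
pose h := fun x => A x * cos (th x).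
pose r := fun x => A' x * sin (th x) / th' x - A x * sin (th x) * th'' x / th' x ^+ 2.
pose d := fun x => - A' x / l + sg * A a * th'' x / th' x ^+ 2.
have dV x : x \in `[a, b] -> is_derive x 1 (fun y => (th' y)^-1) (- (th'' x) / th' x ^+ 2).
  move=> xab; have := dth' x xab => dx.
  apply: is_derive_eq; first by apply: is_deriveV; rewrite gt_eqF// th'0.
  by rewrite /GRing.scale/= mulrC mulrN mulNr.
have dH x : x \in `[a, b] -> is_derive x 1 H (h x + r x).
  move=> xab; have dx := dth x xab; have dax := dA x xab; have dv := dV x xab.
  have ds : is_derive x 1 (sin \o th) (cos (th x) * th' x) by exact: is_derive1_comp.
  apply: (is_derive_eq (is_deriveM (is_deriveM dax ds) dv)).
  rewrite /GRing.scale /h /r /=.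
  have := th'0 x xab; move=> t0; rewrite !fctE/=.
  by field; rewrite gt_eqF.
have dD x : x \in `[a, b] -> is_derive x 1 D (d x).
  move=> xab; have dax := dA x xab; have dv := dV x xab.
  have -> : D = (fun x => (- l^-1) *: A x + (- (sg * A a)) *: (th' x)^-1).
    by apply/funext => y; rewrite /D /GRing.scale/=; ring.
  apply: (is_derive_eq
    (is_deriveD (is_deriveZ (- l^-1) dax) (is_deriveZ (- (sg * A a)) dv))).
  rewrite /GRing.scale/= /d.
  have := th'0 x xab; move=> t0.
  by field; rewrite !gt_eqF.
have cA x : x \in `[a, b] -> {for x, continuous A}.
  by move=> /dA; exact: is_derive_continuous.
have cth x : x \in `[a, b] -> {for x, continuous th}.
  by move=> /dth; exact: is_derive_continuous.
have cth' x : x \in `[a, b] -> {for x, continuous th'}.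
  by move=> /dth'; exact: is_derive_continuous.
have csin x : x \in `[a, b] -> {for x, continuous (sin \o th)}.
  by move=> xab; apply: continuous_comp; [exact: cth|exact: continuous_sin].
have ccos x : x \in `[a, b] -> {for x, continuous (cos \o th)}.
  by move=> xab; apply: continuous_comp; [exact: cth|exact: continuous_cos].
have cV x : x \in `[a, b] -> {for x, continuous (fun y => (th' y)^-1)}.
  by move=> /dV; exact: is_derive_continuous.
have cV2 x : x \in `[a, b] -> {for x, continuous (fun y => th' y ^- 2)}.
  move=> xab; have -> : (fun y => th' y ^- 2) = (fun y => (th' y)^-1 * (th' y)^-1).
    by apply/funext => y; rewrite expr2 invfM.
  by apply: continuousM; exact: cV.
have ch x : x \in `[a, b] -> {for x, continuous h}.
  by move=> xab; apply: continuousM; [exact: cA|exact: ccos].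
have cr x : x \in `[a, b] -> {for x, continuous r}.
  move=> xab; rewrite /r.
  have cAs := continuousM (cA x xab) (csin x xab).
  apply: continuousB; apply: continuousM; do ?by [exact: cV|exact: cV2].
    by apply: continuousM; [exact: cA'|exact: csin].
  by apply: continuousM; [exact: cAs|exact: cth''].
have cd x : x \in `[a, b] -> {for x, continuous d}.
  move=> xab; rewrite /d.
  apply: continuousD; repeat (apply: continuousM);
    do ?[exact: cst_continuous|exact: cV2|exact: cth''].
  by apply: continuousN; exact: cA'.
have rd x : x \in `[a, b] -> `|r x| <= d x.
  move=> xab; rewrite /r /d; apply: (le_trans (ler_normB _ _)).
  have t0 := th'0 x xab.
  have [A0 Aa A'0] := hA x xab; have [lt sg0] := hth x xab.
  apply: lerD; rewrite !normrM normfV ?normrX ?normrM.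
  - rewrite (gtr0_norm t0) (ler0_norm A'0).
    rewrite -mulrA ler_wpM2l ?oppr_ge0//.
    rewrite ler_pdivrMr// mulrC (@le_trans _ _ 1)//; last first.
      by rewrite ler_pdivlMr// mul1r.
    by rewrite ler_norml sin_geN1 sin_le1.
  - rewrite (gtr0_norm t0) (ger0_norm A0) ler_pM2r ?invr_gt0 ?exprn_gt0//.
    have -> : sg * A a * th'' x = A a * (sg * th'' x) by ring.
    rewrite -[X in _ * X <= _]mul1r -sg1 -normrM (ger0_norm sg0).
    rewrite ler_wpM2r// -[leRHS]mulr1 ler_pM// ler_norml sin_geN1 sin_le1//.
(* The constant 4: each boundary value of [H] costs [A a / l], and [D] varies by at most
   [2 * A a / l], one half from the amplitude and one from [1 / th'], which stays between 0 and
   [1 / l]. *)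
have bnd_HD : `|H b| + `|H a| + (D b - D a) <= 4 * A a / l.
  have HA x : x \in `[a, b] -> `|H x| <= A a / l.
    move=> xab; have [A0 Aa _] := hA x xab; have [lt _] := hth x xab.
    have t0 := th'0 x xab.
    rewrite /H !normrM normfV (gtr0_norm t0) (ger0_norm A0).
    rewrite ler_pM ?mulr_ge0 ?invr_ge0// ?(ltW t0)//.
      by rewrite -[leRHS]mulr1 ler_pM// ler_norml sin_geN1 sin_le1.
    by rewrite lef_pV2 ?posrE.
  have [A0a _ _] := hA a aab.
  have [A0b Aab _] := hA b bab.
  have : D b - D a <= A a / l + A a / l.
    have -> : D b - D a = (A a - A b) / l + A a * (sg * ((th' a)^-1 - (th' b)^-1)).
      by rewrite /D; ring.
    apply: lerD.
      by rewrite ler_pM2r ?invr_gt0// lerBlDr lerDl.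
    rewrite ler_wpM2l//.
    have T x : x \in `[a, b] -> 0 < (th' x)^-1 <= l^-1.
      move=> xab; rewrite invr_gt0 th'0//= lef_pV2 ?posrE ?th'0//.
      by have [] := hth x xab.
    have /andP[Ta1 Ta2] := T a aab; have /andP[Tb1 Tb2] := T b bab.
    apply: (le_trans (ler_norm _)); rewrite normrM sg1 mul1r ler_norml.
    by apply/andP; split; lra.
  have := HA a aab; have := HA b bab.
  have -> : 4 * A a / l = A a / l + A a / l + (A a / l + A a / l) by ring.
  by move=> hb ha hD; apply: lerD => //; apply: lerD.
have ih := itv_integrable ch; have ir := itv_integrable cr.
have id_ := itv_integrable cd.
have chr x : x \in `[a, b] -> {for x, continuous (fun x => h x + r x)}.
  by move=> xab; apply: continuousD; [exact: ch|exact: cr].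
have eH := Rintegral_derive ab dH chr.
have eD := Rintegral_derive ab dD cd.
move: eH; rewrite RintegralD// => eH.
have rD : `|\int[mu]_(x in `[a, b]) r x| <= D b - D a.
  rewrite -eD; apply: (le_trans (le_normr_Rintegral _ _)) => //.
  apply: le_Rintegral => //; exact: rintegrable_norm.
have -> : \int[mu]_(x in `[a, b]) (A x * cos (th x)) =
    (H b - H a) - \int[mu]_(x in `[a, b]) r x.
  by rewrite -eH addrK.
apply: le_trans bnd_HD.
apply: (le_trans (ler_normB _ _)); apply: lerD => //.
exact: ler_normB.
Qed.

Lemma Rintegral_itv_le f a b (M : R) : a <= b ->
  rintegrable mu `[a, b] f ->
  {in `[a, b], forall x, `|f x| <= M} ->
  `|\int[mu]_(x in `[a, b]) f x| <= M * (b - a).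
Proof.
move=> ab fi fM; apply: (le_trans (le_normr_Rintegral _ _)) => //.
have mab : mu `[a, b]%classic = (b - a)%:E.
  rewrite lebesgue_measure_itv/= lte_fin; case: ltgtP ab => // ->.
  by rewrite subrr.
have -> : M * (b - a) = \int[mu]_(x in `[a, b]) M.
  by rewrite Rintegral_cst// -[b - a]/(fine (b - a)%:E) -mab.
apply: le_Rintegral => //; first exact: rintegrable_norm.
by apply: itv_integrable => x _; exact: cst_continuous.
Qed.

End Calculus.

(** * The oscillatory kernel on frequencies at least 1; [e] stands for either sign *)

Section OscillatoryKernel.
Variable R : realType.
Local Notation mu := (@lebesgue_measure R).
Variables (e : R) (e1 : `|e| <= 1).
Implicit Types (a b c p q x y t xi : R).

Let A xi : R := (Num.sqrt xi)^-1.
Let A' xi : R := - (2 * xi * Num.sqrt xi)^-1.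
Let th t x xi : R := x * xi + t * (xi ^+ 3 + e * xi^-1).
Let phi1 xi : R := 3 * xi ^+ 2 - e * xi ^- 2.
Let phi2 xi : R := 6 * xi + 2 * e * xi ^- 3.
Let f t x xi : R := A xi * cos (th t x xi).

Let dinv xi : 0 < xi -> is_derive xi 1 (fun z : R => z^-1) (- xi ^- 2).
Proof.
move=> xi0; apply: (is_derive_eq (@is_deriveV _ id xi 1 1 _ _)) => //.
  by rewrite gt_eqF.
by rewrite /GRing.scale/= mulr1.
Qed.

Let dth t x xi : 0 < xi -> is_derive xi 1 (th t x) (x + t * phi1 xi).
Proof.
move=> xi0; have di := dinv xi0.
have di3 := @is_deriveX _ _ id 3 xi 1 _ (is_derive_id xi 1).
have dl := is_deriveZ x (is_derive_id xi (1 : R)).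
have -> : th t x = x *: id + t *: (id ^+ 3 + e *: (fun z : R => z^-1)).
  by apply/funext => z.
apply: (is_derive_eq (is_deriveD dl (is_deriveZ t (is_deriveD di3 (is_deriveZ e di))))).
by rewrite /GRing.scale/= /phi1; ring.
Qed.

Let dphi1 xi : 0 < xi -> is_derive xi 1 phi1 (phi2 xi).
Proof.
move=> xi0; have di := dinv xi0.
have di2 := @is_deriveX _ _ id 2 xi 1 _ (is_derive_id xi 1).
have dv2 := @is_deriveX _ _ (fun z : R => z^-1) 2 xi 1 _ di.
have -> : phi1 = 3 *: (id : R -> R) ^+ 2 - e *: (fun z : R => z^-1) ^+ 2.
  by apply/funext => z; rewrite /phi1 -exprVn.
apply: (is_derive_eq (is_deriveB (is_deriveZ 3 di2) (is_deriveZ e dv2))).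
rewrite /GRing.scale/= /phi2; field.
by rewrite gt_eqF.
Qed.

Let cinv xi : 0 < xi -> {for xi, continuous (fun z : R => z^-1)}.
Proof. by move=> /dinv/is_derive_continuous. Qed.

Let cphi2 xi : 0 < xi -> {for xi, continuous phi2}.
Proof.
move=> xi0; have -> : phi2 = fun z => 6 * z + 2 * e * (z^-1 * (z^-1 * z^-1)).
  by apply/funext => z; rewrite /phi2 -exprVn !exprS expr0 mulr1.
have ci := cinv xi0.
apply: continuousD.
  by apply: continuousM; [exact: cst_continuous|exact: cvg_id].
apply: continuousM; first exact: cst_continuous.
by apply: continuousM => //; apply: continuousM.
Qed.

Let dA xi : 0 < xi -> is_derive xi 1 A (A' xi).
Proof.
move=> xi0; have s0 : 0 < Num.sqrt xi by rewrite sqrtr_gt0.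
have ds := is_derive1_sqrt xi0.
apply: (is_derive_eq (@is_deriveV _ Num.sqrt xi _ 1 _ ds)); first by rewrite gt_eqF.
rewrite /GRing.scale/= /A' -{3}(sqr_sqrtr (ltW xi0)); field.
by rewrite gt_eqF.
Qed.

Let cA xi : 0 < xi -> {for xi, continuous A}.
Proof. by move=> /dA/is_derive_continuous. Qed.

Let cA' xi : 0 < xi -> {for xi, continuous A'}.
Proof.
move=> xi0; have -> : A' = fun z => - (2^-1 * (z^-1 * A z)).
  by apply/funext => z; rewrite /A' /A !invfM mulrA.
have ci := cinv xi0; have ca := cA xi0.
apply: continuousN; apply: continuousM; first exact: cst_continuous.
by apply: continuousM.
Qed.

Let cf t x xi : 0 < xi -> {for xi, continuous (f t x)}.
Proof.
move=> xi0; apply: continuousM; first exact: cA.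
apply: continuous_comp; last exact: continuous_cos.
exact: is_derive_continuous (dth t x xi0).
Qed.

Let A0 xi : 0 <= A xi. Proof. by rewrite invr_ge0 sqrtr_ge0. Qed.

Let leA a b : 0 < a -> a <= b -> A b <= A a.
Proof.
move=> a0 ab; rewrite lef_pV2 ?posrE ?sqrtr_gt0//; last exact: lt_le_trans ab.
exact: ler_wsqrtr.
Qed.

Let fA t x xi : `|f t x xi| <= A xi.
Proof.
rewrite normrM (ger0_norm (A0 _)) -[leRHS]mulr1 ler_wpM2l// ler_norml.
by rewrite cos_geN1 cos_le1.
Qed.

Let inv_le1 n xi : 1 <= xi -> 0 < xi ^- n <= 1.
Proof.
move=> xi1; have xi0 : 0 < xi by exact: lt_le_trans xi1.
by rewrite invr_gt0 exprn_gt0//= invf_le1 ?exprn_gt0// exprn_ege1.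
Qed.

Let phi1_bounds xi : 1 <= xi -> 2 * xi ^+ 2 <= phi1 xi <= 4 * xi ^+ 2.
Proof.
move=> xi1; have /andP[i0 i1] := inv_le1 2 xi1.
have xx : 1 <= xi ^+ 2 by rewrite exprn_ege1.
have : `|e * xi ^- 2| <= 1.
  by rewrite normrM (gtr0_norm i0) -[leRHS]mulr1 ler_pM// ltW.
by rewrite ler_norml /phi1 => /andP[h1 h2]; apply/andP; split; lra.
Qed.

Let phi2_ge0 xi : 1 <= xi -> 0 <= phi2 xi.
Proof.
move=> xi1; have /andP[i0 i1] := inv_le1 3 xi1.
have : `|e * xi ^- 3| <= 1.
  by rewrite normrM (gtr0_norm i0) -[leRHS]mulr1 ler_pM// ltW.
by rewrite ler_norml /phi2 => /andP[h1 h2]; lra.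
Qed.

(** The difference factors as [(b - a) * (b + a) * (3 + e / (a ^+ 2 * b ^+ 2))], whose last factor
    is at least 2. This replaces a lower bound on the second derivative of the phase. *)
Let phi1_incr p a b : 1 <= p -> p <= a -> a <= b ->
  4 * p * (b - a) <= phi1 b - phi1 a.
Proof.
move=> p1 pa ab.
have a1 : 1 <= a by exact: le_trans pa.
have b1 : 1 <= b by exact: le_trans ab.
have a0 : 0 < a by exact: lt_le_trans a1.
have b0 : 0 < b by exact: lt_le_trans b1.
have /andP[i0 i1] := inv_le1 2 a1; have /andP[j0 j1] := inv_le1 2 b1.
have -> : phi1 b - phi1 a = (b - a) * ((b + a) * (3 + e * (a ^- 2 * b ^- 2))).
  by rewrite /phi1; field; rewrite !gt_eqF.
rewrite mulrC ler_wpM2l ?subr_ge0//.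
have : `|e * (a ^- 2 * b ^- 2)| <= 1.
  rewrite normrM -[leRHS]mulr1 ler_pM// gtr0_norm ?mulr_gt0//.
  by apply: mulr_ile1 => //; exact: ltW.
rewrite ler_norml => /andP[h1 _].
have : 0 <= (b + a) * (1 + e * (a ^- 2 * b ^- 2)).
  by apply: mulr_ge0; [rewrite addr_ge0// ltW|lra].
have : 2 * p <= b + a by lra.
lra.
Qed.

Let integrable_f t x p q : 1 <= p -> rintegrable mu `[p, q] (f t x).
Proof.
move=> p1; apply: itv_integrable => xi; rewrite in_itv/= => /andP[pxi _].
by apply: cf; rewrite (lt_le_trans ltr01)// (le_trans p1).
Qed.

(** The cosine is even, so the sign [s] of the phase derivative can be absorbed into the phase. That
    derivative is monotone because [phi2 >= 0] for [xi >= 1], in the direction given by the sign of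
    [s * t]. *)
Let first_derivative_test t x p q (s l : R) : 1 <= p -> p <= q -> 0 < l -> `|s| = 1 ->
  (forall xi, p <= xi <= q -> l <= s * (x + t * phi1 xi)) ->
  `|\int[mu]_(xi in `[p, q]) f t x xi| <= 4 * A p / l.
Proof.
move=> p1 pq l0 s1 hl.
have pos xi : xi \in `[p, q] -> 1 <= xi.
  by rewrite in_itv/= => /andP[pxi _]; exact: le_trans pxi.
have pos0 xi : xi \in `[p, q] -> 0 < xi by move=> /pos; exact: lt_le_trans.
have [sg sg1 sgst] : exists2 sg : R, `|sg| = 1 & 0 <= sg * (s * t).
  have [st|st] := leP 0 (s * t); first by exists 1; rewrite ?normr1 ?mul1r.
  by exists (-1); rewrite ?normrN1// mulN1r oppr_ge0 ltW.
have -> : \int[mu]_(xi in `[p, q]) f t x xi =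
    \int[mu]_(xi in `[p, q]) (A xi * cos (s * th t x xi)).
  apply: eq_Rintegral => xi _; rewrite /f; congr (_ * _).
  case: (ger0P s) s1 => _; first by move=> ->; rewrite mul1r.
  by move=> /eqP; rewrite eqr_oppLR => /eqP ->; rewrite mulN1r cosN.
refine (@van_der_corput1 R A A' (fun xi => s * th t x xi)
  (fun xi => s * (x + t * phi1 xi)) (fun xi => s * t * phi2 xi) p q l sg
  pq l0 sg1 _ _ _ _ _ _ _).
- by move=> xi /pos0; exact: dA.
- by move=> xi /pos0; exact: cA'.
- by move=> xi /pos0 xi0; apply: (@is_deriveZ _ _ _ (th t x) s); exact: dth.
- move=> xi /pos0 xi0; have d := dphi1 xi0.
  have -> : (fun xi => s * (x + t * phi1 xi)) = (fun xi => s *: (x + (t *: phi1 xi))) by [].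
  apply: (is_derive_eq (is_deriveZ s (is_deriveD (is_derive_cst x xi 1) (is_deriveZ t d)))).
  by rewrite /GRing.scale/= add0r mulrA.
- move=> xi /pos0 xi0; apply: continuousM; first exact: cst_continuous.
  exact: cphi2.
- move=> xi /[dup] /pos0 xi0 /[dup] /pos xi1; rewrite in_itv/= => /andP[pxi _].
  split; [exact: A0|by apply: leA => //; exact: lt_le_trans p1|].
  by rewrite oppr_le0 invr_ge0 !mulr_ge0 ?sqrtr_ge0// ltW.
- move=> xi /[dup] /pos xi1; rewrite in_itv/= => /hl h; split => //.
  by rewrite mulrA mulr_ge0// ?phi2_ge0//; move: sgst; rewrite mulrA.
Qed.

Let Rintegral_f_le t x p q (M : R) : 1 <= p -> p <= q -> A p <= M ->
  `|\int[mu]_(xi in `[p, q]) f t x xi| <= M * (q - p).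
Proof.
move=> p1 pq AM; apply: Rintegral_itv_le => //; first exact: integrable_f.
move=> xi; rewrite in_itv/= => /andP[pxi _].
rewrite (le_trans (fA _ _ _))// (le_trans _ AM)// leA//.
exact: lt_le_trans p1.
Qed.

(* Away from the stationary point [c] the phase derivative is at least
   [eta^-1], while the window of width [eta] around [c] is estimated trivially. *)
Let second_derivative_test t x (r eta : R) p q : 1 <= p -> p <= q -> t < 0 ->
  0 < r -> r / 4 <= p -> 0 < eta -> - t * r * eta = eta^-1 ->
  `|\int[mu]_(xi in `[p, q]) f t x xi| <= 10 * A (r / 4) * eta.
Proof.
move=> p1 pq t0 r0 rp eta0 heta.
have r40 : 0 < r / 4 by rewrite divr_gt0.
have half a b s : p <= a -> a <= b -> `|s| = 1 ->
    (forall xi, a <= xi <= b -> eta^-1 <= s * (x + t * phi1 xi)) ->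
    `|\int[mu]_(xi in `[a, b]) f t x xi| <= 4 * A (r / 4) * eta.
  move=> pa ab s1 hs.
  have a1 : 1 <= a by exact: le_trans pa.
  have ei : 0 < eta^-1 by rewrite invr_gt0.
  apply: (le_trans (first_derivative_test a1 ab ei s1 hs)).
  rewrite invrK ler_pM2r// ler_pM2l// leA// (le_trans rp)//.
have window a b : p <= a -> a <= b -> b - a <= eta ->
    `|\int[mu]_(xi in `[a, b]) f t x xi| <= A (r / 4) * eta.
  move=> pa ab abeta; have a1 : 1 <= a by exact: le_trans pa.
  apply: (le_trans (@Rintegral_f_le t x a b (A (r / 4)) a1 ab _)).
    by rewrite leA// (le_trans rp).
  by rewrite ler_wpM2l.
(* [r / 4 <= p] means [4 * p >= r], so by [phi1_incr] the phase derivative decreases at rate at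
   least [- t * r]: across a length [eta] it changes by at least [eta^-1]. *)
have thd a b : p <= a -> a <= b ->
    - t * r * (b - a) <= (x + t * phi1 a) - (x + t * phi1 b).
  move=> pa ab; have := phi1_incr p1 pa ab.
  have : 0 <= (4 * p - r) * (b - a) by rewrite mulr_ge0 ?subr_ge0//; lra.
  move=> h1 h2.
  have -> : x + t * phi1 a - (x + t * phi1 b) = - t * (phi1 b - phi1 a) by ring.
  rewrite -mulrA ler_wpM2l ?oppr_ge0 ?(ltW t0)//; lra.
have left c : p <= c <= q -> 0 <= x + t * phi1 c ->
    `|\int[mu]_(xi in `[p, c]) f t x xi| <= 5 * A (r / 4) * eta.
  move=> /andP[pc cq] hc.
  have Aeta : 0 <= A (r / 4) * eta by rewrite mulr_ge0// ltW.
  have [cp|cp] := leP (c - p) eta.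
    by apply: (le_trans (window p c _ pc cp)) => //; lra.
  have pce : p <= c - eta by lra.
  have cec : c - eta <= c by lra.
  rewrite (Rintegral_itv_split pce cec); last exact: integrable_f.
  have -> : 5 * A (r / 4) * eta = 4 * A (r / 4) * eta + A (r / 4) * eta by ring.
  apply: (le_trans (ler_normD _ _)); apply: lerD.
    apply: (half _ _ 1) => //; first by rewrite normr1.
    move=> xi /andP[pxi xic]; rewrite mul1r.
    have xc : xi <= c by exact: le_trans cec.
    have := thd xi c pxi xc; rewrite -heta.
    have : 0 <= - t * r * (c - xi - eta).
      by rewrite !mulr_ge0 ?oppr_ge0 ?(ltW t0) ?(ltW r0)//; lra.
    by move=> *; lra.
  by apply: window => //; lra.
have right c : p <= c <= q -> x + t * phi1 c <= 0 ->
    `|\int[mu]_(xi in `[c, q]) f t x xi| <= 5 * A (r / 4) * eta.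
  move=> /andP[pc cq] hc.
  have Aeta : 0 <= A (r / 4) * eta by rewrite mulr_ge0// ltW.
  have [cp|cp] := leP (q - c) eta.
    by apply: (le_trans (window c q pc _ cp)) => //; lra.
  have ceq : c + eta <= q by lra.
  have cce : c <= c + eta by lra.
  rewrite (Rintegral_itv_split cce ceq); last exact/integrable_f/(le_trans p1).
  have -> : 5 * A (r / 4) * eta = A (r / 4) * eta + 4 * A (r / 4) * eta by ring.
  apply: (le_trans (ler_normD _ _)); apply: lerD.
    by apply: window => //; lra.
  apply: (half _ _ (-1)) => //; first exact: le_trans cce.
    by rewrite normrN1.
  move=> xi /andP[pxi xic]; rewrite mulN1r.
  have xc : c <= xi by exact: le_trans pxi.
  have := thd c xi pc xc; rewrite -heta.
  have : 0 <= - t * r * (xi - c - eta).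
    by rewrite !mulr_ge0 ?oppr_ge0 ?(ltW t0) ?(ltW r0)//; lra.
  by move=> *; lra.
have Aeta : 0 <= A (r / 4) * eta by rewrite mulr_ge0// ltW.
(* The phase derivative decreases on [[p, q]]. Either it keeps one sign and one half of the argument
   suffices, or it has a zero [c], at which the interval is cut. *)
have [hq|hq] := leP 0 (x + t * phi1 q).
  by apply: (le_trans (left q _ hq)); rewrite ?pq ?lexx//; lra.
have [hp|hp] := leP (x + t * phi1 p) 0.
  by apply: (le_trans (right p _ hp)); rewrite ?pq ?lexx//; lra.
have [c cpq hc] : exists2 c, c \in `[p, q] & x + t * phi1 c = 0.
  apply: (@IVT _ (fun xi => x + t * phi1 xi)) => //.
    apply: itv_within_continuous => xi; rewrite in_itv/= => /andP[pxi _].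
    have xi0 : 0 < xi by rewrite (lt_le_trans ltr01)// (le_trans p1).
    apply: continuousD; first exact: cst_continuous.
    apply: continuousM; first exact: cst_continuous.
    exact: is_derive_continuous (dphi1 xi0).
  by rewrite ge_min le_max (ltW hq) (ltW hp) orbT.
have /andP[pc cq] : p <= c <= q by rewrite in_itv/= in cpq.
rewrite (Rintegral_itv_split pc cq); last exact: integrable_f.
have -> : 10 * A (r / 4) * eta = 5 * A (r / 4) * eta + 5 * A (r / 4) * eta by ring.
apply: (le_trans (ler_normD _ _)); apply: lerD.
  by apply: left; rewrite ?pc ?cq// hc.
by apply: right; rewrite ?pc ?cq// hc.
Qed.

(** Below 1/x no oscillation is used: the amplitude alone integrates to at most
    [2 * Num.sqrt x^-1]. *)
Let kernel_low t x : 0 < x -> x <= 1 ->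
  int_bounded (f t x) (fun xi => 1 <= xi /\ xi <= x^-1) (2 / Num.sqrt x).
Proof.
move=> x0 x1 p q pq hpq.
have p1 : 1 <= p by have [] := hpq p; rewrite ?lexx.
have qx : q <= x^-1 by have [] := hpq q; rewrite ?lexx ?pq.
have p0 : 0 < p by exact: lt_le_trans p1.
have pos xi : xi \in `[p, q] -> 0 < xi.
  by rewrite in_itv/= => /andP[+ _]; exact: lt_le_trans.
have dS : {in `[p, q], forall xi, is_derive xi 1 (fun z => 2 * Num.sqrt z) (A xi)}.
  move=> xi /pos xi0; have := is_deriveZ 2 (is_derive1_sqrt xi0).
  move=> h; apply: (is_derive_eq h); rewrite /GRing.scale/= /A; field.
  by rewrite gt_eqF// sqrtr_gt0.
have cA_ : {in `[p, q], forall xi, {for xi, continuous A}}.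
  by move=> xi /pos; exact: cA.
have fi := integrable_f t x q p1.
have Ai := itv_integrable cA_.
apply: (le_trans (le_norm_Rintegral _ fi Ai _)) => //.
rewrite (Rintegral_derive pq dS cA_).
have : Num.sqrt q <= (Num.sqrt x)^-1 by rewrite -sqrtrV ?(ltW x0)//; exact: ler_wsqrtr.
have := sqrtr_ge0 p; lra.
Qed.

(** Beyond 1/x the amplitude is at most [Num.sqrt x]. If t >= 0, the phase derivative is at least x.
    If t < 0, let r satisfy [- t * r ^+ 2 = x]: up to r/4 the derivative is at least x/2, beyond r
    it is at most -x, and in between the second derivative test applies. The three regions
    contribute 8, 20 and 4 times [(Num.sqrt x)^-1]. *)
Let kernel_high t x : 0 < x -> x <= 1 ->
  int_bounded (f t x) (fun xi => 1 <= xi /\ x^-1 <= xi) (32 / Num.sqrt x).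
Proof.
move=> x0 x1.
have y0 : 0 < Num.sqrt x by rewrite sqrtr_gt0.
have yx : Num.sqrt x ^+ 2 = x by rewrite sqr_sqrtr// ltW.
have Ax xi : x^-1 <= xi -> A xi <= Num.sqrt x.
  move=> xxi; rewrite (le_trans (leA _ xxi)) ?invr_gt0//.
  by rewrite /A sqrtrV ?invrK// ltW.
have sqx : Num.sqrt x / x = (Num.sqrt x)^-1.
  by rewrite -{2}yx expr2 invfM mulrA divff ?mul1r// gt_eqF.
have [t0|t0] := leP 0 t.
  move=> p q pq hpq.
  have [p1 xp] : 1 <= p /\ x^-1 <= p by apply: hpq; rewrite ?lexx.
  apply: (le_trans (@first_derivative_test t x p q 1 x p1 pq x0 (normr1 _) _)).
    move=> xi /andP[pxi _]; rewrite mul1r lerDl mulr_ge0//.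
    have /andP[h _] := phi1_bounds (le_trans p1 pxi).
    by apply: le_trans h; rewrite mulr_ge0// sqr_ge0.
  rewrite -sqx mulrA ler_pM2r ?invr_gt0//.
  have := Ax p xp; lra.
have ta0 : 0 < - t by rewrite oppr_gt0.
set r := Num.sqrt (x / - t).
have r0 : 0 < r by rewrite sqrtr_gt0 divr_gt0.
have rx : - t * r ^+ 2 = x.
  by rewrite sqr_sqrtr ?divr_ge0 ?ltW// mulrC divfK// gt_eqF.
have cfP xi : 1 <= xi -> {for xi, continuous (f t x)}.
  by move=> xi1; apply: cf; exact: lt_le_trans xi1.
have -> : 32 / Num.sqrt x = 8 / Num.sqrt x + (20 / Num.sqrt x + 4 / Num.sqrt x) by lra.
have inv0 (k : R) : 0 <= k -> 0 <= k / Num.sqrt x by move=> k0; rewrite divr_ge0// ltW.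
have h8 := inv0 8 (ler0n _ _); have h20 := inv0 20 (ler0n _ _).
have h4 := inv0 4 (ler0n _ _); have h24 := addr_ge0 h20 h4.
refine (@int_bounded_split _ _ _ (r / 4) _ _ h8 h24 _ _ _).
- by move=> xi []; auto.
- move=> p q pq hpq.
  have [[p1 xp] _] : (1 <= p /\ x^-1 <= p) /\ p <= r / 4 by apply: hpq; rewrite ?lexx.
  have x2 : 0 < x / 2 by rewrite divr_gt0.
  apply: (le_trans (@first_derivative_test t x p q 1 (x / 2) p1 pq x2 (normr1 _) _)).
    move=> xi /[dup] /hpq[_ xir] /andP[pxi _]; rewrite mul1r.
    have xi1 := le_trans p1 pxi.
    have /andP[_ h] := phi1_bounds xi1.
    have h2 : xi ^+ 2 <= r ^+ 2 / 16.
      have -> : r ^+ 2 / 16 = (r / 4) ^+ 2 by field.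
      by rewrite ler_sqr// nnegrE ?divr_ge0 ?(ltW r0)// (le_trans ler01).
    have : - t * phi1 xi <= - t * (r ^+ 2 / 4).
      by rewrite ler_pM2l//; lra.
    lra.
  have -> : 4 * A p / (x / 2) = 8 * (A p / x) by field; rewrite gt_eqF.
  by rewrite -sqx ler_pM2l// ler_pM2r ?invr_gt0//; exact: Ax.
- refine (@int_bounded_split _ _ _ r _ _ h20 h4 _ _ _).
  + by move=> xi [[]]; auto.
  + move=> p q pq hpq.
    have [[[p1 xp] rp] _] :
      ((1 <= p /\ x^-1 <= p) /\ r / 4 <= p) /\ p <= r by apply: hpq; rewrite ?lexx.
    (* The solution of [- t * r * eta = eta^-1]. As [A (r / 4) = 2 / Num.sqrt r], the bound
       [10 * A (r / 4) * eta] becomes 20 / sqrt (- t r^2) = 20 / sqrt x. *)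
    pose eta := (Num.sqrt (- t * r))^-1.
    have tr0 : 0 < - t * r by rewrite mulr_gt0.
    have sr0 : 0 < Num.sqrt (- t * r) by rewrite sqrtr_gt0.
    have eta0 : 0 < eta by rewrite invr_gt0.
    apply: (le_trans (@second_derivative_test t x r eta p q p1 pq t0 r0 rp eta0 _)).
      rewrite /eta invrK -{1}(sqr_sqrtr (ltW tr0)) expr2 mulfK// gt_eqF//.
    have -> : Num.sqrt x = Num.sqrt (- t * r) * Num.sqrt r.
      by rewrite -sqrtrM ?(ltW tr0)// -mulrA -expr2 rx.
    have -> : A (r / 4) = 2 / Num.sqrt r.
      rewrite /A sqrtrM ?(ltW r0)// sqrtrV//.
      have -> : (4 : R) = 2 ^+ 2 by lra.
      rewrite sqrtr_sqr ger0_norm//; field; rewrite gt_eqF// sqrtr_gt0//.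
    rewrite /eta le_eqVlt; apply/orP; left; apply/eqP; field.
    by rewrite !gt_eqF// sqrtr_gt0.
  + move=> p q pq hpq.
    have [[[p1 xp] _] rp] :
      ((1 <= p /\ x^-1 <= p) /\ r / 4 <= p) /\ r <= p by apply: hpq; rewrite ?lexx.
    apply: (le_trans (@first_derivative_test t x p q (-1) x p1 pq x0 (normrN1 _) _)).
      move=> xi /[dup] /hpq[_ xir] /andP[pxi _]; rewrite mulN1r.
      have xi1 := le_trans p1 pxi.
      have /andP[h _] := phi1_bounds xi1.
      have h2 : r ^+ 2 <= xi ^+ 2.
        by rewrite ler_sqr// nnegrE ?(ltW r0)// (le_trans ler01).
      have : - t * (2 * r ^+ 2) <= - t * phi1 xi.
        by rewrite ler_pM2l//; lra.
      lra.
    rewrite -sqx mulrA ler_pM2r ?invr_gt0//.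
    have := Ax p xp; lra.
Qed.

Lemma oscillatory_kernel t x q : 0 < x -> x <= 1 -> 1 <= q ->
  `|\int[mu]_(xi in `[1, q]) ((Num.sqrt xi)^-1 *
      cos (x * xi + t * (xi ^+ 3 + e * xi^-1)))| <= 34 / Num.sqrt x.
Proof.
move=> x0 x1 q1.
have y0 : 0 < Num.sqrt x by rewrite sqrtr_gt0.
have -> : 34 / Num.sqrt x = 2 / Num.sqrt x + 32 / Num.sqrt x by lra.
have h2 : 0 <= 2 / Num.sqrt x by rewrite divr_ge0// ltW.
have h32 : 0 <= 32 / Num.sqrt x by rewrite divr_ge0// ltW.
apply: (@int_bounded_split _ (f t x) (fun xi => 1 <= xi) x^-1 _ _ h2 h32) => //.
- by move=> xi xi1; apply: cf; exact: lt_le_trans xi1.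
- exact: kernel_low.
- exact: kernel_high.
- by move=> xi /andP[].
Qed.

End OscillatoryKernel.

(** * The finite TT* argument with Schur's test *)

Section TTstar.
Context d (T : measurableType d) (R : realType).
Variables (mu : {measure set T -> \bar R}) (D : set T) (mD : measurable D).
Variables (n : nat) (c s : 'I_n -> T -> R) (u v w : T -> R) (kappa : R).
Hypothesis mc : forall i, measurable_fun D (c i).
Hypothesis ms : forall i, measurable_fun D (s i).
Hypothesis c1 : forall i x, `|c i x| <= 1.
Hypothesis s1 : forall i x, `|s i x| <= 1.
Hypothesis mu_ : measurable_fun D u.
Hypothesis mv_ : measurable_fun D v.
Hypothesis w0 : forall x, 0 < w x.
Hypothesis wi : rintegrable mu D w.
Hypothesis uvi : rintegrable mu D (fun x => (u x ^+ 2 + v x ^+ 2) / w x).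

Let S i := \int[mu]_(x in D) (u x * c i x - v x * s i x).
Let K i j := \int[mu]_(x in D) (w x * (c i x * c j x + s i x * s j x)).

Let mw : measurable_fun D w := rintegrable_measurable wi.

(** Since |f| w <= f^2 + w^2, the function |f| is at most [f ^+ 2 / w + w], and both terms are
    integrable on [D]. *)
Lemma weighted_integrable (f : T -> R) : measurable_fun D f ->
  (forall x, f x ^+ 2 <= u x ^+ 2 + v x ^+ 2) -> rintegrable mu D f.
Proof.
move=> mf fuv; apply: (rintegrable_le mD (fun x => (u x ^+ 2 + v x ^+ 2) / w x + w x)) => //.
- move=> x Dx; have w0x := w0 x.
  rewrite -(ler_pM2r w0x) mulrDl divfK ?gt_eqF//.
  apply: (@le_trans _ _ (f x ^+ 2 + w x * w x)); last by rewrite lerD2r.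
  rewrite -real_normK ?num_real//.
  have : 0 <= (`|f x| - w x) ^+ 2 by rewrite sqr_ge0.
  have : 0 <= `|f x| * w x by rewrite mulr_ge0// ltW.
  lra.
- exact: rintegrableD.
Qed.

Let ui : rintegrable mu D u.
Proof. by apply: weighted_integrable => // x; rewrite lerDl sqr_ge0. Qed.

Let vi : rintegrable mu D v.
Proof. by apply: weighted_integrable => // x; rewrite lerDr sqr_ge0. Qed.

Let uci i : rintegrable mu D (fun x => u x * c i x - v x * s i x).
Proof.
apply: rintegrableB => //.
  under eq_fun do rewrite mulrC; exact: (rintegrableMl mD 1).
under eq_fun do rewrite mulrC; exact: (rintegrableMl mD 1).
Qed.

Let wci i j : rintegrable mu D (fun x => w x * (c i x * c j x + s i x * s j x)).
Proof.
under eq_fun do rewrite mulrC; apply: (rintegrableMl mD 2) => //.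
  by apply: measurable_funD; apply: measurable_funM.
move=> x _; rewrite (le_trans (ler_normD _ _))// !normrM.
by apply: (@lerD _ _ 1 _ 1); apply: mulr_ile1.
Qed.

(* Expand 0 <= int ((u - l w P)^2 + (v + l w Q)^2) / w with l = 1 / kappa,
   P = sum_i S_i c_i and Q = sum_i S_i s_i; Schur's test bounds the quadratic term. *)
Lemma TTstar_bound : 0 < kappa ->
  (forall i, \sum_(j < n) `|K i j| <= kappa) ->
  \sum_(i < n) S i ^+ 2 <= kappa * \int[mu]_(x in D) ((u x ^+ 2 + v x ^+ 2) / w x).
Proof.
move=> kappa0 hK; pose l := kappa^-1.
pose P x := \sum_(i < n) S i * c i x.
pose Q x := \sum_(i < n) S i * s i x.
set B := \int[mu]_(x in D) _.
set A := \sum_(i < n) _.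
pose I1 := \sum_(i < n) S i * \int[mu]_(x in D) (u x * c i x - v x * s i x).
pose I2 := \sum_(i < n) \sum_(j < n) S i * S j * K i j.
pose g1 x := \sum_(i < n) S i * (u x * c i x - v x * s i x).
pose g2 x := \sum_(i < n) \sum_(j < n) S i * S j * (w x * (c i x * c j x + s i x * s j x)).
have g1i : rintegrable mu D g1 by apply: rintegrable_sum => // i _; exact: rintegrableZl.
have g2i : rintegrable mu D g2.
  by apply: rintegrable_sum => // i _; apply: rintegrable_sum => // j _; exact: rintegrableZl.
have eI1 : \int[mu]_(x in D) g1 x = I1.
  rewrite Rintegral_sum//; last by move=> i _; exact: rintegrableZl.
  by apply: eq_bigr => i _; rewrite RintegralZl//; exact: uci.
have eI2 : \int[mu]_(x in D) g2 x = I2.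
  rewrite Rintegral_sum//; last first.
    by move=> i _; apply: rintegrable_sum => // j _; exact: rintegrableZl.
  apply: eq_bigr => i _; rewrite Rintegral_sum//; last by move=> j _; exact: rintegrableZl.
  by apply: eq_bigr => j _; rewrite RintegralZl//; exact: wci.
have g1E x : g1 x = u x * P x - v x * Q x.
  rewrite /g1 /P /Q !mulr_sumr -sumrB; apply: eq_bigr => i _; ring.
have g2E x : g2 x = w x * (P x ^+ 2 + Q x ^+ 2).
  rewrite /g2 /P /Q !expr2 !mulr_suml -big_split/= mulr_sumr.
  apply: eq_bigr => i _; rewrite !mulr_sumr -big_split/= mulr_sumr.
  by apply: eq_bigr => j _; ring.
have pos : 0 <= B - 2 * l * I1 + l ^+ 2 * I2.
  rewrite -eI1 -eI2 /B -!RintegralZl// -RintegralB//; last exact: rintegrableZl.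
  rewrite -RintegralD//; [|apply: rintegrableB => //; exact: rintegrableZl|exact: rintegrableZl].
  apply: Rintegral_ge0 => x Dx; rewrite g1E g2E.
  have -> : (u x ^+ 2 + v x ^+ 2) / w x - 2 * l * (u x * P x - v x * Q x) +
     l ^+ 2 * (w x * (P x ^+ 2 + Q x ^+ 2)) =
     ((u x - l * w x * P x) ^+ 2 + (v x + l * w x * Q x) ^+ 2) / w x.
    by field; rewrite gt_eqF.
  by rewrite divr_ge0 ?(ltW (w0 x))// addr_ge0// sqr_ge0.
have I1E : I1 = A by apply: eq_bigr => i _; rewrite expr2.
have KC i j : K i j = K j i.
  by apply: eq_Rintegral => x _; rewrite (mulrC (c i x)) (mulrC (s i x)).
(* Schur's test: 2 |S_i S_j| <= S_i^2 + S_j^2, and by symmetry of [K] both halves are controlled by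
   the same row sums. *)
have I2A : I2 <= kappa * A.
  pose h i j := S i ^+ 2 * `|K i j|.
  have h1 : \sum_(i < n) \sum_(j < n) h i j <= kappa * A.
    rewrite mulr_sumr; apply: ler_sum => i _.
    by rewrite -mulr_sumr mulrC ler_wpM2r// sqr_ge0.
  have h2 : \sum_(i < n) \sum_(j < n) h j i <= kappa * A by rewrite exchange_big.
  have : I2 <= \sum_(i < n) \sum_(j < n) (2^-1 * (h i j + h j i)).
    apply: ler_sum => i _; apply: ler_sum => j _.
    rewrite /h (KC j i) -mulrDl mulrA.
    apply: (le_trans (ler_norm _)); rewrite normrM ler_wpM2r// ler_norml.
    have := sqr_ge0 (S i + S j); have := sqr_ge0 (S i - S j).
    by move=> *; apply/andP; split; lra.
  have -> : \sum_(i < n) \sum_(j < n) (2^-1 * (h i j + h j i)) =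
     2^-1 * (\sum_(i < n) \sum_(j < n) h i j + \sum_(i < n) \sum_(j < n) h j i).
    rewrite -big_split/= mulr_sumr; apply: eq_bigr => i _.
    by rewrite -big_split/= mulr_sumr.
  lra.
rewrite I1E in pos.
have : l ^+ 2 * I2 <= l * A.
  have -> : l * A = l ^+ 2 * (kappa * A) by rewrite /l; field; rewrite gt_eqF.
  by rewrite ler_wpM2l// sqr_ge0.
move=> h; have : l * A <= B by lra.
by rewrite /l mulrC ler_pdivrMr// mulrC.
Qed.

End TTstar.

(** * The weighted kernel on symmetric intervals *)

Section PhaseKernel.
Variables (R : realType) (b : bool).
Local Notation mu := (@lebesgue_measure R).
Implicit Types (x y t N xi : R).

Lemma measurable_inv : measurable_fun [set: R] (fun z : R => z^-1).
Proof.
rewrite -(setUv [set (0 : R)]); apply/measurable_funU => //.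
  by apply: measurableC.
split; first exact: measurable_fun_set1.
apply: open_continuous_measurable_fun.
  by apply: closed_openC; exact: (accessible_closed_set1 (hausdorff_accessible (@Rhausdorff R))).
move=> x; rewrite inE/= => /eqP x0.
exact: inv_continuous.
Qed.

Lemma measurable_phase t x : measurable_fun [set: R] (ostrovsky_phase b t x).
Proof.
apply: measurable_funD; first exact: measurable_funM.
apply: measurable_funM => //; apply: measurable_funD.
  exact: measurable_funX.
by apply: measurable_funM => //; exact: measurable_inv.
Qed.

Lemma measurable_cos_phase D t x : measurable_fun D (fun xi => cos (ostrovsky_phase b t x xi)).
Proof.
apply: measurable_funTS.
apply: (@measurableT_comp _ _ _ _ _ _ cos); last exact: measurable_phase.
by apply: continuous_measurable_fun; exact: continuous_cos.
Qed.

Lemma measurable_sin_phase D t x : measurable_fun D (fun xi => sin (ostrovsky_phase b t x xi)).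
Proof.
apply: measurable_funTS.
apply: (@measurableT_comp _ _ _ _ _ _ sin); last exact: measurable_phase.
by apply: continuous_measurable_fun; exact: continuous_sin.
Qed.

Lemma ostrovsky_phaseB t t' x x' xi :
  ostrovsky_phase b t x xi - ostrovsky_phase b t' x' xi =
  ostrovsky_phase b (t - t') (x - x') xi.
Proof. by rewrite /ostrovsky_phase; ring. Qed.

(* The inverse of the weight is at most <xi>^(2 s) exactly when s >= 1/4. *)
Definition weight xi : R := (Num.sqrt (Num.max 1 `|xi|))^-1.

Lemma weight_gt0 xi : 0 < weight xi.
Proof. by rewrite invr_gt0 sqrtr_gt0 lt_max ltr01. Qed.

Lemma weight_le1 xi : weight xi <= 1.
Proof.
by rewrite invf_le1 ?sqrtr_gt0 ?lt_max ?ltr01// -{1}sqrtr1 ler_wsqrtr// le_max lexx.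
Qed.

Lemma measurable_weight : measurable_fun [set: R] weight.
Proof.
have ms : measurable_fun [set: R] (@Num.sqrt R).
  by apply: continuous_measurable_fun; exact: sqrt_continuous.
apply: (measurableT_comp measurable_inv); apply: (measurableT_comp ms).
by apply: measurable_maxr => //; exact: measurableT_comp.
Qed.

Lemma fin_itv_measure (a c : R) : (mu `[a, c]%classic < +oo)%E.
Proof.
rewrite lebesgue_measure_itv/=; case: ifP => _; last exact: ltry.
by rewrite -EFinB ltry.
Qed.

Lemma bounded_rintegrable (f : R -> R) (M a c : R) :
  measurable_fun `[a, c] f -> (forall x, `|f x| <= M) -> rintegrable mu `[a, c] f.
Proof.
move=> mf fM; apply: measurable_bounded_integrable => //; first exact: fin_itv_measure.
exists M; split; first exact: num_real.
by move=> m Mm x _ /=; rewrite (le_trans (fM x))// ltW.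
Qed.

Definition weighted_cos t x xi := weight xi * cos (ostrovsky_phase b t x xi).

Lemma weighted_cos_le1 t x xi : `|weighted_cos t x xi| <= 1.
Proof.
rewrite normrM; apply: mulr_ile1 => //.
  by rewrite ger0_norm ?weight_le1// ltW// weight_gt0.
by rewrite ler_norml cos_geN1 cos_le1.
Qed.

Lemma rintegrable_weighted_cos t x a c : rintegrable mu `[a, c] (weighted_cos t x).
Proof.
apply: (@bounded_rintegrable _ 1); last exact: weighted_cos_le1.
apply: measurable_funM; last exact: measurable_cos_phase.
by apply: measurable_funTS; exact: measurable_weight.
Qed.

Lemma weighted_cosN t x xi : weighted_cos t x (- xi) = weighted_cos t x xi.
Proof.
rewrite /weighted_cos /weight normrN -cosN; congr (_ * cos _).
by rewrite /ostrovsky_phase invrN exprNn -signr_odd/=; ring.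
Qed.

(** Reduces negative x to positive x at the price of reversing t, over which the estimates are
    uniform. *)
Lemma weighted_cos_opp t x xi : weighted_cos t x xi = weighted_cos (- t) (- x) xi.
Proof.
by rewrite /weighted_cos -[in LHS]cosN; congr (_ * cos _); rewrite /ostrovsky_phase; ring.
Qed.

Lemma continuous_weighted_cos t x xi : 1 <= `|xi| -> {for xi, continuous (weighted_cos t x)}.
Proof.
move=> xi1; have xi0 : xi != 0 by rewrite -normr_gt0 (lt_le_trans ltr01).
apply: continuousM.
  apply: continuousV; first by rewrite gt_eqF// sqrtr_gt0 lt_max ltr01.
  apply: (@continuous_comp _ _ _ (fun z : R => Num.max 1 `|z|) Num.sqrt); last exact: sqrt_continuous.
  by apply: continuous_max; [exact: cst_continuous|exact: norm_continuous].
apply: (@continuous_comp _ _ _ (ostrovsky_phase b t x) cos); last exact: continuous_cos.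
apply: continuousD; first by apply: continuousM; [exact: cst_continuous|exact: cvg_id].
apply: continuousM; first exact: cst_continuous.
apply: continuousD; first exact: exprn_continuous.
by apply: continuousM; [exact: cst_continuous|exact: inv_continuous].
Qed.

Let kernel_half t x N : 1 <= N -> 0 < `|x| -> `|x| <= 1 ->
  `|\int[mu]_(xi in `[1, N]) weighted_cos t x xi| <= 34 / Num.sqrt `|x|.
Proof.
move=> N1 x0 x1.
have main t' x' : 0 < x' -> x' <= 1 ->
    `|\int[mu]_(xi in `[1, N]) weighted_cos t' x' xi| <= 34 / Num.sqrt x'.
  move=> x'0 x'1.
  have e1 : `|(-1) ^+ b : R| <= 1 by rewrite normrX normrN1 expr1n.
  rewrite (le_trans _ (oscillatory_kernel e1 t' x'0 x'1 N1))// le_eqVlt.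
  apply/orP; left; apply/eqP; congr `|_|.
  apply: eq_Rintegral => xi; rewrite inE/= in_itv/= => /andP[xi1 _].
  rewrite /weighted_cos /weight ger0_norm ?(le_trans _ xi1)//.
  by rewrite max_r.
have [x0'|x0'] := ltP 0 x; first by rewrite (gtr0_norm x0') in x1 *; exact: main.
have -> : \int[mu]_(xi in `[1, N]) weighted_cos t x xi =
   \int[mu]_(xi in `[1, N]) weighted_cos (- t) (- x) xi.
  by apply: eq_Rintegral => xi _; exact: weighted_cos_opp.
have -> : `|x| = - x by rewrite ler0_norm.
by apply: main; [rewrite -(ler0_norm x0')|rewrite -(ler0_norm x0')].
Qed.

(** The two outer parts cost 34 each, the left one being the mirror image of the right one because
    the phase is odd. The segment [-1, 1] around the singularity of the phase costs its length 2,
    absorbed because [(Num.sqrt |x|)^-1 >= 1]. *)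
Lemma kernel_bound t x N : 0 < `|x| -> `|x| <= 1 ->
  `|\int[mu]_(xi in `[- N, N]) weighted_cos t x xi| <= 70 / Num.sqrt `|x|.
Proof.
move=> x0 x1.
have s0 : 0 < Num.sqrt `|x| by rewrite sqrtr_gt0.
have s1 : Num.sqrt `|x| <= 1 by rewrite -sqrtr1 ler_wsqrtr.
have i1 : 1 <= (Num.sqrt `|x|)^-1 by rewrite invr_ge1 ?unitf_gt0//.
have triv a c : a <= c -> `|\int[mu]_(xi in `[a, c]) weighted_cos t x xi| <= c - a.
  move=> ac; rewrite -[leRHS]mul1r; apply: Rintegral_itv_le => //.
    exact: rintegrable_weighted_cos.
  by move=> xi _; exact: weighted_cos_le1.
have [N0|N0] := ltP N 0.
  rewrite set_itv_ge; last by rewrite bnd_simp -ltNge; lra.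
  rewrite Rintegral_set0 normr0; lra.
have [N1|N1] := ltP N 1.
  by apply: (le_trans (triv _ _ _)); lra.
rewrite (@Rintegral_itv_split _ _ _ (-1))//; try lra; last exact: rintegrable_weighted_cos.
rewrite (@Rintegral_itv_split _ _ (-1) 1)//; try lra; last exact: rintegrable_weighted_cos.
have -> : \int[mu]_(xi in `[- N, -1]) weighted_cos t x xi =
          \int[mu]_(xi in `[1, N]) weighted_cos t x xi.
  rewrite /Rintegral integration_by_substitution_oppr//.
    by congr fine; apply: eq_integral => xi _ /=; rewrite weighted_cosN.
  apply: itv_within_continuous => xi; rewrite in_itv/= => /andP[_ xi1].
  by apply: continuous_weighted_cos; rewrite ler0_norm; lra.
have k := kernel_half t N1 x0 x1.
have k1 := triv (-1) 1.
rewrite (le_trans (ler_normD _ _))// (le_trans (lerD (lexx _) (ler_normD _ _)))//.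
have : `|\int[mu]_(xi in `[-1, 1]) weighted_cos t x xi| <= 2.
  by apply: (le_trans (k1 _)); lra.
lra.
Qed.

Lemma kernel_trivial_bound t x N L : N <= L -> 0 <= L ->
  `|\int[mu]_(xi in `[- N, N]) weighted_cos t x xi| <= 2 * L.
Proof.
move=> NL L0.
have [N0|N0] := ltP N 0.
  rewrite set_itv_ge; last by rewrite bnd_simp -ltNge; lra.
  by rewrite Rintegral_set0 normr0; lra.
apply: (@le_trans _ _ (1 * (N - - N))); last lra.
apply: Rintegral_itv_le => //; first lra.
  exact: rintegrable_weighted_cos.
by move=> xi _; exact: weighted_cos_le1.
Qed.

End PhaseKernel.

(** * The estimate on a grid of points *)

Section Grid.
Variables (R : realType).
Local Notation mu := (@lebesgue_measure R).
Implicit Types (x y t N xi : R).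

(** With a and b the roots of m and m - 1, this is (a - b)^2 >= 0 combined with a^2 - b^2 = 1. It
    makes sums of inverse square roots telescope. *)
Lemma inv_sqrt_le_diff (m : nat) : (0 < m)%N ->
  (Num.sqrt (m%:R : R))^-1 <= 2 * Num.sqrt m%:R - 2 * Num.sqrt (m.-1)%:R.
Proof.
case: m => // m _ /=.
have s0 : 0 < Num.sqrt (m.+1%:R : R) by rewrite sqrtr_gt0.
have a2 : Num.sqrt (m.+1%:R : R) ^+ 2 = m%:R + 1 by rewrite sqr_sqrtr// -natr1.
have b2 : Num.sqrt (m%:R : R) ^+ 2 = m%:R by rewrite sqr_sqrtr.
rewrite -[X in X <= _]mul1r ler_pdivrMr//.
have := sqr_ge0 (Num.sqrt (m.+1%:R : R) - Num.sqrt m%:R).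
rewrite sqrrB a2 b2 mulrBl -!mulrA -expr2 a2 mulr2n; lra.
Qed.

Lemma sum_inv_sqrt_dist (n : nat) (i : 'I_n) :
  \sum_(k < n | k != i) (Num.sqrt `|i%:R - k%:R|)^-1 <= 4 * Num.sqrt (n%:R : R).
Proof.
(* Natural subtraction truncates at 0: only the second root varies to the left of [i], only the
   first to its right, and [h i.+1 = h i]. One telescoping sum thus covers both sides and skips the
   diagonal. *)
pose h (k : nat) : R := 2 * Num.sqrt (k - i.+1)%:R - 2 * Num.sqrt (i - k)%:R.
have le_sqrt (a c : nat) : (a <= c)%N -> Num.sqrt (a%:R : R) <= Num.sqrt c%:R.
  by move=> ac; rewrite ler_wsqrtr// ler_nat.
apply: (@le_trans _ _ (\sum_(k < n) (h k.+1 - h k))).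
  rewrite big_mkcond/=; apply: ler_sum => k _; case: ifPn => ki; rewrite /h.
    have [ik|ik|/val_inj ik] := ltngtP k i; last by rewrite ik eqxx in ki.
    - have -> : (k.+1 - i.+1 = 0)%N by rewrite subSS; apply/eqP; rewrite subn_eq0 ltnW.
      have -> : (k - i.+1 = 0)%N by apply/eqP; rewrite subn_eq0 leqW// ltnW.
      have -> : (i - k.+1 = (i - k).-1)%N by rewrite subnS.
      rewrite -natrB; last exact: ltnW.
      rewrite ger0_norm// sqrtr0 mulr0 !sub0r opprK addrC.
      by apply: inv_sqrt_le_diff; rewrite subn_gt0.
    - have -> : (i - k.+1 = 0)%N by apply/eqP; rewrite subn_eq0 leqW// ltnW.
      have -> : (i - k = 0)%N by apply/eqP; rewrite subn_eq0 ltnW.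
      rewrite subSS subnS distrC -natrB; last exact: ltnW.
      rewrite ger0_norm// sqrtr0 mulr0 !subr0.
      by apply: inv_sqrt_le_diff; rewrite subn_gt0.
  move/negPn/eqP : ki => ->.
  rewrite subnn.
  have -> : (i - i.+1 = 0)%N by apply/eqP; rewrite subn_eq0.
  by rewrite subnn subrr.
rewrite -(big_mkord xpredT (fun k => h k.+1 - h k)) telescope_sumr// /h.
have h1 := le_sqrt _ _ (leq_subr i.+1 n).
have h2 := le_sqrt _ _ (ltnW (ltn_ord i)).
have h3 := sqrtr_ge0 ((i - n)%:R : R).
by rewrite sub0n sqrtr0 subn0; lra.
Qed.

Variable (b : bool).

(* Up to the factor (2 pi)^(-1/2), the real part of the truncated solution with
   density u + i v; the imaginary part is obtained from v + i (- u). *)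
Definition osc (u v : R -> R) t x N : R :=
  \int[mu]_(xi in `[- N, N])
    (u xi * cos (ostrovsky_phase b t x xi) - v xi * sin (ostrovsky_phase b t x xi)).

Lemma mem_sym_itv N xi : (xi \in `[- N, N]%classic) = (`|xi| <= N).
Proof. by rewrite mem_setE in_itv/= ler_norml. Qed.

(** Moves the truncation into the integrand, so that integrals with different [N] live on one
    interval, as the TT* argument requires. *)
Lemma Rintegral_sub_itv (f : R -> R) N (L : R) : N <= L ->
  \int[mu]_(xi in `[- L, L]) (f xi * \1_(`[- N, N]%classic) xi) =
  \int[mu]_(xi in `[- N, N]) f xi.
Proof.
move=> NL.
rewrite -[in RHS](@setIidr _ `[- L, L]%classic `[- N, N]%classic); last first.
  move=> xi /=; rewrite !in_itv/= => /andP[h1 h2].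
  by apply/andP; split; lra.
by rewrite Rintegral_mkcondr; apply: eq_Rintegral => xi _; rewrite patch_indic.
Qed.

Definition weighted_l2 (u v : R -> R) xi := (u xi ^+ 2 + v xi ^+ 2) / weight xi.

Lemma weighted_l2_ge0 u v xi : 0 <= weighted_l2 u v xi.
Proof. by rewrite divr_ge0 ?(ltW (weight_gt0 _))// addr_ge0// sqr_ge0. Qed.

(** The row sums of the kernel are at most 281 n: the diagonal entry is at most [2 * L <= n], and
    the others sum to at most [70 * Num.sqrt n] times [4 * Num.sqrt n]. *)
Lemma osc_grid_bound (u v : R -> R) (n : nat) (t_ N_ : 'I_n -> R) y (L : R) :
  measurable_fun setT u -> measurable_fun setT v ->
  rintegrable mu setT (weighted_l2 u v) ->
  (0 < n)%N -> 0 <= L -> 2 * L <= n%:R -> (forall i, N_ i <= L) ->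
  \sum_(i < n) osc u v (t_ i) (y + i%:R / n%:R) (N_ i) ^+ 2 <=
    281 * n%:R * \int[mu]_xi weighted_l2 u v xi.
Proof.
move=> mu_ mv_ uvi n0 L0 Ln NL.
pose D := `[- L, L]%classic : set R.
have mD : measurable D by exact: measurable_itv.
have n0' : 0 < n%:R :> R by rewrite ltr0n.
pose X (i : 'I_n) := y + i%:R / n%:R.
pose one (i : 'I_n) : R -> R := \1_(`[- N_ i, N_ i]%classic).
pose c i xi := cos (ostrovsky_phase b (t_ i) (X i) xi) * one i xi.
pose s i xi := sin (ostrovsky_phase b (t_ i) (X i) xi) * one i xi.
have mone i : measurable_fun D (one i) by exact: measurable_indic.
have one1 i xi : `|one i xi| <= 1 by rewrite ger0_norm// /one indicE; case: (_ \in _).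
have mc i : measurable_fun D (c i).
  by apply: measurable_funM => //; exact: measurable_cos_phase.
have ms i : measurable_fun D (s i).
  by apply: measurable_funM => //; exact: measurable_sin_phase.
have c1 i xi : `|c i xi| <= 1.
  by rewrite normrM mulr_ile1// ler_norml cos_geN1 cos_le1.
have s1 i xi : `|s i xi| <= 1.
  by rewrite normrM mulr_ile1// ler_norml sin_geN1 sin_le1.
have wi : rintegrable mu D (@weight R).
  apply: (@bounded_rintegrable _ _ 1).
    by apply: measurable_funTS; exact: measurable_weight.
  by move=> xi; rewrite ger0_norm ?weight_le1// ltW// weight_gt0.
have uviD : rintegrable mu D (weighted_l2 u v) by exact: integrableS uvi.
have muD : measurable_fun D u by exact: measurable_funTS.
have mvD : measurable_fun D v by exact: measurable_funTS.
have k0 : 0 < 281 * n%:R :> R by apply: mulr_gt0; rewrite ltr0n.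
have := @TTstar_bound _ _ _ mu D mD n c s u v (@weight R) _ mc ms c1 s1 muD mvD
  (@weight_gt0 R) wi uviD k0.
have cE i : \int[mu]_(xi in D) (u xi * c i xi - v xi * s i xi) =
    osc u v (t_ i) (X i) (N_ i).
  rewrite /osc -(@Rintegral_sub_itv _ _ L)//; apply: eq_Rintegral => xi _.
  by rewrite /c /s /one; ring.
(* A product of two truncations is the truncation at the smaller radius, and cos cos + sin sin is
   the cosine of the phase difference, which is the phase at [(t_ i - t_ j, X i - X j)]. *)
have KE i j : \int[mu]_(xi in D) (weight xi * (c i xi * c j xi + s i xi * s j xi)) =
    \int[mu]_(xi in `[- Num.min (N_ i) (N_ j), Num.min (N_ i) (N_ j)])
      weighted_cos b (t_ i - t_ j) (X i - X j) xi.
  have mL : Num.min (N_ i) (N_ j) <= L by rewrite ge_min NL.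
  rewrite -[RHS](Rintegral_sub_itv _ mL).
  apply: eq_Rintegral => xi _.
  have -> : \1_(`[- Num.min (N_ i) (N_ j), Num.min (N_ i) (N_ j)]%classic) xi =
      one i xi * one j xi :> R.
    rewrite /one !indicE -natrM mulnb; congr (_ %:R).
    by rewrite !mem_sym_itv le_min.
  rewrite /weighted_cos -ostrovsky_phaseB cosB /c /s; ring.
move=> H; apply: (le_trans _ (le_trans (H _) _)); last first.
- rewrite ler_wpM2l ?(ltW k0)//.
  exact: (@Rintegral_subset _ _ _ mu setT measurableT D (weighted_l2 u v) mD
    (@subsetT _ D) uvi (weighted_l2_ge0 u v)).
- move=> i.
  rewrite (bigD1 i)//= KE subrr.
  have -> : 281 * n%:R = n%:R + 280 * n%:R :> R by ring.
  apply: lerD.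
    by apply: le_trans Ln; apply: kernel_trivial_bound => //; rewrite ge_min NL.
  apply: (@le_trans _ _ (\sum_(j < n | j != i)
     70 * Num.sqrt n%:R * (Num.sqrt `|i%:R - j%:R|)^-1)); last first.
    rewrite -mulr_sumr.
    have := sum_inv_sqrt_dist i => h.
    have s0 := sqrtr_ge0 (n%:R : R).
    have -> : 280 * n%:R = 70 * Num.sqrt n%:R * (4 * Num.sqrt n%:R) :> R.
      rewrite -[in LHS](@sqr_sqrtr _ (n%:R : R))//; ring.
    by rewrite ler_wpM2l// mulr_ge0.
  apply: ler_sum => j ji; rewrite KE.
  have XE : X i - X j = (i%:R - j%:R) / n%:R by rewrite /X; ring.
  have ij0 : 0 < `|i%:R - j%:R : R|.
    by rewrite normr_gt0 subr_eq0 eqr_nat eq_sym.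
  have ijn : `|i%:R - j%:R : R| <= n%:R.
    have := ltn_ord i; have := ltn_ord j; rewrite -!(ltr_nat R) => h1 h2.
    have := ler0n R i; have := ler0n R j => h3 h4.
    by rewrite ler_norml; apply/andP; split; lra.
  have nXE : `|X i - X j| = `|i%:R - j%:R| / n%:R.
    by rewrite XE normrM normfV [`|n%:R|]ger0_norm.
  have hx0 : 0 < `|X i - X j| by rewrite nXE divr_gt0.
  have hx1 : `|X i - X j| <= 1 by rewrite nXE ler_pdivrMr// mul1r.
  apply: (le_trans (kernel_bound b _ _ hx0 hx1)).
  rewrite nXE sqrtrM// sqrtrV// invfM invrK.
  rewrite le_eqVlt; apply/orP; left; apply/eqP; ring.
- by apply: ler_sum => i _; rewrite cE.
Qed.

End Grid.

(** * The maximal function *)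

Section Shift.
Variable R : realType.
Local Notation mu := (@lebesgue_measure R).

Lemma shift_preimage_itv (h a c : R) (b0 b1 : bool) :
  (fun y => y + h) @^-1` [set` Interval (BSide b0 a) (BSide b1 c)] =
  [set` Interval (BSide b0 (a - h)) (BSide b1 (c - h))].
Proof.
by apply/seteqP; split => y /=; rewrite !in_itv/= lteifBlDr lteifBrDr.
Qed.

Lemma lebesgue_measure_shift (h : R) (A : set R) : measurable A ->
  pushforward mu ((fun y => y + h) : _ -> measurableTypeR R) A = mu A.
Proof.
move=> mA; apply/esym.
have mh : measurable_fun [set: measurableTypeR R] (fun y : measurableTypeR R => y + h : measurableTypeR R).
  by apply: measurable_funD.
pose mh_mixin := isMeasurableFun.Build _ _ _ _ _ mh.
pose mh_pack := MeasurableFun.Pack (MeasurableFun.Class mh_mixin).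
have := @lebesgue_measure_unique R (pushforward mu mh_pack) _ _ mA.
apply => /= _ [[a c]] _ <-.
rewrite /pushforward shift_preimage_itv/= !lebesgue_measure_itv/=.
by rewrite !lte_fin ltrD2r -!EFinB opprB addrA addrNK.
Qed.

Lemma ge0_integral_shift (h a c : R) (f : R -> \bar R) :
  measurable_fun setT f -> (forall x, 0 <= f x)%E ->
  (\int[mu]_(y in `[a, c[) f (y + h)%R = \int[mu]_(y in `[(a + h)%R, (c + h)%R[) f y)%E.
Proof.
move=> mf f0.
have mh : measurable_fun [set: measurableTypeR R] (fun y : measurableTypeR R => y + h : measurableTypeR R).
  by apply: measurable_funD.
have -> : `[a, c[%classic = (fun y : measurableTypeR R => y + h : measurableTypeR R) @^-1` `[a + h, c + h[.
  by rewrite shift_preimage_itv !addrK.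
rewrite -(@ge0_integral_pushforward _ _ _ _ _ _ mh mu _ f)//=; last exact: measurable_funTS.
apply: eq_measure_integral => //= A mA _; exact: lebesgue_measure_shift.
Qed.

(* Bounds for sums over every translate of a grid of step 1/n thus become bounds
   for the integral over a unit interval. *)
Lemma ge0_integral_grid (a : R) (n : nat) (f : R -> \bar R) : (0 < n)%N ->
  measurable_fun setT f -> (forall x, 0 <= f x)%E ->
  (\int[mu]_(x in `[a, (a + 1)%R[) f x =
   \int[mu]_(y in `[a, (a + n%:R^-1)%R[) \sum_(i < n) f (y + i%:R / n%:R)%R)%E.
Proof.
move=> n0 mf f0; have n0' : 0 < n%:R :> R by rewrite ltr0n.
have main m : (\int[mu]_(x in `[a, (a + m%:R / n%:R)%R[) f x =
   \sum_(i < m) \int[mu]_(y in `[a, (a + n%:R^-1)%R[) f (y + i%:R / n%:R)%R)%E.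
  elim: m => [|m ih].
    by rewrite big_ord0 mul0r addr0 set_itvco0 integral_set0.
  rewrite big_ord_recr/= -ih ge0_integral_shift//.
  have -> : a + n%:R^-1 + m%:R / n%:R = a + m.+1%:R / n%:R :> R.
    by rewrite -natr1; field; rewrite gt_eqF.
  have am : a <= a + m%:R / n%:R by rewrite lerDl divr_ge0// ltW.
  have mm : a + m%:R / n%:R <= a + m.+1%:R / n%:R.
    by rewrite lerD2l ler_pM2r ?invr_gt0// ler_nat.
  rewrite (@itv_bndbnd_setU _ _ _ (BLeft (a + m%:R / n%:R)))//.
  rewrite ge0_integral_setU//.
  - by apply: measurable_funTS.
  - apply/disj_setPS => x /= [].
    by rewrite !in_itv/= => /andP[_ h1] /andP[h2 _]; have := lt_le_trans h1 h2; rewrite ltxx.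
have := main n; rewrite divff ?gt_eqF// => ->.
rewrite ge0_integral_sum// => i.
apply: measurable_funTS; apply: measurableT_comp => //.
by apply: measurable_funD.
Qed.

End Shift.

(** * The maximal function and its bound on unit intervals *)

Section Maximal.
Variable R : realType.
Local Notation mu := (@lebesgue_measure R).

(** The choices at different indices are independent, so a bound valid for every selection passes to
    the sum of the suprema. Only finitely many choices are made at a time, for a fixed translate of
    the grid. *)
Lemma sum_ereal_sup_le (I : Type) (P : set I) (n : nat) (X : 'I_n -> I -> R) (K : R) :
  P !=set0 -> (forall i p, 0 <= X i p) ->
  (forall sel : 'I_n -> I, (forall i, P (sel i)) -> \sum_(i < n) X i (sel i) <= K) ->
  (\sum_(i < n) ereal_sup [set (X i p)%:E | p in P] <= K%:E)%E.
Proof.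
move=> [p0 Pp0]; elim: n X K => [|n ih] X K X0 h.
  by rewrite big_ord0 lee_fin; have := h (fun=> p0) (fun=> Pp0); rewrite big_ord0.
rewrite big_ord_recl.
set rest := (\sum_(i < n) _)%E.
have restK p : P p -> (rest <= (K - X ord0 p)%:E)%E.
  move=> Pp; apply: ih => [i q|sel Psel]; first exact: X0.
  pose sel' i := oapp sel p (unlift ord0 i).
  have := h sel'; rewrite big_ord_recl /sel' unlift_none/=.
  under eq_bigr do rewrite liftK/=.
  rewrite lerBrDl; apply => i.
  by case: unliftP => [j _|_] /=.
have rest0 : (0 <= rest)%E.
  apply: sume_ge0 => i _; apply: le_ereal_sup_tmp.
  by exists (X (lift ord0 i) p0)%:E; [exists p0|rewrite lee_fin].
have restf : rest \is a fin_num.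
  by rewrite ge0_fin_numE// (le_lt_trans (restK _ Pp0))// ltry.
rewrite -leeBrDr//; apply: ge_ereal_sup => _ [p Pp <-].
by rewrite leeBrDr// -leeBrDl// -EFinB; exact: restK.
Qed.

Variables (b : bool) (u v : R -> R).
Hypothesis mu_ : measurable_fun setT u.
Hypothesis mv_ : measurable_fun setT v.
Hypothesis uvi : rintegrable mu setT (weighted_l2 u v).
Implicit Types (t x N xi : R).

Let wi N : rintegrable mu `[- N, N] (@weight R).
Proof.
apply: (@bounded_rintegrable _ _ 1).
  by apply: measurable_funTS; exact: measurable_weight.
by move=> xi; rewrite ger0_norm ?weight_le1// ltW// weight_gt0.
Qed.

Let uviD N : rintegrable mu `[- N, N] (weighted_l2 u v).
Proof. exact: integrableS uvi. Qed.

Lemma rintegrable_itv_re N : rintegrable mu `[- N, N] u.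
Proof.
refine (@weighted_integrable _ _ _ mu _ _ u v _ (@weight_gt0 R) (wi N) (uviD N) _ _ _) => //.
- exact: measurable_funTS.
- by move=> x; rewrite lerDl sqr_ge0.
Qed.

Lemma rintegrable_itv_im N : rintegrable mu `[- N, N] v.
Proof.
refine (@weighted_integrable _ _ _ mu _ _ u v _ (@weight_gt0 R) (wi N) (uviD N) _ _ _) => //.
- exact: measurable_funTS.
- by move=> x; rewrite lerDr sqr_ge0.
Qed.

Let integrand_integrable (th : R -> R) N : measurable_fun setT th ->
  rintegrable mu `[- N, N] (fun xi => u xi * cos (th xi) - v xi * sin (th xi)).
Proof.
move=> mth.
have mc : measurable_fun [set: R] (@cos R) by apply: continuous_measurable_fun; exact: continuous_cos.
have ms : measurable_fun [set: R] (@sin R) by apply: continuous_measurable_fun; exact: continuous_sin.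
have mD : measurable (`[- N, N]%classic : set R) by exact: measurable_itv.
apply: rintegrableB => //.
  apply: (rintegrableMr _ 1) => //; last exact: rintegrable_itv_re.
    by apply: measurable_funTS; exact: measurableT_comp.
  by move=> x _; rewrite ler_norml cos_geN1 cos_le1.
apply: (rintegrableMr _ 1) => //; last exact: rintegrable_itv_im.
  by apply: measurable_funTS; exact: measurableT_comp.
by move=> x _; rewrite ler_norml sin_geN1 sin_le1.
Qed.

Lemma rintegrable_osc t x N : rintegrable mu `[- N, N]
  (fun xi => u xi * cos (ostrovsky_phase b t x xi) - v xi * sin (ostrovsky_phase b t x xi)).
Proof. by apply: integrand_integrable; exact: measurable_phase. Qed.

(** Stated for any phase continuous in a parameter, to serve both [x] and [t]. The dominating
    function |u| + |v| is integrable on bounded intervals. *)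
Let osc_continuous (th : R -> R -> R) N :
  (forall a, measurable_fun setT (th a)) -> (forall xi, continuous (th ^~ xi)) ->
  continuous (fun a => \int[mu]_(xi in `[- N, N]) (u xi * cos (th a xi) - v xi * sin (th a xi))).
Proof.
move=> mth cth a.
have ia : a \in `]a - 1, a + 1[%classic by rewrite inE/= in_itv/=; apply/andP; split; lra.
have mD : measurable (`[- N, N]%classic : set R) by exact: measurable_itv.
apply: (@continuity_under_integral R _ _ mu
  (fun a xi => u xi * cos (th a xi) - v xi * sin (th a xi)) _ mD (a - 1) (a + 1)
  _ _ (fun xi => `|u xi| + `|v xi|) _ _ a ia).
- by move=> x _; exact: integrand_integrable.
- apply: aeW => xi _ y _; apply: cvgB; apply: cvgM; do ?exact: cvg_cst.
    by apply: (@continuous_comp _ _ _ (th ^~ xi) cos); [exact: cth|exact: continuous_cos].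
  by apply: (@continuous_comp _ _ _ (th ^~ xi) sin); [exact: cth|exact: continuous_sin].
- apply: rintegrableD => //; apply: rintegrable_norm.
    exact: rintegrable_itv_re.
  exact: rintegrable_itv_im.
- move=> x _; apply: aeW => xi _.
  rewrite (le_trans (ler_normB _ _))// !normrM.
  by apply: lerD; rewrite -[leRHS]mulr1 ler_wpM2l// ler_norml ?cos_geN1 ?cos_le1 ?sin_geN1 ?sin_le1.
Qed.

Lemma osc_continuous_space t N : continuous (fun x => osc b u v t x N).
Proof.
refine (@osc_continuous (fun x => ostrovsky_phase b t x) N _ _) => [a|xi y].
  exact: measurable_phase.
by apply: cvgD; [apply: cvgM; [exact: cvg_id|exact: cvg_cst]|exact: cvg_cst].
Qed.

Lemma osc_continuous_time x N : continuous (fun t => osc b u v t x N).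
Proof.
refine (@osc_continuous (fun t => ostrovsky_phase b t x) N _ _) => [a|xi y].
  exact: measurable_phase.
by apply: cvgD; [exact: cvg_cst|apply: cvgM; [exact: cvg_id|exact: cvg_cst]].
Qed.

(** The cap [L] on the truncation radius lets a finite grid, with [2 * L <= n], control every
    choice; the time is unrestricted. *)
Definition maxosc_le (L : R) x : \bar R :=
  ereal_sup [set (osc b u v p.1 x p.2 ^+ 2)%:E | p in [set p : R * R | p.2 <= L]].

Lemma maxosc_le_ge t x N L : N <= L -> ((osc b u v t x N ^+ 2)%:E <= maxosc_le L x)%E.
Proof. by move=> NL; apply: ereal_sup_ubound; exists (t, N). Qed.

Lemma maxosc_le_ge0 L x : (0 <= maxosc_le L x)%E.
Proof. by apply: le_trans (maxosc_le_ge 0 x (lexx L)); rewrite lee_fin sqr_ge0. Qed.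

(** A supremum of continuous functions of [x], even an uncountable one, is lower semicontinuous. *)
Lemma measurable_maxosc_le L : measurable_fun setT (maxosc_le L).
Proof.
apply: lower_semicontinuous_measurable => x a.
move=> /ereal_sup_gt[_ [[t N] /= NL <-]]; rewrite lte_fin => ax.
exists [set y | a < osc b u v t y N ^+ 2].
  have cx := @osc_continuous_space t N x.
  have cx2 : osc b u v t y N ^+ 2 @[y --> x] --> osc b u v t x N ^+ 2 by exact: (cvgM cx cx).
  exact: (cvgr_gt _ cx2 _ ax).
by move=> y /= ay; apply: lt_le_trans (maxosc_le_ge t y NL); rewrite lte_fin.
Qed.

(** Every translate of a grid with [n >= 2 * L] satisfies a bound proportional to [n]; integrating
    the translation over a length 1/n cancels this factor, so the result is uniform in [L]. *)
Lemma maxosc_le_integral L (a : R) :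
  (\int[mu]_(x in `[a, (a + 1)%R[) maxosc_le L x <=
     (281 * \int[mu]_xi weighted_l2 u v xi)%:E)%E.
Proof.
set B := \int[mu]_xi _.
wlog L0 : L / 0 <= L.
  move=> h; apply: (@le_trans _ _ (\int[mu]_(x in `[a, (a + 1)%R[) maxosc_le (Num.max L 0)%R x)%E); last first.
    by apply: h; rewrite le_max lexx orbT.
  apply: ge0_le_integral => //.
  - by move=> x _; exact: maxosc_le_ge0.
  - by apply: measurable_funTS; exact: measurable_maxosc_le.
  - by apply: measurable_funTS; exact: measurable_maxosc_le.
  - move=> x _; apply: le_ereal_sup => _ [[t N] /= NL <-]; exists (t, N) => //=.
    by rewrite le_max NL.
pose n := (Num.truncn (2 * L)).+1.
have n0 : (0 < n)%N by [].
have n0' : 0 < n%:R :> R by rewrite ltr0n.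
have Ln : 2 * L <= n%:R by apply: ltW; rewrite truncnS_gt.
rewrite (ge0_integral_grid _ n0 (measurable_maxosc_le L) (maxosc_le_ge0 L)).
apply: (@le_trans _ _ (\int[mu]_(y in `[a, (a + n%:R^-1)%R[) (281 * n%:R * B)%:E)%E).
  apply: ge0_le_integral => //.
  - by move=> y _; apply: sume_ge0 => i _; exact: maxosc_le_ge0.
  - apply: emeasurable_sum => i; apply: measurable_funTS.
    apply: measurableT_comp; first exact: measurable_maxosc_le.
    exact: measurable_funD.
  - move=> y _; apply: (@sum_ereal_sup_le _ _ _
      (fun i p => osc b u v p.1 (y + i%:R / n%:R) p.2 ^+ 2)).
    + by exists (0, L) => /=.
    + by move=> i p; exact: sqr_ge0.
    + move=> sel hsel; exact: (@osc_grid_bound R b u v n (fun i => (sel i).1) (fun i => (sel i).2) y L mu_ mv_ uvi n0 L0 Ln hsel).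
rewrite integral_cst//= lebesgue_measure_itv/= lte_fin ltrDl invr_gt0 n0'.
rewrite -EFinB -EFinM lee_fin.
have -> : 281 * n%:R * B * (a + n%:R^-1 - a) = 281 * B by field; rewrite gt_eqF.
by [].
Qed.

(** Written as the supremum of an increasing sequence, so that monotone convergence applies. *)
Definition maxosc x : \bar R := ereal_sup (range (fun k : nat => maxosc_le k%:R x)).

Lemma maxosc_ge t x N : ((osc b u v t x N ^+ 2)%:E <= maxosc x)%E.
Proof.
pose k := (Num.truncn (Num.max N 0)).+1.
have Nk : N <= k%:R.
  have : Num.max N 0 < k%:R by rewrite truncnS_gt.
  by rewrite gt_max => /andP[/ltW].
apply: (le_trans (maxosc_le_ge t x Nk)).
by apply: ereal_sup_ubound; exists k.
Qed.

Lemma maxosc_ge0 x : (0 <= maxosc x)%E.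
Proof. by apply: le_trans (maxosc_ge 0 x 0); rewrite lee_fin sqr_ge0. Qed.

Lemma maxosc_le_nd x : nondecreasing_seq (fun k : nat => maxosc_le k%:R x).
Proof.
move=> j k jk; apply: le_ereal_sup => _ [[t N] /= NL <-]; exists (t, N) => //=.
by rewrite (le_trans NL)// ler_nat.
Qed.

Lemma maxosc_limn x : maxosc x = limn (fun k : nat => maxosc_le k%:R x).
Proof.
apply/esym/cvg_lim => //; apply: ereal_nondecreasing_cvgn.
exact: maxosc_le_nd.
Qed.

Lemma measurable_maxosc : measurable_fun setT maxosc.
Proof.
apply: (emeasurable_fun_cvg (fun k : nat => maxosc_le k%:R)).
  by move=> k; exact: measurable_maxosc_le.
move=> x _; apply: ereal_nondecreasing_cvgn; exact: maxosc_le_nd.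
Qed.

Lemma maxosc_integral (a : R) :
  (\int[mu]_(x in `[a, (a + 1)%R[) maxosc x <=
     (281 * \int[mu]_xi weighted_l2 u v xi)%:E)%E.
Proof.
under eq_integral do rewrite maxosc_limn.
rewrite monotone_convergence//.
- apply: lime_le.
    apply: ereal_nondecreasing_is_cvgn => j k jk; apply: ge0_le_integral => //.
    + by move=> x _; exact: maxosc_le_ge0.
    + by apply: measurable_funTS; exact: measurable_maxosc_le.
    + by apply: measurable_funTS; exact: measurable_maxosc_le.
    + by move=> x _; exact: maxosc_le_nd.
  by apply: nearW => k; exact: maxosc_le_integral.
- by move=> k; apply: measurable_funTS; exact: measurable_maxosc_le.
- by move=> k x _; exact: maxosc_le_ge0.
- by move=> x _; exact: maxosc_le_nd.
Qed.

End Maximal.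

(** * From unit intervals to the whole line *)

Section UniformlyLocalIntegral.
Variable R : realType.
Local Notation mu := (@lebesgue_measure R).

(** At integers it telescopes: rho n = 1/(n+1) - 1/(n+2). Summing a bound [K] over all unit
    intervals with these factors, on both sides of the origin, gives at most [2 * K]. *)
Definition rho (x : R) : R := ((1 + `|x|) * (2 + `|x|))^-1.

Lemma rho_gt0 x : 0 < rho x.
Proof. by rewrite invr_gt0 mulr_gt0 ?ltr_pwDl. Qed.

Lemma continuous_rho : continuous rho.
Proof.
move=> x; apply: cvgV; first by rewrite gt_eqF// mulr_gt0 ?ltr_pwDl.
by apply: cvgM; apply: cvgD; try exact: cvg_cst; exact: norm_continuous.
Qed.

Lemma measurable_rho : measurable_fun setT rho.
Proof. by apply: continuous_measurable_fun; exact: continuous_rho. Qed.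

Lemma rho_le (x y : R) : `|y| <= `|x| -> rho x <= rho y.
Proof.
move=> yx; rewrite lef_pV2 ?posrE ?mulr_gt0 ?ltr_pwDl//.
by apply: ler_pM; rewrite ?addr_ge0 ?lerD2l.
Qed.

Lemma integral_rho_le (f : R -> \bar R) (K : R) :
  measurable_fun setT f -> (forall x, 0 <= f x)%E ->
  (forall a, \int[mu]_(x in `[a, (a + 1)%R[) f x <= K%:E)%E ->
  (\int[mu]_x ((rho x)%:E * f x) <= (2 * K)%:E)%E.
Proof.
move=> mf f0 fK.
have mrf : measurable_fun setT (fun x => (rho x)%:E * f x)%E.
  apply: emeasurable_funM => //; apply/measurable_EFinP; exact: measurable_rho.
have rf0 x : (0 <= (rho x)%:E * f x)%E by rewrite mule_ge0// lee_fin ltW// rho_gt0.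
have K0 : 0 <= K by rewrite -lee_fin (le_trans _ (fK 0))// integral_ge0.
have piece a y : (forall x, a <= x < a + 1 -> `|y| <= `|x|) ->
    (\int[mu]_(x in `[a, (a + 1)%R[) ((rho x)%:E * f x) <= (rho y * K)%:E)%E.
  move=> hy; apply: (@le_trans _ _ (\int[mu]_(x in `[a, (a + 1)%R[) ((rho y)%:E * f x))%E).
    apply: ge0_le_integral => //.
    - exact: measurable_funTS.
    - by apply: emeasurable_funM => //; exact: measurable_funTS.
    - move=> x /=; rewrite in_itv/= => /hy yx.
      by rewrite lee_wpmul2r// lee_fin rho_le.
  rewrite ge0_integralZl//; first by rewrite EFinM lee_wpmul2l// lee_fin ltW// rho_gt0.
    exact: measurable_funTS.
  by rewrite lee_fin ltW// rho_gt0.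
have disj (a c d : R) : [disjoint `[a, c[%classic & `[c, d[%classic].
  apply/disj_setPS => x /= [].
  by rewrite !in_itv/= => /andP[_ h1] /andP[h2 _]; have := lt_le_trans h1 h2; rewrite ltxx.
have main (n : nat) : (\int[mu]_(x in `[(- n%:R)%R, n%:R[) ((rho x)%:E * f x) <=
    (2 * K * (1 - (n%:R + 1)^-1))%:E)%E.
  elim: n => [|n ih].
    by rewrite oppr0 add0r invr1 subrr mulr0 set_itvco0 integral_set0.
  have n0 := ler0n R n.
  have e1 : - n.+1%:R + 1 = - n%:R :> R by rewrite -natr1; ring.
  have e2 : n%:R + 1 = n.+1%:R :> R by rewrite -natr1.
  have h1 : - n.+1%:R <= n%:R :> R by lra.
  have h2 : n%:R <= n.+1%:R :> R by lra.
  have h3 : - n.+1%:R <= - n%:R :> R by lra.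
  have h4 : - n%:R <= n%:R :> R by lra.
  rewrite (@itv_bndbnd_setU _ _ _ (BLeft n%:R)) ?bnd_simp//.
  rewrite ge0_integral_setU//; last by apply: measurable_funTS.
  rewrite (@itv_bndbnd_setU _ _ _ (BLeft (- n%:R))) ?bnd_simp//.
  rewrite ge0_integral_setU//; last by apply: measurable_funTS.
  have p1 : (\int[mu]_(x in `[(- n.+1%:R)%R, (- n%:R)%R[) ((rho x)%:E * f x) <= (rho n%:R * K)%:E)%E.
    rewrite -e1; apply: piece => x; rewrite -natr1 => /andP[k1 k2].
    by rewrite [leLHS]ger0_norm// ler0_norm; lra.
  have p2 : (\int[mu]_(x in `[n%:R, n.+1%:R[) ((rho x)%:E * f x) <= (rho n%:R * K)%:E)%E.
    rewrite -e2; apply: piece => x /andP[k1 k2].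
    by rewrite !ger0_norm//; lra.
  apply: (le_trans (leeD (leeD p1 ih) p2)).
  rewrite -!EFinD lee_fin /rho ger0_norm// -natr1 le_eqVlt; apply/orP; left; apply/eqP.
  by field; rewrite !gt_eqF//; lra.
have <- : \bigcup_n `[(- n%:R)%R, n%:R[%classic = [set: R].
  apply/seteqP; split => // x _; exists (Num.truncn `|x|).+1 => //=.
  rewrite in_itv/=; have : `|x| < (Num.truncn `|x|).+1%:R by exact: truncnS_gt.
  by rewrite ltr_norml => /andP[/ltW -> ->].
have nd : nondecreasing_seq (fun n : nat => `[(- n%:R)%R, n%:R[%classic : set R).
  move=> m n mn; rewrite subsetEset => x /=; rewrite !in_itv/= => /andP[h1 h2].
  by rewrite -(ler_nat R) in mn; apply/andP; split; lra.
have mE n : measurable (`[(- n%:R)%R, n%:R[%classic : set R) by exact: measurable_itv.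
have mfE n : measurable_fun (`[(- n%:R)%R, n%:R[%classic : set R) (fun x => (rho x)%:E * f x)%E.
  exact: measurable_funTS.
have := @ge0_nondecreasing_set_cvg_integral _ _ _ _ _ mu nd mE mfE (fun i x _ => rf0 x).
move=> /(cvg_lim (@ereal_hausdorff R)) <-.
apply: lime_le.
  apply: ereal_nondecreasing_is_cvgn.
  exact: (@ge0_nondecreasing_set_nondecreasing_integral _ _ _ _ _ mu nd mE mfE (fun i x _ => rf0 x)).
apply: nearW => n; apply: (le_trans (main n)); rewrite lee_fin.
by rewrite -[leRHS]mulr1 ler_wpM2l ?mulr_ge0// gerBl invr_ge0.
Qed.

End UniformlyLocalIntegral.

(** * Almost everywhere convergence, uniformly in time *)

Section PointwiseConvergence.
Variables (R : realType) (b : bool) (u v : R -> R).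
Local Notation mu := (@lebesgue_measure R).
Hypothesis mu_ : measurable_fun setT u.
Hypothesis mv_ : measurable_fun setT v.
Hypothesis uvi : rintegrable mu setT (weighted_l2 u v).
Implicit Types (t x N xi : R) (n : nat).

Lemma integral_rho_maxosc (f g : R -> R) :
  measurable_fun setT f -> measurable_fun setT g -> rintegrable mu setT (weighted_l2 f g) ->
  (\int[mu]_x ((rho x)%:E * maxosc b f g x) <=
    (2 * (281 * \int[mu]_xi weighted_l2 f g xi))%:E)%E.
Proof.
move=> mf mg fgi; apply: integral_rho_le.
- exact: measurable_maxosc.
- by move=> x; exact: maxosc_ge0.
- by move=> a; exact: maxosc_integral.
Qed.

Definition tail n (f : R -> R) xi := f xi * \1_[set z : R | n%:R < `|z|] xi.

Lemma measurable_tail_set n : measurable [set z : R | n%:R < `|z|].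
Proof.
rewrite -[X in measurable X]setTI.
by apply: measurable_fun_ltr => //; exact: measurableT_comp.
Qed.

Lemma measurable_tail n (f : R -> R) : measurable_fun setT f -> measurable_fun setT (tail n f).
Proof.
by move=> mf; apply: measurable_funM => //; apply: measurable_indic; exact: measurable_tail_set.
Qed.

Lemma weighted_l2_tail n : weighted_l2 (tail n u) (tail n v) = tail n (weighted_l2 u v).
Proof.
apply/funext => xi; rewrite /weighted_l2 /tail indicE.
by case: (_ \in _); rewrite ?mulr1 ?mulr0 ?expr0n/= ?addr0 ?mul0r.
Qed.

Lemma rintegrable_tail n (f : R -> R) : rintegrable mu setT f -> rintegrable mu setT (tail n f).
Proof.
move=> fi; apply: (rintegrableMr measurableT 1) => //.
  by apply: measurable_indic; exact: measurable_tail_set.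
by move=> xi _; rewrite ger0_norm// indicE; case: (_ \in _).
Qed.

Lemma Rintegral_tail_cvg (f : R -> R) : rintegrable mu setT f ->
  \int[mu]_xi tail n f xi @[n --> \oo] --> (0 : R).
Proof.
move=> fi; have mf := rintegrable_measurable fi.
apply: fine_cvg; rewrite (_ : 0%:E = \int[mu]_xi (cst 0%E xi))%E; last by rewrite integral0.
apply: (@dominated_cvg _ _ _ mu _ measurableT _ _ (fun x => `|(f x)%:E|%E)) => //.
- by move=> n; apply/measurable_EFinP; exact: measurable_tail.
- move=> xi _; apply: cvg_near_cst; exists (Num.truncn `|xi|).+1 => // n /= hn.
  rewrite /tail indicE memNset ?mulr0//=.
  by apply/negP; rewrite -leNgt (le_trans (ltW (truncnS_gt _)))// ler_nat.
- exact: integrable_abse.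
- move=> n xi _; rewrite /= lee_fin /tail normrM indicE.
  by case: (_ \in _); rewrite ?normr1 ?mulr1// normr0 mulr0.
Qed.

Lemma osc_tail t x N n : n%:R <= N ->
  osc b (tail n u) (tail n v) t x N = osc b u v t x N - osc b u v t x n%:R.
Proof.
move=> nN; rewrite /osc.
set F := fun xi => u xi * cos (ostrovsky_phase b t x xi) - v xi * sin (ostrovsky_phase b t x xi).
have Fi : rintegrable mu `[- N, N] F by exact: rintegrable_osc.
rewrite -(Rintegral_sub_itv F nN) -RintegralB//; last first.
  have mN : measurable (`[- N, N]%classic : set R) by exact: measurable_itv.
  apply: (rintegrableMr _ 1) => //.
  by move=> xi _; rewrite ger0_norm// indicE; case: (_ \in _).
apply: eq_Rintegral => xi _; rewrite /F /tail !indicE mem_sym_itv.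
have -> : (xi \in [set z : R | n%:R < `|z|]) = (n%:R < `|xi|) by apply/idP/idP; rewrite inE.
by rewrite ltNge; case: (_ <= _); rewrite /= ?mulr0 ?mulr1 ?subr0; ring.
Qed.

(** A Cauchy condition in [N], uniform in [t]: it gives the limit in [N] and transfers continuity in
    [t] to it. *)
Definition uniformly_small_tail x := forall e, 0 < e ->
  exists n, forall t N, n%:R <= N -> `|osc b u v t x N - osc b u v t x n%:R| <= e.

(** Let [m] be the infimum over [n] of the maximal functions of the tails. For every [n], the
    integral of [rho * m] is at most 562 = 2 * 281 times the tail of a convergent integral, so it
    vanishes and [m = 0] almost everywhere. Where [m x = 0], some maximal function is below
    [e ^+ 2], which bounds the differences beyond that [n] by [e]. *)
Lemma ae_uniformly_small_tail : {ae mu, forall x, uniformly_small_tail x}.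
Proof.
pose M n x := maxosc b (tail n u) (tail n v) x.
pose m x := einfs (fun n => M n x) 0.
have mt n := @measurable_tail n _ mu_; have mt' n := @measurable_tail n _ mv_.
have it n : rintegrable mu setT (weighted_l2 (tail n u) (tail n v)).
  by rewrite weighted_l2_tail; exact: rintegrable_tail.
have mM n : measurable_fun setT (M n) by exact: measurable_maxosc.
have mm : measurable_fun setT m by exact: (measurable_fun_einfs mM).
have mle n x : (m x <= M n x)%E by apply: ereal_inf_lbound; exists n.
have m0 x : (0 <= m x)%E.
  by apply: le_ereal_inf_tmp => _ [n _ <-]; exact: maxosc_ge0.
have mr : measurable_fun setT (fun x => (rho x)%:E * m x)%E.
  by apply: emeasurable_funM => //; apply/measurable_EFinP; exact: measurable_rho.
have mrM n : measurable_fun setT (fun x => (rho x)%:E * M n x)%E.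
  by apply: emeasurable_funM => //; apply/measurable_EFinP; exact: measurable_rho.
have mr0 x : (0 <= (rho x)%:E * m x)%E by rewrite mule_ge0// lee_fin ltW// rho_gt0.
have int0 : (\int[mu]_x `|(rho x)%:E * m x| = 0)%E.
  under eq_integral do rewrite gee0_abs//.
  apply/eqP; rewrite eq_le integral_ge0// andbT.
  apply/lee_addgt0Pr => e e0; rewrite add0e.
  have /cvgr_lt := Rintegral_tail_cvg uvi.
  have K0 : 0 < 562 :> R by rewrite ltr0n.
  have e2 : 0 < e / 562 by exact: divr_gt0.
  move=> /(_ _ e2)[n _ /(_ n (leqnn n)) /= hn].
  apply: (@le_trans _ _ (\int[mu]_x ((rho x)%:E * M n x))%E).
    apply: ge0_le_integral => //.
    - exact: mrM.
    - by move=> x _; rewrite lee_wpmul2l// lee_fin ltW// rho_gt0.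
  apply: (le_trans (integral_rho_maxosc (mt n) (mt' n) (it n))).
  rewrite lee_fin weighted_l2_tail.
  by move: hn; rewrite (ltr_pdivlMr _ _ K0) => hn; lra.
have := (ae_eq_integral_abs mu measurableT mr).1 int0.
apply: filterS => x /(_ Logic.I) /eqP.
rewrite mule_eq0 eqe gt_eqF ?rho_gt0//= => /eqP mx0 e e0.
have : (m x < (e ^+ 2)%:E)%E by rewrite mx0 lte_fin exprn_gt0.
move=> /ereal_inf_lt[_ [n _ <-]] Mn; exists n => t N nN.
rewrite -osc_tail//.
rewrite -ler_sqr ?nnegrE ?(ltW e0)// real_normK ?num_real//.
rewrite -lee_fin; apply: le_trans (ltW Mn); exact: maxosc_ge.
Qed.

Section SmallTail.
Variable x : R.
Hypothesis hx : uniformly_small_tail x.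

Lemma osc_is_cvg t : cvg (osc b u v t x N @[N --> +oo]).
Proof.
apply/cauchy_cvgP/cauchy_exP => e e0.
have e2 : 0 < e / 2 by rewrite divr_gt0.
have [n hn] := hx e2; exists (osc b u v t x n%:R).
exists n%:R; split; first exact: num_real.
move=> N /ltW nN; rewrite /= -ball_normE/= distrC (le_lt_trans (hn t N nN))//.
by rewrite ltr_pdivrMr// ltr_pMr// ltr1n.
Qed.

Let U t := lim (osc b u v t x N @[N --> +oo]).

Let U_near e : 0 < e -> exists n, forall t, `|U t - osc b u v t x n%:R| <= e.
Proof.
move=> e0; have [n hn] := hx e0; exists n => t.
have c : `|osc b u v t x N - osc b u v t x n%:R| @[N --> +oo] --> `|U t - osc b u v t x n%:R|.
  by apply: cvg_norm; apply: cvgB; [exact: osc_is_cvg|exact: cvg_cst].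
apply: (cvgr_to_le c); exists n%:R; split; first exact: num_real.
by move=> N /ltW; exact: hn.
Qed.

Lemma osc_lim_continuous0 : U t @[t --> 0] --> U 0.
Proof.
apply/cvgrPdist_le => e e0.
have e3 : 0 < e / 3 by rewrite divr_gt0.
have [n hn] := U_near e3.
have /cvgrPdist_le /(_ _ e3) := @osc_continuous_time _ b _ _ mu_ mv_ uvi x n%:R 0.
apply: filterS => t ht.
have -> : U 0 - U t = (U 0 - osc b u v 0 x n%:R) + (osc b u v 0 x n%:R - osc b u v t x n%:R)
  + (osc b u v t x n%:R - U t) by ring.
rewrite (le_trans (ler_normD _ _))//.
have := ler_normD (U 0 - osc b u v 0 x n%:R) (osc b u v 0 x n%:R - osc b u v t x n%:R).
have := hn 0; have := hn t; rewrite (distrC (U t)).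
lra.
Qed.

End SmallTail.
End PointwiseConvergence.

(** * Schwartz functions and Fourier inversion *)

Section RealSchwartz.
Variable R : realType.
Local Notation mu := (@lebesgue_measure R).
Implicit Types (f g a : R -> R) (x xi : R) (k n : nat).

(** The real Schwartz class; complex functions are handled through their real and imaginary
    parts. *)
Definition rschwartz f :=
  (forall n x, derivable (derive1n n f) x 1) /\
  forall k n, exists B : R, forall x, `|x| ^+ k * `|derive1n n f x| <= B.

Lemma derive1nSr n f : derive1n n.+1 f = derive1n n f^`()%classic.
Proof. by rewrite /derive1n iterSr. Qed.

(* Coinduction principle: the Schwartz class is the largest class of bounded
   differentiable functions stable under d/dx and under multiplication by x. *)
Lemma rschwartz_coind (P : (R -> R) -> Prop) :
  (forall f, P f -> forall x, derivable f x 1) ->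
  (forall f, P f -> P f^`()%classic) ->
  (forall f, P f -> P (fun x => x * f x)) ->
  (forall f, P f -> exists B : R, forall x, `|f x| <= B) ->
  forall f, P f -> rschwartz f.
Proof.
move=> Pd P' PX Pb f Pf.
have Pn n : P (derive1n n f) by elim: n => // n ih; rewrite derive1nS; exact: P'.
split=> [n x|k n]; first exact: Pd.
have Pk : P (fun x => x ^+ k * derive1n n f x).
  elim: k => [|k ih].
    by under eq_fun do rewrite expr0 mul1r.
  by under eq_fun do rewrite exprS -mulrA; exact: PX.
have [B hB] := Pb _ Pk; exists B => x.
by rewrite -normrX -normrM.
Qed.

Lemma rschwartz_is_derive f x : rschwartz f -> is_derive x 1 f (f^`()%classic x).
Proof. by move=> [df _]; rewrite derive1E; apply/derivableP; exact: (df 0%N). Qed.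

Lemma rschwartz_derive f : rschwartz f -> rschwartz f^`()%classic.
Proof. by move=> [df bf]; split=> [n x|k n]; rewrite -derive1nSr; [exact: df|exact: bf]. Qed.

Lemma is_derive_derive1 f f' : (forall x, is_derive x 1 f (f' x)) -> f^`()%classic = f'.
Proof. by move=> df; apply/funext => x; rewrite derive1E; have [_] := df x. Qed.

Lemma rschwartz_lin (c d : R) f g : rschwartz f -> rschwartz g ->
  rschwartz (fun x => c * f x + d * g x).
Proof.
move=> [df bf] [dg bg].
have E n : derive1n n (fun x => c * f x + d * g x) =
    (fun x => c * derive1n n f x + d * derive1n n g x).
  elim: n => // n ih; rewrite derive1nS ih; apply: is_derive_derive1 => x.
  rewrite !derive1nS !derive1E.
  have h1 := derivableP (df n x); have h2 := derivableP (dg n x).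
  exact: (is_deriveD (is_deriveZ c h1) (is_deriveZ d h2)).
split=> [n x|k n]; rewrite E.
  have h1 := derivableP (df n x); have h2 := derivableP (dg n x).
  have [] := is_deriveD (is_deriveZ c h1) (is_deriveZ d h2).
  by [].
have [B1 h1] := bf k n; have [B2 h2] := bg k n.
exists (`|c| * B1 + `|d| * B2) => x.
apply: (@le_trans _ _ (`|c| * (`|x| ^+ k * `|derive1n n f x|) + `|d| * (`|x| ^+ k * `|derive1n n g x|))).
  rewrite mulrCA [X in _ <= _ + X]mulrCA -mulrDr ler_wpM2l ?exprn_ge0//.
  by rewrite (le_trans (ler_normD _ _))// !normrM.
by apply: lerD; rewrite ler_wpM2l.
Qed.

Lemma rschwartzZ c f : rschwartz f -> rschwartz (fun x => c * f x).
Proof.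
by move=> sf; have := rschwartz_lin c 0 sf sf; under eq_fun do rewrite mul0r addr0.
Qed.

Lemma rschwartzN f : rschwartz f -> rschwartz (fun x => - f x).
Proof. by move=> sf; have := rschwartzZ (-1) sf; under eq_fun do rewrite mulN1r. Qed.

Lemma rschwartzX f : rschwartz f -> rschwartz (fun x => x * f x).
Proof.
move=> [df bf].
(* Leibniz formula. At [n = 0] the index [n.-1] is harmless because its coefficient vanishes. *)
have E n : derive1n n (fun x => x * f x) =
    (fun x => x * derive1n n f x + n%:R * derive1n n.-1 f x).
  elim: n => [|n ih]; first by apply/funext => x; rewrite mul0r addr0.
  rewrite derive1nS ih; apply: is_derive_derive1 => x.
  have h1 := derivableP (df n x); have h2 := derivableP (df n.-1 x).
  apply: (is_derive_eq (is_deriveD (is_deriveM (is_derive_id x 1) h1) (is_deriveZ n%:R h2))).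
  rewrite /GRing.scale/= mulr1 -!derive1E -!derive1nS -natr1.
  by case: n {ih h1 h2} => [|n] /=; rewrite ?mul0r ?addr0 ?mulr0 ?add0r ?mul1r//; ring.
split=> [n x|k n]; rewrite E.
  have h1 := derivableP (df n x); have h2 := derivableP (df n.-1 x).
  have [] := is_deriveD (is_deriveM (is_derive_id x 1) h1) (is_deriveZ n%:R h2).
  by [].
have [B1 h1] := bf k.+1 n; have [B2 h2] := bf k n.-1.
exists (B1 + n%:R * B2) => x.
apply: (@le_trans _ _ (`|x| ^+ k.+1 * `|derive1n n f x| + n%:R * (`|x| ^+ k * `|derive1n n.-1 f x|))).
  rewrite exprSr -mulrA [X in _ <= _ + X]mulrCA -mulrDr ler_wpM2l ?exprn_ge0//.
  by rewrite (le_trans (ler_normD _ _))// !normrM [`|n%:R|]ger0_norm.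
by apply: lerD => //; rewrite ler_wpM2l.
Qed.

Lemma rschwartz_continuous f : rschwartz f -> continuous f.
Proof. by move=> sf x; exact: is_derive_continuous (rschwartz_is_derive x sf). Qed.

Lemma rschwartz_measurable f : rschwartz f -> measurable_fun setT f.
Proof. by move=> sf; apply: continuous_measurable_fun; exact: rschwartz_continuous. Qed.

Lemma rschwartz_rho f : rschwartz f -> exists2 B : R, 0 <= B & forall x, `|f x| <= B * rho x.
Proof.
move=> [_ bf].
have [B0 h0] := bf 0%N 0%N; have [B1 h1] := bf 1%N 0%N; have [B2 h2] := bf 2%N 0%N.
have B0ge : 0 <= B0 by apply: le_trans (h0 0); rewrite mulr_ge0.
have B1ge : 0 <= B1 by apply: le_trans (h1 0); rewrite mulr_ge0.
have B2ge : 0 <= B2 by apply: le_trans (h2 0); rewrite mulr_ge0.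
(* The coefficients of (1 + |x|)(2 + |x|) = 2 + 3 |x| + |x|^2. *)
exists (2 * B0 + 3 * B1 + B2) => [|x]; first by rewrite !addr_ge0 ?mulr_ge0.
rewrite /rho ler_pdivlMr; last by rewrite mulr_gt0 ?ltr_pwDl.
have := h0 x; have := h1 x; have := h2 x; rewrite /= expr0 expr1 expr2 mul1r.
move=> *; lra.
Qed.

Lemma rintegrable_rho : rintegrable mu setT (@rho R).
Proof.
have mr : measurable_fun setT (fun x : R => (rho x)%:E).
  by apply/measurable_EFinP; exact: measurable_rho.
apply/integrableP; split => //.
have h : (\int[mu]_x ((rho x)%:E * cst 1%E x) <= (2 * 1)%:E)%E.
  apply: integral_rho_le => // a.
  rewrite integral_cst//= lebesgue_measure_itv/= lte_fin ltrDl ltr01.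
  by rewrite -EFinB mul1e lee_fin addrAC subrr add0r.
apply: le_lt_trans (ltry (2 * 1)); apply: le_trans h.
rewrite le_eqVlt; apply/orP; left; apply/eqP; apply: eq_integral => x _.
by rewrite gee0_abs ?mule1// lee_fin ltW// rho_gt0.
Qed.

Lemma rschwartz_integrable f : rschwartz f -> rintegrable mu setT f.
Proof.
move=> sf; have [B B0 hB] := rschwartz_rho sf.
apply: (@rintegrable_le _ _ _ mu setT measurableT f (fun x => B * rho x)) => //.
  exact: rschwartz_measurable.
by apply: rintegrableZl => //; exact: rintegrable_rho.
Qed.

Lemma Rintegral_setT_cvg f : rintegrable mu setT f ->
  \int[mu]_(x in `[- n%:R, n%:R]) f x @[n --> \oo] --> \int[mu]_x f x.
Proof.
move=> fi; have mf := rintegrable_measurable fi.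
have h := Rintegral_tail_cvg fi.
have E n : \int[mu]_(x in `[- n%:R, n%:R]) f x = \int[mu]_x f x - \int[mu]_x tail n f x.
  have ti := rintegrable_tail n fi.
  rewrite Rintegral_mkcond -RintegralB//; apply: eq_Rintegral => x _.
  rewrite patchE mem_sym_itv /tail indicE.
  have -> : (x \in [set z : R | n%:R < `|z|]) = (n%:R < `|x|) by apply/idP/idP; rewrite inE.
  by rewrite ltNge; case: (_ <= _); rewrite /= ?mulr0 ?mulr1 ?subr0 ?subrr.
rewrite (funext E).
rewrite -[X in _ --> X]subr0; apply: cvgB => //; exact: cvg_cst.
Qed.

(** The boundary terms at n and -n are at most [B / n.+1] each, by the decay of [rho]. *)
Lemma Rintegral_derive0 f g (B : R) : (forall x, is_derive x 1 f (g x)) -> continuous g ->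
  rintegrable mu setT g -> (forall x, `|f x| <= B * rho x) -> \int[mu]_x g x = 0.
Proof.
move=> df cg gi fB.
have h := Rintegral_setT_cvg gi.
apply: (@cvg_unique _ (@Rhausdorff R) _ _ _ _ h).
have E n : \int[mu]_(x in `[- n%:R, n%:R]) g x = f n%:R - f (- n%:R).
  by apply: Rintegral_derive => // [|x _]; [have := ler0n R n; lra|exact: cg].
rewrite (funext E).
have B0 : 0 <= B.
  have := le_trans (normr_ge0 _) (fB 0).
  by rewrite pmulr_lge0// rho_gt0.
have bnd n x : `|x| = n%:R -> `|f x| <= B * n.+1%:R^-1.
  move=> xn; apply: (le_trans (fB x)); rewrite ler_wpM2l// /rho xn.
  rewrite lef_pV2 ?posrE ?mulr_gt0 ?ltr_pwDl//.
  rewrite -natr1; have n0 := ler0n R n.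
  by rewrite -[leLHS]mulr1 [leRHS]mulrC ler_pM//; lra.
apply/norm_cvg0P; apply: (@squeeze_cvgr _ _ _ _ (cst 0) (fun n => 2 * B * n.+1%:R^-1)).
- apply: nearW => n; rewrite /= normr_ge0/= (le_trans (ler_normB _ _))//.
  have -> : 2 * B * n.+1%:R^-1 = B * n.+1%:R^-1 + B * n.+1%:R^-1 by ring.
  by apply: lerD; apply: bnd; rewrite ?normrN ger0_norm.
- exact: cvg_cst.
- rewrite -[X in _ --> X](mulr0 (2 * B)); apply: cvgM; first exact: cvg_cst.
  exact: cvg_harmonic.
Qed.

End RealSchwartz.

(** * Cosine and sine transforms of Schwartz functions *)

Section TrigTransforms.
Variable R : realType.
Local Notation mu := (@lebesgue_measure R).
Implicit Types (f g a : R -> R) (x xi y : R).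

(* The Fourier transform of a real function a is (2 pi)^(-1/2) (ctr a - i str a). *)
Definition ctr a xi : R := \int[mu]_x (cos (x * xi) * a x).
Definition str a xi : R := \int[mu]_x (sin (x * xi) * a x).

Lemma measurable_cosM xi : measurable_fun setT (fun x : R => cos (x * xi)).
Proof.
apply: continuous_measurable_fun => x.
by apply: (@continuous_comp _ _ _ (fun x => x * xi) cos);
  [apply: cvgM; [exact: cvg_id|exact: cvg_cst]|exact: continuous_cos].
Qed.

Lemma measurable_sinM xi : measurable_fun setT (fun x : R => sin (x * xi)).
Proof.
apply: continuous_measurable_fun => x.
by apply: (@continuous_comp _ _ _ (fun x => x * xi) sin);
  [apply: cvgM; [exact: cvg_id|exact: cvg_cst]|exact: continuous_sin].
Qed.

Lemma rintegrable_cosM a xi : rintegrable mu setT a ->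
  rintegrable mu setT (fun x => cos (x * xi) * a x).
Proof.
move=> ai; apply: (@rintegrableMl _ _ _ mu setT measurableT (fun x => cos (x * xi)) a 1) => //.
  exact: measurable_cosM.
by move=> x _; rewrite ler_norml cos_geN1 cos_le1.
Qed.

Lemma rintegrable_sinM a xi : rintegrable mu setT a ->
  rintegrable mu setT (fun x => sin (x * xi) * a x).
Proof.
move=> ai; apply: (@rintegrableMl _ _ _ mu setT measurableT (fun x => sin (x * xi)) a 1) => //.
  exact: measurable_sinM.
by move=> x _; rewrite ler_norml sin_geN1 sin_le1.
Qed.

Lemma is_derive_cosM x xi : is_derive xi 1 (fun z : R => cos (x * z)) (- x * sin (x * xi)).
Proof.
have h : is_derive xi 1 (fun z : R => x * z) x.
  by apply: (is_derive_eq (is_deriveZ x (is_derive_id xi 1))); rewrite /GRing.scale/= mulr1.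
by apply: (is_derive_eq (is_derive1_comp (is_derive_cos _) h)); rewrite mulrC mulNr mulrN.
Qed.

Lemma is_derive_sinM x xi : is_derive xi 1 (fun z : R => sin (x * z)) (x * cos (x * xi)).
Proof.
have h : is_derive xi 1 (fun z : R => x * z) x.
  by apply: (is_derive_eq (is_deriveZ x (is_derive_id xi 1))); rewrite /GRing.scale/= mulr1.
by apply: (is_derive_eq (is_derive1_comp (is_derive_sin _) h)); rewrite mulrC.
Qed.

(** Differentiation under the integral sign for both kernels at once; |x a(x)| dominates
    independently of the frequency. *)
Let is_derive_transform (k k' : R -> R -> R) a xi :
  (forall x z : R, is_derive z 1 (k^~ x : R -> R) (k' z x)) ->
  (forall z, rintegrable mu setT (fun x => k z x * a x)) ->
  (forall z x, `|k' z x| <= `|x|) ->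
  rintegrable mu setT (fun x => x * a x) ->
  is_derive xi 1 (fun z : R => \int[mu]_x (k z x * a x) : R) (\int[mu]_x (k' xi x * a x)).
Proof.
move=> dk ki k'b xai.
have I : `]xi - 1, xi + 1[%classic xi by rewrite /= in_itv/=; apply/andP; split; lra.
pose F z x := k z x * a x.
have dF (x z : R) : is_derive z 1 (F^~ x : R -> R) (k' z x * a x).
  have -> : F^~ x = (a x) *: (k^~ x) by apply/funext => w; rewrite /F mulrC.
  by apply: (is_derive_eq (is_deriveZ (a x) (dk x z))); rewrite /GRing.scale/= mulrC.
have E z x : (F^~ x)^`()%classic z = k' z x * a x.
  by rewrite derive1E; have [_] := dF x z.
have h1 : forall z, `]xi - 1, xi + 1[%classic z -> mu.-integrable setT (EFin \o F z).
  by move=> z _; exact: ki.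
have h2 : forall z x, `]xi - 1, xi + 1[%classic z -> setT x -> derivable (F^~ x) z 1.
  by move=> z x _ _; have [] := dF x z.
have h3 x : 0 <= `|x * a x| by [].
have h4 : mu.-integrable setT (EFin \o (fun x => `|x * a x|)) by exact: rintegrable_norm.
have h5 : forall z x, `]xi - 1, xi + 1[%classic z -> setT x ->
    `|partial1of2 F z x| <= `|x * a x|.
  by move=> z x _ _; rewrite /partial1of2 E !normrM ler_wpM2r.
have D := derivable_under_integral measurableT I h1 h2 h3 h4 h5.
have V := differentiation_under_integral measurableT I h1 h2 h3 h4 h5.
apply: DeriveDef => //; rewrite -derive1E V.
by apply: eq_Rintegral => x _; rewrite /partial1of2 E.
Qed.

Lemma is_derive_ctr a xi : rschwartz a ->
  is_derive xi 1 (ctr a) (- str (fun x => x * a x) xi).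
Proof.
move=> sa; have sxa := rschwartzX sa.
have := @is_derive_transform (fun xi x => cos (x * xi)) (fun xi x => - x * sin (x * xi)) a xi.
have -> : - str (fun x => x * a x) xi = \int[mu]_x (- x * sin (x * xi) * a x).
  rewrite /str -mulN1r -RintegralZl//; last exact/rintegrable_sinM/rschwartz_integrable.
  by apply: eq_Rintegral => x _; ring.
apply.
- by move=> x z; exact: is_derive_cosM.
- by move=> z; exact/rintegrable_cosM/rschwartz_integrable.
- by move=> z x; rewrite normrM normrN -[leRHS]mulr1 ler_wpM2l// ler_norml sin_geN1 sin_le1.
- exact: rschwartz_integrable.
Qed.

Lemma is_derive_str a xi : rschwartz a ->
  is_derive xi 1 (str a) (ctr (fun x => x * a x) xi).
Proof.
move=> sa; have sxa := rschwartzX sa.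
have := @is_derive_transform (fun xi x => sin (x * xi)) (fun xi x => x * cos (x * xi)) a xi.
have -> : ctr (fun x => x * a x) xi = \int[mu]_x (x * cos (x * xi) * a x).
  by apply: eq_Rintegral => x _; ring.
apply.
- by move=> x z; exact: is_derive_sinM.
- by move=> z; exact/rintegrable_sinM/rschwartz_integrable.
- by move=> z x; rewrite normrM -[leRHS]mulr1 ler_wpM2l// ler_norml cos_geN1 cos_le1.
- exact: rschwartz_integrable.
Qed.

Let by_parts (k k' : R -> R) a c : rschwartz a ->
  (forall x, is_derive x 1 k (c * k' x)) -> continuous k' ->
  (forall x, `|k x| <= 1) -> (forall x, `|k' x| <= 1) ->
  \int[mu]_x (k x * a^`()%classic x) = - c * \int[mu]_x (k' x * a x).
Proof.
move=> sa dk ck' k1 k'1.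
have sa' := rschwartz_derive sa.
have ck : continuous k by move=> x; exact: is_derive_continuous (dk x).
have mk : measurable_fun setT k by exact: continuous_measurable_fun.
have mk' : measurable_fun setT k' by exact: continuous_measurable_fun.
have i1 : rintegrable mu setT (fun x => k x * a^`()%classic x).
  by apply: (@rintegrableMl _ _ _ mu setT measurableT k _ 1) => //; exact: rschwartz_integrable.
have i2 : rintegrable mu setT (fun x => k' x * a x).
  by apply: (@rintegrableMl _ _ _ mu setT measurableT k' _ 1) => //; exact: rschwartz_integrable.
have [B B0 hB] := rschwartz_rho sa.
have : \int[mu]_x (k x * a^`()%classic x + c * (k' x * a x)) = 0.
  apply: (@Rintegral_derive0 _ (fun x => k x * a x) _ B).
  - move=> x; have da := rschwartz_is_derive x sa.
    apply: (is_derive_eq (is_deriveM (dk x) da)); rewrite /GRing.scale/=; ring.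
  - move=> x; apply: cvgD.
      by apply: cvgM; [exact: ck|exact: rschwartz_continuous].
    apply: cvgM; first exact: cvg_cst.
    by apply: cvgM; [exact: ck'|exact: rschwartz_continuous].
  - by apply: rintegrableD => //; exact: rintegrableZl.
  - by move=> x; rewrite normrM (le_trans _ (hB x))// ler_piMl.
rewrite RintegralD//; last exact: rintegrableZl.
rewrite RintegralZl// => /eqP; rewrite addr_eq0 => /eqP ->.
by rewrite mulNr.
Qed.

Lemma ctr_derive a xi : rschwartz a -> ctr a^`()%classic xi = xi * str a xi.
Proof.
move=> sa; have := @by_parts (fun x => cos (x * xi)) (fun x => sin (x * xi)) a (- xi) sa.
rewrite opprK; apply.
- by move=> x; under eq_fun do rewrite mulrC; rewrite [x * xi]mulrC; exact: is_derive_cosM.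
- move=> x; apply: (@continuous_comp _ _ _ (fun x => x * xi) sin).
    by apply: cvgM; [exact: cvg_id|exact: cvg_cst].
  exact: continuous_sin.
- by move=> x; rewrite ler_norml cos_geN1 cos_le1.
- by move=> x; rewrite ler_norml sin_geN1 sin_le1.
Qed.

Lemma str_derive a xi : rschwartz a -> str a^`()%classic xi = - xi * ctr a xi.
Proof.
move=> sa; have := @by_parts (fun x => sin (x * xi)) (fun x => cos (x * xi)) a xi sa.
apply.
- by move=> x; under eq_fun do rewrite mulrC; rewrite [x * xi]mulrC; exact: is_derive_sinM.
- move=> x; apply: (@continuous_comp _ _ _ (fun x => x * xi) cos).
    by apply: cvgM; [exact: cvg_id|exact: cvg_cst].
  exact: continuous_cos.
- by move=> x; rewrite ler_norml sin_geN1 sin_le1.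
- by move=> x; rewrite ler_norml cos_geN1 cos_le1.
Qed.

Lemma ctr_bounded a xi : rintegrable mu setT a -> `|ctr a xi| <= \int[mu]_x `|a x|.
Proof.
move=> ai; apply: le_norm_Rintegral => //.
- exact: rintegrable_cosM.
- exact: rintegrable_norm.
- by move=> x _; rewrite normrM ler_piMl// ler_norml cos_geN1 cos_le1.
Qed.

Lemma str_bounded a xi : rintegrable mu setT a -> `|str a xi| <= \int[mu]_x `|a x|.
Proof.
move=> ai; apply: le_norm_Rintegral => //.
- exact: rintegrable_sinM.
- exact: rintegrable_norm.
- by move=> x _; rewrite normrM ler_piMl// ler_norml sin_geN1 sin_le1.
Qed.

Lemma ctrN a xi : rschwartz a -> ctr (fun x => - a x) xi = - ctr a xi.
Proof.
move=> /rschwartz_integrable ai; rewrite /ctr -mulN1r -RintegralZl//.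
  by apply: eq_Rintegral => x _; ring.
exact: rintegrable_cosM.
Qed.

Lemma strN a xi : rschwartz a -> str (fun x => - a x) xi = - str a xi.
Proof.
move=> /rschwartz_integrable ai; rewrite /str -mulN1r -RintegralZl//.
  by apply: eq_Rintegral => x _; ring.
exact: rintegrable_sinM.
Qed.

(** The sums [ctr a + str c] form a class stable under both operations of [rschwartz_coind], each of
    which exchanges the two transforms: the derivative is given by the pair (x c, - x a) and
    multiplication by xi by (c', - a'). *)
Lemma rschwartz_transform f a c : rschwartz a -> rschwartz c ->
  f = (fun xi => ctr a xi + str c xi) -> rschwartz f.
Proof.
move=> sa sc fE.
apply: (@rschwartz_coind _ (fun f => exists a c, [/\ rschwartz a, rschwartz c &
  f = (fun xi => ctr a xi + str c xi)])); last by exists a, c.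
- move=> _ [a' [c' [sa' sc' ->]]] xi.
  by have [] := is_deriveD (is_derive_ctr xi sa') (is_derive_str xi sc').
- move=> _ [a' [c' [sa' sc' ->]]].
  exists (fun x => x * c' x), (fun x => - (x * a' x)); split.
  + exact: rschwartzX.
  + exact/rschwartzN/rschwartzX.
  + apply: is_derive_derive1 => xi; rewrite strN; last exact: rschwartzX.
    rewrite addrC; exact: is_deriveD (is_derive_ctr xi sa') (is_derive_str xi sc').
- move=> _ [a' [c' [sa' sc' ->]]].
  exists c'^`()%classic, (fun x => - a'^`()%classic x); split.
  + exact: rschwartz_derive.
  + exact/rschwartzN/rschwartz_derive.
  + apply/funext => xi; rewrite strN; last exact: rschwartz_derive.
    by rewrite ctr_derive// str_derive//; ring.
- move=> _ [a' [c' [sa' sc' ->]]].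
  exists (\int[mu]_x `|a' x| + \int[mu]_x `|c' x|) => xi.
  by rewrite (le_trans (ler_normD _ _))// lerD// ?ctr_bounded ?str_bounded//; exact: rschwartz_integrable.
Qed.

Lemma rschwartz0 : rschwartz (fun _ : R => 0).
Proof.
have E n : derive1n n (fun _ : R => 0) = (fun _ : R => (0 : R)).
  elim: n => // n ih; rewrite derive1nS ih.
  exact: (is_derive_derive1 (fun x => is_derive_cst (0 : R) x 1)).
split=> [n x|k n]; rewrite E; first exact: derivable_cst.
by exists 0 => x; rewrite normr0 mulr0.
Qed.

Lemma rschwartz_ctr a : rschwartz a -> rschwartz (ctr a).
Proof.
move=> sa; apply: (rschwartz_transform sa rschwartz0).
apply/funext => xi; rewrite /str.
under [X in _ + X]eq_Rintegral do rewrite mulr0.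
by rewrite Rintegral_cst// mul0r addr0.
Qed.

Lemma rschwartz_str a : rschwartz a -> rschwartz (str a).
Proof.
move=> sa; apply: (rschwartz_transform rschwartz0 sa).
apply/funext => xi; rewrite /ctr.
under [X in X + _]eq_Rintegral do rewrite mulr0.
by rewrite Rintegral_cst// mul0r add0r.
Qed.

End TrigTransforms.

(** * Gaussians as Schwartz functions *)

Section Gaussian.
Variable R : realType.
Local Notation mu := (@lebesgue_measure R).
Implicit Types (f g a : R -> R) (x xi y : R).

Definition qgauss (al be ga : R) x : R := expR (- al * x ^+ 2 + be * x + ga).

Lemma is_derive_qgauss al be ga x :
  is_derive x 1 (qgauss al be ga) ((be - 2 * al * x) * qgauss al be ga x).
Proof.
have d2 := @is_deriveX _ _ id 2 x 1 _ (is_derive_id x 1).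
have dq : is_derive x 1 (fun z : R => - al * z ^+ 2 + be * z + ga) (be - 2 * al * x).
  have -> : (fun z : R => - al * z ^+ 2 + be * z + ga) = - al *: (id : R -> R) ^+ 2 + be *: id + cst ga.
    by apply/funext => z.
  apply: (is_derive_eq (is_deriveD (is_deriveD (is_deriveZ (- al) d2)
    (is_deriveZ be (is_derive_id x 1))) (is_derive_cst ga x 1))).
  by rewrite /GRing.scale/=; ring.
by apply: (is_derive_eq (is_derive1_comp (is_derive_expR _) dq)); rewrite mulrC.
Qed.

(** The power is at most n! exp |x|, and completing the square bounds the rest of the exponent, at
    most (|be| + 1) |x| - al x^2 + ga, by (|be| + 1)^2 / (4 al) + ga. *)
Lemma pow_qgauss_bounded al be ga n : 0 < al ->
  exists B : R, forall x, `|x| ^+ n * qgauss al be ga x <= B.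
Proof.
move=> al0.
have pow_le (y : R) : 0 <= y -> y ^+ n <= n`!%:R * expR y.
  case: n => [|n] y0; first by rewrite expr0 fact0 mul1r -expR0 ler_expR.
  have f0 : 0 < (n.+1)`!%:R :> R by rewrite ltr0n fact_gt0.
  rewrite mulrC -ler_pdivrMr//; apply: le_trans (expR_ge1Dxn n y0).
  by rewrite lerDr.
exists (n`!%:R * expR (ga + (`|be| + 1) ^+ 2 / (4 * al))) => x.
apply: (@le_trans _ _ (n`!%:R * expR `|x| * qgauss al be ga x)).
  by rewrite ler_wpM2r ?expR_ge0// pow_le.
rewrite -mulrA ler_wpM2l// -expRD ler_expR.
have h1 : be * x <= `|be| * `|x| by rewrite (le_trans (ler_norm _))// normrM.
have h2 : 0 <= al * (`|x| - (`|be| + 1) / (2 * al)) ^+ 2 by rewrite mulr_ge0 ?sqr_ge0// ltW.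
have h3 : al * (`|x| - (`|be| + 1) / (2 * al)) ^+ 2 =
   al * x ^+ 2 - (`|be| + 1) * `|x| + (`|be| + 1) ^+ 2 / (4 * al).
  rewrite -(real_normK (num_real x)); field; rewrite gt_eqF//.
by rewrite h3 in h2; lra.
Qed.

(** Polynomials times a fixed Gaussian form a class to which [rschwartz_coind] applies. *)
Lemma rschwartz_qgauss al be ga : 0 < al -> rschwartz (qgauss al be ga).
Proof.
move=> al0.
have dp (p : {poly R}) x : is_derive x 1 (fun x => p.[x] * qgauss al be ga x)
    ((p^`() + p * (be%:P - (2 * al) *: 'X)).[x] * qgauss al be ga x).
  have dg := is_derive_qgauss al be ga x.
  apply: (is_derive_eq (is_deriveM (is_derive_poly p x) dg)).
  by rewrite hornerD hornerM hornerD hornerN hornerC hornerZ hornerX /GRing.scale/=; ring.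
apply: (@rschwartz_coind _ (fun f => exists p : {poly R}, f = fun x => p.[x] * qgauss al be ga x)).
- by move=> _ [p ->] x; have [] := dp p x.
- move=> _ [p ->]; eexists; apply: is_derive_derive1 => x; exact: dp.
- by move=> _ [p ->]; exists ('X * p); apply/funext => x; rewrite hornerM hornerX mulrA.
- move=> _ [p ->].
  have [B hB] := choice (fun n => @pow_qgauss_bounded al be ga n al0).
  exists (\sum_(i < size p) `|p`_i| * B i) => x.
  rewrite horner_coef mulr_suml (le_trans (ler_norm_sum _ _ _))//.
  apply: ler_sum => i _; rewrite -mulrA normrM ler_wpM2l//.
  by rewrite normrM normrX [`|qgauss _ _ _ _|]ger0_norm ?expR_ge0.
- by exists 1; apply/funext => x; rewrite hornerE mul1r.
Qed.

End Gaussian.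

Section Fubini.
Variable R : realType.
Local Notation mu := (@lebesgue_measure R).

Lemma Rintegral_Fubini (f g : R -> R) (k : R -> R -> R) :
  rintegrable mu setT f -> rintegrable mu setT g ->
  measurable_fun setT (fun z : R * R => k z.1 z.2) -> (forall x y, `|k x y| <= 1) ->
  \int[mu]_x (f x * \int[mu]_y (k x y * g y)) =
  \int[mu]_y (g y * \int[mu]_x (k x y * f x)).
Proof.
move=> fi gi mk k1.
have mf := rintegrable_measurable fi; have mg := rintegrable_measurable gi.
pose F (z : R * R) := (f z.1 * (k z.1 z.2 * g z.2))%:E.
have mF : measurable_fun setT F.
  apply/measurable_EFinP; apply: measurable_funM.
    by apply: (measurableT_comp mf); exact: measurable_fst.
  apply: measurable_funM => //.
  by apply: (measurableT_comp mg); exact: measurable_snd.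
have mk1 x : measurable_fun setT (k x).
  exact: (measurableT_comp mk (pair1_measurable x)).
have mk2 y : measurable_fun setT (k^~ y).
  exact: (measurableT_comp mk (pair2_measurable y)).
have kg x : rintegrable mu setT (fun y => k x y * g y).
  exact: (@rintegrableMl _ _ _ mu setT measurableT (k x) g 1 (mk1 x) (fun y _ => k1 x y) gi).
have kf y : rintegrable mu setT (fun x => k x y * f x).
  exact: (@rintegrableMl _ _ _ mu setT measurableT (k^~ y) f 1 (mk2 y) (fun x _ => k1 x y) fi).
have fkg x : rintegrable mu setT (fun y => f x * (k x y * g y)).
  by apply: rintegrableZl => //; exact: kg.
have gkf y : rintegrable mu setT (fun x => g y * (k x y * f x)).
  by apply: rintegrableZl => //; exact: kf.
have Fi : (mu \x mu)%E.-integrable setT F.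
  apply/integrable12ltyP => //.
  apply: (@le_lt_trans _ _ (\int[mu]_x (`|f x| * \int[mu]_y `|g y|)%:E)%E).
    apply: ge0_le_integral => //.
    - by move=> x _; exact: integral_ge0.
    - by apply: (@measurable_fun_fubini_tonelli_F _ _ _ _ _ mu (abse \o F)) => //=; exact: measurableT_comp.
    - apply/measurable_EFinP; apply: measurable_funM => //; exact: measurableT_comp.
    - move=> x _; have gn := rintegrable_norm gi.
      rewrite -RintegralZl// -EFin_Rintegral//; last exact: rintegrableZl.
      apply: ge0_le_integral => //.
      + apply: measurableT_comp => //; apply/measurable_EFinP.
        exact: (rintegrable_measurable (fkg x)).
      + apply/measurable_EFinP; apply: measurable_funM => //; exact: measurableT_comp.
      + by move=> y _; rewrite /F /= lee_fin !normrM ler_wpM2l// ler_piMl.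
  have fn := rintegrable_norm fi.
  under eq_integral do rewrite mulrC.
  by rewrite EFin_Rintegral ?ltry//; exact: rintegrableZl.
have := Fubini Fi; rewrite /F/= => H.
congr fine.
transitivity (\int[mu]_x \int[mu]_y (f x * (k x y * g y))%:E)%E.
  apply: eq_integral => x _.
  rewrite -RintegralZl//; last exact: kg.
  by apply/esym/EFin_Rintegral => //; exact: fkg.
rewrite H; apply: eq_integral => y _.
rewrite -RintegralZl//; last exact: kf.
transitivity (\int[mu]_x (g y * (k x y * f x))%:E)%E.
  by apply: eq_integral => x _; congr (_%:E); ring.
by apply: EFin_Rintegral => //; exact: gkf.
Qed.

End Fubini.

(** * Normal densities as an approximate identity, and their transforms *)

Section ApproximateIdentity.
Variable R : realType.
Local Notation mu := (@lebesgue_measure R).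
Implicit Types (f g a k : R -> R) (m s x xi y z : R).

Lemma normal_pdf_qgauss m s : 0 < s ->
  normal_pdf m s = (fun x => normal_peak s *
    qgauss (2 * s ^+ 2)^-1 (m / s ^+ 2) (- m ^+ 2 / (2 * s ^+ 2)) x).
Proof.
move=> s0; apply/funext => x; rewrite normal_pdfE ?gt_eqF// /normal_fun /qgauss.
by congr (_ * expR _); rewrite -mulr_natl; field; rewrite gt_eqF.
Qed.

Lemma normal_pdf_sym m s x : s != 0 -> normal_pdf m s x = normal_pdf x s m.
Proof.
by move=> s0; rewrite !normal_pdfE// /normal_fun -[(x - m) ^+ 2]sqrrN opprB.
Qed.

Lemma normal_pdf_shift m s x : s != 0 -> normal_pdf 0 s (x - m) = normal_pdf m s x.
Proof. by move=> s0; rewrite !normal_pdfE// /normal_fun subr0. Qed.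

Lemma Rintegral_normal_pdf m s : \int[mu]_x normal_pdf m s x = 1.
Proof. by rewrite /Rintegral integral_normal_pdf. Qed.

(** A pointwise comparison with a density of twice the width, so that the first absolute moment is
    bounded without being computed. *)
Lemma normal_pdf_dist m s x : 0 < s ->
  `|x - m| * normal_pdf m s x <= 2 * s * normal_pdf m (2 * s) x.
Proof.
move=> s0; have s0' : s != 0 by rewrite gt_eqF.
rewrite !normal_pdfE ?mulf_neq0// /normal_fun.
have -> : normal_peak (2 * s) = normal_peak s / 2 :> R.
  rewrite /normal_peak.
  have -> : (2 * s) ^+ 2 * pi *+ 2 = 2 ^+ 2 * (s ^+ 2 * pi *+ 2) :> R by ring.
  by rewrite sqrtrM ?sqr_ge0// sqrtr_sqr ger0_norm// invfM mulrC.
have [d dE] : exists d : R, d = `|x - m| by exists `|x - m|.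
have dd : (x - m) ^+ 2 = d ^+ 2 by rewrite dE real_normK ?num_real.
rewrite dd -dE mulrCA.
have -> : 2 * s * (normal_peak s / 2 * expR (- d ^+ 2 / ((2 * s) ^+ 2 *+ 2))) =
   normal_peak s * (s * expR (- d ^+ 2 / ((2 * s) ^+ 2 *+ 2))) by field.
rewrite ler_wpM2l ?normal_peak_ge0//.
(* 3/8 = 1/2 - 1/8 is the gap between the exponents of the two widths. It remains to see that z <=
   exp (3 z^2 / 8) for z = d / s, which follows from z <= 1 + 3 z^2 / 8. *)
have -> : - d ^+ 2 / ((2 * s) ^+ 2 *+ 2) = 3 / 8 * (d / s) ^+ 2 + - d ^+ 2 / (s ^+ 2 *+ 2).
  by field.
rewrite expRD mulrA ler_wpM2r ?expR_ge0//.
rewrite mulrC -ler_pdivrMr//.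
apply: le_trans (expR_ge1Dx _).
have := sqr_ge0 (d / s - 4 / 3); rewrite sqrrB mulr2n; lra.
Qed.

(** The Lipschitz condition is centred at the single point [x], so the estimate serves both Schwartz
    functions and the indicator of an interval away from its endpoints. *)
Lemma approximate_identity k (K L : R) x s : 0 < s -> 0 <= L ->
  measurable_fun setT k -> (forall y, `|k y| <= K) ->
  (forall y, `|k y - k x| <= L * `|y - x|) ->
  `|\int[mu]_y (k y * normal_pdf x s y) - k x| <= 4 * L * s.
Proof.
move=> s0 L0 mk kK kL.
have pi_ m' s' : rintegrable mu setT (normal_pdf m' s') by exact: integrable_normal_pdf.
have kpi : rintegrable mu setT (fun y => k y * normal_pdf x s y).
  by apply: (@rintegrableMl _ _ _ mu setT measurableT k _ K) => //; exact: pi_.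
have -> : k x = \int[mu]_y (k x * normal_pdf x s y).
  by rewrite RintegralZl ?Rintegral_normal_pdf ?mulr1//; exact: pi_.
have kpi2 : rintegrable mu setT (fun y => k x * normal_pdf x s y).
  by apply: rintegrableZl => //; exact: pi_.
rewrite -RintegralB//.
have -> : 4 * L * s = \int[mu]_y (4 * L * s * normal_pdf x (2 * s) y).
  by rewrite RintegralZl ?Rintegral_normal_pdf ?mulr1//; exact: pi_.
apply: le_norm_Rintegral => //.
- by apply: rintegrableB.
- by apply: rintegrableZl => //; exact: pi_.
- move=> y _; rewrite -mulrBl normrM [`|normal_pdf _ _ _|]ger0_norm ?normal_pdf_ge0//.
  apply: (@le_trans _ _ (L * (`|y - x| * normal_pdf x s y))).
    by rewrite mulrA ler_wpM2r// normal_pdf_ge0.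
  have h := @normal_pdf_dist x s y s0.
  have := ler_wpM2l L0 h.
  have : 0 <= L * s * normal_pdf x (2 * s) y.
    by rewrite !mulr_ge0 ?normal_pdf_ge0// ltW.
  by move=> *; lra.
Qed.

Lemma rschwartz_lipschitz a : rschwartz a ->
  exists2 L : R, 0 <= L & forall x y, `|a y - a x| <= L * `|y - x|.
Proof.
move=> sa; have [B B0 hB] := rschwartz_rho (rschwartz_derive sa).
exists B => // x y.
wlog xy : x y / x <= y.
  move=> h; have [|/ltW] := leP x y; first exact: h.
  by rewrite distrC [`|y - x|]distrC; exact: h.
have sa' := rschwartz_derive sa.
have ca' : {in `[x, y], forall z, {for z, continuous a^`()%classic}}.
  by move=> z _; exact: rschwartz_continuous.
rewrite -(@Rintegral_derive _ a a^`()%classic x y xy) => //; last first.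
  by move=> z _; exact: rschwartz_is_derive.
rewrite (ger0_norm (_ : 0 <= y - x)) ?subr_ge0//.
apply: Rintegral_itv_le => //; first exact: itv_integrable.
move=> z _; rewrite (le_trans (hB z))// -[leRHS]mulr1 ler_wpM2l//.
rewrite invf_le1 ?mulr_gt0 ?ltr_pwDl//.
have z0 := normr_ge0 z; have := mulr_ge0 z0 z0; lra.
Qed.

Let ode f s : 0 < s -> (forall z, is_derive z 1 f (- (z / s ^+ 2) * f z)) ->
  forall z, f z = f 0 * expR (- z ^+ 2 / (2 * s ^+ 2)).
Proof.
move=> s0 df z.
pose e := fun z : R => expR (z ^+ 2 / (2 * s ^+ 2)).
have de (w : R) : is_derive w 1 e (w / s ^+ 2 * e w).
  have d2 := @is_deriveX _ _ id 2 w 1 _ (is_derive_id w 1).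
  have dq : is_derive w 1 (fun z : R => z ^+ 2 / (2 * s ^+ 2)) (w / s ^+ 2).
    have -> : (fun z : R => z ^+ 2 / (2 * s ^+ 2)) = (2 * s ^+ 2)^-1 *: (id : R -> R) ^+ 2.
      by apply/funext => v; rewrite mulrC.
    apply: (is_derive_eq (is_deriveZ _ d2)); rewrite /GRing.scale/=; field.
    by rewrite gt_eqF.
  by apply: (is_derive_eq (is_derive1_comp (is_derive_expR _) dq)); rewrite mulrC.
have d0 (w : R) : is_derive w 1 (f * e) 0.
  apply: (is_derive_eq (is_deriveM (df w) (de w))); rewrite /GRing.scale/=; ring.
have := is_derive_0_is_cst z 0 d0.
rewrite /e !fctE expr0n/= mul0r expR0 mulr1 => <-.
rewrite -mulrA -expRD -mulrDl.
by rewrite subrr mul0r expR0 mulr1.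
Qed.

(** As [G' = - s ^+ 2 * (x * G)], both transforms solve F' = - (z / s^2) F, which determines them
    from their values at 0: the sine transform vanishes there, and the cosine transform is the mass
    of [G], read off from the normal density of deviation 1/s. *)
Lemma gauss_transforms s z : 0 < s ->
  ctr (qgauss (s ^+ 2 / 2) 0 0) z = 2 * pi * normal_pdf 0 s z /\
  str (qgauss (s ^+ 2 / 2) 0 0) z = 0.
Proof.
move=> s0; set G := qgauss _ _ _.
have s20 : 0 < s ^+ 2 / 2 by rewrite divr_gt0// exprn_gt0.
have sG : rschwartz G by exact: rschwartz_qgauss.
have G' : G^`()%classic = (fun x => - s ^+ 2 * (x * G x)).
  apply: is_derive_derive1 => x; have := is_derive_qgauss (s ^+ 2 / 2) 0 0 x.
  move=> d; apply: (is_derive_eq d).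
  by rewrite -/G; field.
have sxG := rschwartzX sG.
have xG tr : tr = @ctr R \/ tr = @str R -> forall w, tr G^`()%classic w = - s ^+ 2 * tr (fun x => x * G x) w.
  move=> trE w; rewrite G'; case: trE => ->; rewrite /ctr /str -RintegralZl//.
  - by apply: eq_Rintegral => x _; ring.
  - exact/rintegrable_cosM/rschwartz_integrable.
  - by apply: eq_Rintegral => x _; ring.
  - exact/rintegrable_sinM/rschwartz_integrable.
have c : forall w : R, is_derive w 1 (ctr G) (- (w / s ^+ 2) * ctr G w).
  move=> w; apply: (is_derive_eq (is_derive_ctr w sG)).
  have := xG _ (or_intror erefl) w; rewrite str_derive// => E.
  have -> : - (w / s ^+ 2) * ctr G w = (- w * ctr G w) / s ^+ 2 by ring.
  by rewrite E; field; rewrite gt_eqF.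
have d : forall w : R, is_derive w 1 (str G) (- (w / s ^+ 2) * str G w).
  move=> w; apply: (is_derive_eq (is_derive_str w sG)).
  have := xG _ (or_introl erefl) w; rewrite ctr_derive// => E.
  have -> : - (w / s ^+ 2) * str G w = - (w * str G w) / s ^+ 2 by ring.
  by rewrite E; field; rewrite gt_eqF.
split; last first.
  rewrite (ode s0 d) /str (_ : (\int[mu]_x _)%R = 0) ?mul0r//.
  by under eq_Rintegral do rewrite mulr0 sin0 mul0r; rewrite Rintegral_cst// mul0r.
rewrite (ode s0 c) normal_pdfE ?gt_eqF// /normal_fun subr0 [RHS]mulrA -[s ^+ 2 *+ 2]mulr_natl.
congr (_ * _).
have sV : 0 < s^-1 by rewrite invr_gt0.
have pk : 0 < normal_peak s^-1 by rewrite normal_peak_gt0// gt_eqF.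
have : \int[mu]_x (normal_peak s^-1 * G x) = 1.
  rewrite -(Rintegral_normal_pdf 0 s^-1); apply: eq_Rintegral => x _.
  rewrite normal_pdfE ?gt_eqF// /normal_fun /G /qgauss; congr (_ * expR _).
  by rewrite subr0 mul0r !addr0 -mulr_natl; field; rewrite gt_eqF.
rewrite RintegralZl//; last exact: rschwartz_integrable.
have -> : ctr G 0 = \int[mu]_x G x.
  by apply: eq_Rintegral => x _; rewrite mulr0 cos0 mul1r.
move=> E.
have -> : \int[mu]_x G x = (normal_peak s^-1)^-1.
  by rewrite -[RHS]mulr1 -E mulrA mulVf ?mul1r// gt_eqF.
have peakE (r : R) : 0 < r -> normal_peak r = (r * Num.sqrt (pi *+ 2))^-1.
  by move=> r0; rewrite /normal_peak -mulrnAr sqrtrM ?sqr_ge0// sqrtr_sqr gtr0_norm.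
rewrite (peakE _ sV) (peakE _ s0).
have p0 : 0 < Num.sqrt (pi *+ 2 : R) by rewrite sqrtr_gt0 mulrn_wgt0// pi_gt0.
have pE : Num.sqrt (pi *+ 2 : R) ^+ 2 = 2 * pi.
  by rewrite sqr_sqrtr; [ring|rewrite mulrn_wge0// pi_ge0].
rewrite -pE; field; rewrite !gt_eqF//.
Qed.

End ApproximateIdentity.

(** * Fourier inversion for real Schwartz functions *)

Section Inversion.
Variable R : realType.
Local Notation mu := (@lebesgue_measure R).
Implicit Types (a : R -> R) (s x xi y : R).

Let measurable_phase_diff (tr : R -> R) y : continuous tr ->
  measurable_fun setT (fun z : R * R => tr (z.1 * (z.2 - y))).
Proof.
move=> ct; have mt : measurable_fun setT tr by exact: continuous_measurable_fun.
apply: (measurableT_comp mt); apply: measurable_funM; first exact: measurable_fst.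
by apply: measurable_funB => //; exact: measurable_snd.
Qed.

(* The factor exp (- s^2 xi^2 / 2) makes the inversion integral absolutely convergent. *)
Let gauss_fubini (tr : R -> R) a y s : continuous tr -> (forall x, `|tr x| <= 1) ->
  rschwartz a -> 0 < s ->
  \int[mu]_xi (qgauss (s ^+ 2 / 2) 0 0 xi * \int[mu]_x (tr (xi * (x - y)) * a x)) =
  \int[mu]_x (a x * \int[mu]_xi (tr (xi * (x - y)) * qgauss (s ^+ 2 / 2) 0 0 xi)).
Proof.
move=> ct t1 sa s0.
apply: (@Rintegral_Fubini _ _ _ (fun xi x => tr (xi * (x - y)))) => //.
- by apply/rschwartz_integrable/rschwartz_qgauss; rewrite divr_gt0// exprn_gt0.
- exact: rschwartz_integrable.
- exact: measurable_phase_diff.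
Qed.

(** 0 <= 1 - exp (- s^2 xi^2 / 2) <= s^2 xi^2, so a finite second moment makes the cost of the
    regularisation quadratic in [s]. *)
Let gauss_remove (g : R -> R) s : continuous g ->
  rintegrable mu setT g -> rintegrable mu setT (fun xi => xi ^+ 2 * `|g xi|) ->
  `|\int[mu]_xi g xi - \int[mu]_xi (qgauss (s ^+ 2 / 2) 0 0 xi * g xi)| <=
     s ^+ 2 * \int[mu]_xi (xi ^+ 2 * `|g xi|).
Proof.
move=> cg gi xgi.
have G1 xi : 0 <= 1 - qgauss (s ^+ 2 / 2) 0 0 xi <= s ^+ 2 * xi ^+ 2.
  rewrite /qgauss mul0r !addr0.
  have sx : 0 <= s ^+ 2 * xi ^+ 2 by rewrite mulr_ge0// sqr_ge0.
  have h1 : expR (- (s ^+ 2 / 2) * xi ^+ 2) <= 1.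
    by rewrite -[leRHS]expR0 ler_expR; lra.
  have h2 := expR_ge1Dx (- (s ^+ 2 / 2) * xi ^+ 2).
  by apply/andP; split; lra.
have Gi : rintegrable mu setT (fun xi => qgauss (s ^+ 2 / 2) 0 0 xi * g xi).
  apply: (@rintegrableMl _ _ _ mu setT measurableT (qgauss (s ^+ 2 / 2) 0 0) g 1) => //.
    apply: continuous_measurable_fun => x.
    exact: is_derive_continuous (is_derive_qgauss _ _ _ x).
  by move=> xi _; have /andP[h1 _] := G1 xi; rewrite ger0_norm ?expR_ge0//; lra.
rewrite -RintegralB// -RintegralZl//.
apply: le_norm_Rintegral => //.
- exact: rintegrableB.
- exact: rintegrableZl.
- move=> xi _; have /andP[h1 h2] := G1 xi.
  have -> : g xi - qgauss (s ^+ 2 / 2) 0 0 xi * g xi = (1 - qgauss (s ^+ 2 / 2) 0 0 xi) * g xi.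
    by ring.
  by rewrite normrM (ger0_norm h1) mulrA ler_wpM2r.
Qed.

Let linear_small (X A B : R) : (forall s, 0 < s -> `|X| <= A * s ^+ 2 + B * s) -> X = 0.
Proof.
move=> h; apply/eqP; rewrite -normr_le0; apply/ler_addgt0Pr => e e0; rewrite add0r.
pose s := Num.min 1 (e / (`|A| + `|B| + 1)).
have D0 : 0 < `|A| + `|B| + 1 by rewrite ltr_wpDl// addr_ge0.
have s0 : 0 < s by rewrite lt_min ltr01 divr_gt0.
have s1 : s <= 1 by rewrite ge_min lexx.
have se : s * (`|A| + `|B| + 1) <= e.
  by rewrite -ler_pdivlMr// ge_min lexx orbT.
apply: (le_trans (h s s0)); apply: le_trans se.
have h1 : A * s ^+ 2 <= `|A| * s.
  apply: (@le_trans _ _ (`|A| * s ^+ 2)).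
    by rewrite ler_wpM2r ?sqr_ge0// ler_norm.
  by rewrite ler_wpM2l// expr2 -[leRHS]mulr1 ler_wpM2l// ltW.
have h2 : B * s <= `|B| * s by rewrite ler_wpM2r ?ler_norm// ltW.
lra.
Qed.

Let combine_cos a y xi : rschwartz a ->
  \int[mu]_x (cos (xi * (x - y)) * a x) = cos (xi * y) * ctr a xi + sin (xi * y) * str a xi.
Proof.
move=> sa; have ai := rschwartz_integrable sa.
have ci := rintegrable_cosM xi ai; have si := rintegrable_sinM xi ai.
rewrite /ctr /str -!RintegralZl// -RintegralD//; try exact: rintegrableZl.
apply: eq_Rintegral => x _; rewrite mulrBr cosB (mulrC x); ring.
Qed.

Let combine_sin a y xi : rschwartz a ->
  \int[mu]_x (sin (xi * (x - y)) * a x) = cos (xi * y) * str a xi - sin (xi * y) * ctr a xi.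
Proof.
move=> sa; have ai := rschwartz_integrable sa.
have ci := rintegrable_cosM xi ai; have si := rintegrable_sinM xi ai.
rewrite /ctr /str -!RintegralZl// -RintegralB//; try exact: rintegrableZl.
apply: eq_Rintegral => x _; rewrite mulrBr sinB (mulrC x); ring.
Qed.

Let combined_integrable (g : R -> R) a y : rschwartz a ->
  (forall xi, g xi = cos (xi * y) * ctr a xi + sin (xi * y) * str a xi) \/
  (forall xi, g xi = cos (xi * y) * str a xi - sin (xi * y) * ctr a xi) ->
  [/\ continuous g, rintegrable mu setT g & rintegrable mu setT (fun xi => xi ^+ 2 * `|g xi|)].
Proof.
move=> sa gE.
have sc := rschwartz_ctr sa; have ss := rschwartz_str sa.
have cc : continuous (fun xi => cos (xi * y)).
  move=> x; apply: (@continuous_comp _ _ _ (fun x => x * y) cos).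
    by apply: cvgM; [exact: cvg_id|exact: cvg_cst].
  exact: continuous_cos.
have cs : continuous (fun xi => sin (xi * y)).
  move=> x; apply: (@continuous_comp _ _ _ (fun x => x * y) sin).
    by apply: cvgM; [exact: cvg_id|exact: cvg_cst].
  exact: continuous_sin.
have cg : continuous g.
  case: gE => /funext ->.
  - by move=> x; apply: cvgD; apply: cvgM; [exact: cc|exact: rschwartz_continuous|exact: cs|exact: rschwartz_continuous].
  - by move=> x; apply: cvgB; apply: cvgM; [exact: cc|exact: rschwartz_continuous|exact: cs|exact: rschwartz_continuous].
have gle xi : `|g xi| <= `|ctr a xi| + `|str a xi|.
  have c1 : `|cos (xi * y)| <= 1 by rewrite ler_norml cos_geN1 cos_le1.
  have s1 : `|sin (xi * y)| <= 1 by rewrite ler_norml sin_geN1 sin_le1.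
  case: gE => ->.
  - by rewrite (le_trans (ler_normD _ _))// !normrM lerD// ler_piMl.
  - by rewrite (le_trans (ler_normB _ _))// !normrM addrC lerD// ler_piMl.
have mg : measurable_fun setT g by exact: continuous_measurable_fun.
split => //.
  apply: (@rintegrable_le _ _ _ mu setT measurableT g (fun xi => `|ctr a xi| + `|str a xi|)) => //.
  by apply: rintegrableD => //; apply: rintegrable_norm; exact: rschwartz_integrable.
have x2 b : rschwartz b -> rintegrable mu setT (fun xi => `|xi * (xi * b xi)|).
  by move=> sb; apply/rintegrable_norm/rschwartz_integrable/rschwartzX/rschwartzX.
apply: (@rintegrable_le _ _ _ mu setT measurableT _
  (fun xi => `|xi * (xi * ctr a xi)| + `|xi * (xi * str a xi)|)).
- by apply: measurable_funM; [exact: measurable_funX|exact: measurableT_comp].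
- move=> xi _; rewrite ger0_norm; last by rewrite mulr_ge0// sqr_ge0.
  rewrite -(real_normK (num_real xi)) !normrM !mulrA -expr2 -mulrDr.
  by rewrite ler_wpM2l// sqr_ge0.
- by apply: rintegrableD => //; exact: x2.
Qed.

(** Real part of the inversion formula. With the Gaussian factor, Fubini turns the inversion
    integral into 2 pi times the average of [a] against a normal density centred at [y]. Removing
    the factor costs O(s^2) and replacing the average by [a y] costs O(s). *)
Lemma fourier_inversion_cos a y : rschwartz a ->
  ctr (ctr a) y + str (str a) y = 2 * pi * a y.
Proof.
move=> sa; have sc := rschwartz_ctr sa; have ss := rschwartz_str sa.
pose g xi := cos (xi * y) * ctr a xi + sin (xi * y) * str a xi.
have [cg gi xgi] := @combined_integrable g a y sa (or_introl (fun xi => erefl)).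
have -> : ctr (ctr a) y + str (str a) y = \int[mu]_xi g xi.
  rewrite /g RintegralD//; [exact/rintegrable_cosM/rschwartz_integrable|].
  exact/rintegrable_sinM/rschwartz_integrable.
have [L L0 hL] := rschwartz_lipschitz sa.
have [B B0 hB] := rschwartz_rho sa.
apply/eqP; rewrite -subr_eq0; apply/eqP.
apply: (@linear_small _ (\int[mu]_xi (xi ^+ 2 * `|g xi|)) (2 * pi * (4 * L))) => s s0.
have s0' : s != 0 by rewrite gt_eqF.
set G := \int[mu]_xi (qgauss (s ^+ 2 / 2) 0 0 xi * g xi).
have h1 := gauss_remove s cg gi xgi; rewrite -/G in h1.
have h2 : G = 2 * pi * \int[mu]_x (a x * normal_pdf y s x).
  have -> : G = \int[mu]_xi (qgauss (s ^+ 2 / 2) 0 0 xi * \int[mu]_x (cos (xi * (x - y)) * a x)).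
    by apply: eq_Rintegral => xi _; rewrite combine_cos.
  rewrite gauss_fubini//; [|exact: continuous_cos|by move=> x; rewrite ler_norml cos_geN1 cos_le1].
  rewrite -RintegralZl//; last first.
    have := @rintegrableMr _ _ _ mu setT measurableT (normal_pdf y s) a (normal_peak s).
    apply; [exact: measurable_normal_pdf| |exact: rschwartz_integrable].
    by move=> x _; rewrite ger0_norm ?normal_pdf_ge0// normal_pdf_ub.
  apply: eq_Rintegral => x _; have [h _] := gauss_transforms (x - y) s0.
  by rewrite /ctr in h; rewrite h normal_pdf_shift//; ring.
have a1 x : `|a x| <= B.
  rewrite (le_trans (hB x))// -[leRHS]mulr1 ler_wpM2l//.
  rewrite invf_le1 ?mulr_gt0 ?ltr_pwDl//.
  have z0 := normr_ge0 x; have := mulr_ge0 z0 z0; lra.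
have h3 := approximate_identity s0 L0 (rschwartz_measurable sa) a1 (fun x => hL y x).
have -> : \int[mu]_xi g xi - 2 * pi * a y = (\int[mu]_xi g xi - G) +
    2 * pi * (\int[mu]_x (a x * normal_pdf y s x) - a y) by rewrite h2; ring.
rewrite (le_trans (ler_normD _ _))//; apply: lerD; first by rewrite mulrC.
rewrite normrM ger0_norm; last by rewrite mulr_ge0// pi_ge0.
by rewrite -mulrA ler_wpM2l// mulr_ge0// pi_ge0.
Qed.

(** Imaginary part of the inversion formula. The regularised integral is exactly 0, because the sine
    transform of a centred Gaussian vanishes. *)
Lemma fourier_inversion_sin a y : rschwartz a -> ctr (str a) y = str (ctr a) y.
Proof.
move=> sa; have sc := rschwartz_ctr sa; have ss := rschwartz_str sa.
pose g xi := cos (xi * y) * str a xi - sin (xi * y) * ctr a xi.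
have [cg gi xgi] := @combined_integrable g a y sa (or_intror (fun xi => erefl)).
apply/eqP; rewrite -subr_eq0; apply/eqP.
have -> : ctr (str a) y - str (ctr a) y = \int[mu]_xi g xi.
  rewrite /g RintegralB//; [exact/rintegrable_cosM/rschwartz_integrable|].
  exact/rintegrable_sinM/rschwartz_integrable.
apply: (@linear_small _ (\int[mu]_xi (xi ^+ 2 * `|g xi|)) 0) => s s0.
set G := \int[mu]_xi (qgauss (s ^+ 2 / 2) 0 0 xi * g xi).
have h1 := gauss_remove s cg gi xgi; rewrite -/G in h1.
suff G0 : G = 0 by rewrite G0 subr0 in h1; rewrite mul0r addr0 mulrC.
have -> : G = \int[mu]_xi (qgauss (s ^+ 2 / 2) 0 0 xi * \int[mu]_x (sin (xi * (x - y)) * a x)).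
  by apply: eq_Rintegral => xi _; rewrite combine_sin.
rewrite gauss_fubini//; [|exact: continuous_sin|by move=> x; rewrite ler_norml sin_geN1 sin_le1].
transitivity (\int[mu]_(x in [set: R]) (0 : R)); last by rewrite Rintegral_cst// mul0r.
apply: eq_Rintegral => x _.
by have [_ h] := gauss_transforms (x - y) s0; rewrite /str in h; rewrite h mulr0.
Qed.

End Inversion.

(** * Complex test functions and the inverse Fourier transform *)

Section ComplexSchwartz.
Variable R : realType.
Local Notation mu := (@lebesgue_measure R).
Implicit Types (p q : R -> R) (phi psi : R -> R[i]).

Lemma normc_le_abs (a c : R) : Normc.normc (a +i* c) <= `|a| + `|c|.
Proof.
rewrite /Normc.normc -ler_sqr ?nnegrE ?addr_ge0// ?sqrtr_ge0//.
rewrite sqr_sqrtr ?addr_ge0 ?sqr_ge0// -(real_normK (num_real a)) -(real_normK (num_real c)).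
by rewrite sqrrD -subr_ge0 [X in 0 <= X](_ : _ = (`|a| * `|c|) *+ 2); [rewrite mulrn_wge0// mulr_ge0|ring].
Qed.

Lemma abs_le_normc (a c : R) : `|a| <= Normc.normc (a +i* c) /\ `|c| <= Normc.normc (a +i* c).
Proof.
by rewrite /Normc.normc; split; rewrite -sqrtr_sqr ler_wsqrtr// ?lerDl ?lerDr ?sqr_ge0.
Qed.

Lemma schwartzP phi : schwartz phi <->
  rschwartz (fun x => complex.Re (phi x)) /\ rschwartz (fun x => complex.Im (phi x)).
Proof.
split=> [[dphi bphi]|[[dp bp] [dq bq]]].
- split; split => [n x|k n]; try by have [] := dphi n x.
  + have [B hB] := bphi k n; exists B => x; apply: le_trans (hB _ _); last by exists x.
    by rewrite ler_wpM2l// ?exprn_ge0// (abs_le_normc _ _).1.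
  + have [B hB] := bphi k n; exists B => x; apply: le_trans (hB _ _); last by exists x.
    by rewrite ler_wpM2l// ?exprn_ge0// (abs_le_normc _ _).2.
- split=> [n x|k n]; first by split; [exact: dp|exact: dq].
  have [B hB] := bp k n; have [C hC] := bq k n; exists (B + C) => _ [x _ <-].
  apply: (le_trans _ (lerD (hB x) (hC x))).
  by rewrite -mulrDr ler_wpM2l// ?exprn_ge0// normc_le_abs.
Qed.

Lemma schwartz_pair p q : rschwartz p -> rschwartz q -> schwartz (fun x => p x +i* q x).
Proof. by move=> sp sq; apply/schwartzP. Qed.

Lemma ctr_lin (c d : R) p q xi : rschwartz p -> rschwartz q ->
  ctr (fun x => c * p x + d * q x) xi = c * ctr p xi + d * ctr q xi.
Proof.
move=> sp sq; have ip := rintegrable_cosM xi (rschwartz_integrable sp).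
have iq := rintegrable_cosM xi (rschwartz_integrable sq).
rewrite /ctr -!RintegralZl// -RintegralD//; [|exact: rintegrableZl..].
by apply: eq_Rintegral => x _; ring.
Qed.

Lemma str_lin (c d : R) p q xi : rschwartz p -> rschwartz q ->
  str (fun x => c * p x + d * q x) xi = c * str p xi + d * str q xi.
Proof.
move=> sp sq; have ip := rintegrable_sinM xi (rschwartz_integrable sp).
have iq := rintegrable_sinM xi (rschwartz_integrable sq).
rewrite /str -!RintegralZl// -RintegralD//; [|exact: rintegrableZl..].
by apply: eq_Rintegral => x _; ring.
Qed.

Lemma fourier_testE p q xi : rschwartz p -> rschwartz q ->
  fourier_test (fun x => p x +i* q x) xi =
  ((Num.sqrt (2 * pi))^-1 * (ctr p xi + str q xi)) +i*
  ((Num.sqrt (2 * pi))^-1 * (ctr q xi - str p xi)).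
Proof.
move=> /rschwartz_integrable ip /rschwartz_integrable iq.
have [cp sp] := (rintegrable_cosM xi ip, rintegrable_sinM xi ip).
have [cq sq] := (rintegrable_cosM xi iq, rintegrable_sinM xi iq).
rewrite /fourier_test /Cintegral /cis.
have -> : (\int[mu]_x complex.Re ((cos (- (x * xi)) +i* sin (- (x * xi))) * (p x +i* q x)))
    = ctr p xi + str q xi.
  rewrite /ctr /str -RintegralD//.
  by apply: eq_Rintegral => x _ /=; rewrite cosN sinN; ring.
have -> : (\int[mu]_x complex.Im ((cos (- (x * xi)) +i* sin (- (x * xi))) * (p x +i* q x)))
    = ctr q xi - str p xi.
  rewrite /ctr /str -RintegralB//.
  by apply: eq_Rintegral => x _ /=; rewrite cosN sinN; ring.
by apply/eqP; rewrite eq_complex /= !mul0r subr0 addr0 !eqxx.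
Qed.

Lemma inv_sqrt_2pi_sqr :
  (Num.sqrt (2 * pi))^-1 * (Num.sqrt (2 * pi))^-1 * (2 * pi) = 1 :> R.
Proof.
have pi20 : 0 < 2 * pi :> R by rewrite mulr_gt0// pi_gt0.
by rewrite -expr2 exprVn sqr_sqrtr ?ltW// mulVf ?gt_eqF.
Qed.

Definition inverse_fourier_re p q x : R := (Num.sqrt (2 * pi))^-1 * ctr p x + - (Num.sqrt (2 * pi))^-1 * str q x.
Definition inverse_fourier_im p q x : R := (Num.sqrt (2 * pi))^-1 * ctr q x + (Num.sqrt (2 * pi))^-1 * str p x.

Lemma rschwartz_inverse_fourier_re p q : rschwartz p -> rschwartz q -> rschwartz (inverse_fourier_re p q).
Proof. by move=> sp sq; apply: rschwartz_lin; [exact: rschwartz_ctr|exact: rschwartz_str]. Qed.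

Lemma rschwartz_inverse_fourier_im p q : rschwartz p -> rschwartz q -> rschwartz (inverse_fourier_im p q).
Proof. by move=> sp sq; apply: rschwartz_lin; [exact: rschwartz_ctr|exact: rschwartz_str]. Qed.

Lemma fourier_test_inverse p q : rschwartz p -> rschwartz q ->
  fourier_test (fun x => inverse_fourier_re p q x +i* inverse_fourier_im p q x) =
  (fun x => p x +i* q x).
Proof.
move=> sp sq; apply/funext => xi.
have [cp cq] := (rschwartz_ctr sp, rschwartz_ctr sq).
have [tp tq] := (rschwartz_str sp, rschwartz_str sq).
rewrite fourier_testE; [|exact: rschwartz_inverse_fourier_re|exact: rschwartz_inverse_fourier_im].
rewrite /inverse_fourier_re /inverse_fourier_im !ctr_lin// !str_lin//.
have hp := fourier_inversion_cos xi sp; have hq := fourier_inversion_cos xi sq.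
have kp := fourier_inversion_sin xi sp; have kq := fourier_inversion_sin xi sq.
move: inv_sqrt_2pi_sqr; move: (Num.sqrt (2 * pi))^-1 => c c2.
apply/eqP; rewrite eq_complex /=; apply/andP; split; apply/eqP.
- transitivity (c * c * (ctr (ctr p) xi + str (str p) xi)); first by rewrite kq; ring.
  by rewrite hp mulrA c2 mul1r.
- transitivity (c * c * (ctr (ctr q) xi + str (str q) xi)); first by rewrite kp; ring.
  by rewrite hq mulrA c2 mul1r.
Qed.

End ComplexSchwartz.

(** * The solution at time zero *)

Section Pairing.
Variable R : realType.
Local Notation mu := (@lebesgue_measure R).
Implicit Types (a p q : R -> R) (x xi : R).

Let transform_continuous (trig : R -> R) a : continuous trig -> (forall x, `|trig x| <= 1) ->
  rintegrable mu setT a -> continuous (fun xi => \int[mu]_x (trig (x * xi) * a x)).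
Proof.
move=> ct t1 ai xi.
have ia : xi \in `]xi - 1, xi + 1[%classic by rewrite inE/= in_itv/=; apply/andP; split; lra.
have mt z : measurable_fun setT (fun x => trig (x * z)).
  apply: continuous_measurable_fun => x.
  by apply: (@continuous_comp _ _ _ (fun x => x * z) trig);
    [apply: cvgM; [exact: cvg_id|exact: cvg_cst]|exact: ct].
apply: (@continuity_under_integral R _ _ mu (fun z x => trig (x * z) * a x) _ measurableT
  (xi - 1) (xi + 1) _ _ (fun x => `|a x|) _ _ xi ia).
- move=> z _; exact: (@rintegrableMl _ _ _ mu setT measurableT (fun x => trig (x * z)) a 1 (mt z)).
- apply: aeW => x _ y _; apply: cvgM; last exact: cvg_cst.
  by apply: (@continuous_comp _ _ _ (fun z => x * z) trig);
    [apply: cvgM; [exact: cvg_cst|exact: cvg_id]|exact: ct].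
- exact: rintegrable_norm.
- by move=> z _; apply: aeW => x _; rewrite normrM ler_piMl.
Qed.

Let cos1 x : `|cos x| <= 1. Proof. by rewrite ler_norml cos_geN1 cos_le1. Qed.
Let sin1 x : `|sin x| <= 1. Proof. by rewrite ler_norml sin_geN1 sin_le1. Qed.

Let transform_duality (trig : R -> R) a p : continuous trig -> (forall x, `|trig x| <= 1) ->
  rintegrable mu setT a -> rintegrable mu setT p ->
  \int[mu]_xi (a xi * \int[mu]_x (trig (x * xi) * p x)) =
  \int[mu]_x (p x * \int[mu]_xi (trig (xi * x) * a xi)).
Proof.
move=> ct t1 ai pi_.
have mk : measurable_fun setT (fun z : R * R => trig (z.2 * z.1)).
  apply: (@measurableT_comp _ _ _ _ _ _ trig); first exact: continuous_measurable_fun.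
  by apply: measurable_funM; [exact: measurable_snd|exact: measurable_fst].
transitivity (\int[mu]_x (p x * \int[mu]_xi (trig (x * xi) * a xi))).
  exact: (@Rintegral_Fubini R a p (fun xi x => trig (x * xi)) ai pi_ mk (fun _ _ => t1 _)).
apply: eq_Rintegral => x _; congr (_ * _).
by apply: eq_Rintegral => xi _; rewrite [x * xi]mulrC.
Qed.

Lemma ctr_duality a p : rintegrable mu setT a -> rintegrable mu setT p ->
  \int[mu]_xi (a xi * ctr p xi) = \int[mu]_x (p x * ctr a x).
Proof. exact: transform_duality (@continuous_cos R) cos1. Qed.

Lemma str_duality a p : rintegrable mu setT a -> rintegrable mu setT p ->
  \int[mu]_xi (a xi * str p xi) = \int[mu]_x (p x * str a x).
Proof. exact: transform_duality (@continuous_sin R) sin1. Qed.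

Lemma rintegrable_mul_ctr a p : rintegrable mu setT a -> rintegrable mu setT p ->
  rintegrable mu setT (fun xi => a xi * ctr p xi).
Proof.
move=> ai pi_; apply: (@rintegrableMr _ _ _ mu setT measurableT (ctr p) a (\int[mu]_x `|p x|)) => //.
  apply: continuous_measurable_fun; apply: transform_continuous => //; exact: continuous_cos.
by move=> xi _; exact: ctr_bounded.
Qed.

Lemma rintegrable_mul_str a p : rintegrable mu setT a -> rintegrable mu setT p ->
  rintegrable mu setT (fun xi => a xi * str p xi).
Proof.
move=> ai pi_; apply: (@rintegrableMr _ _ _ mu setT measurableT (str p) a (\int[mu]_x `|p x|)) => //.
  apply: continuous_measurable_fun; apply: transform_continuous => //; exact: continuous_sin.
by move=> xi _; exact: str_bounded.
Qed.

Lemma transform_pairing a c p q : rintegrable mu setT a -> rintegrable mu setT c ->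
  rintegrable mu setT p -> rintegrable mu setT q ->
  \int[mu]_xi (a xi * (ctr p xi - str q xi) - c xi * (ctr q xi + str p xi)) =
  \int[mu]_x (p x * (ctr a x - str c x)) - \int[mu]_x (q x * (ctr c x + str a x)).
Proof.
move=> ai ci ip iq.
have [apc aqs] := (rintegrable_mul_ctr ai ip, rintegrable_mul_str ai iq).
have [cqc cps] := (rintegrable_mul_ctr ci iq, rintegrable_mul_str ci ip).
have [pac pcs] := (rintegrable_mul_ctr ip ai, rintegrable_mul_str ip ci).
have [qcc qas] := (rintegrable_mul_ctr iq ci, rintegrable_mul_str iq ai).
transitivity ((\int[mu]_xi (a xi * ctr p xi) - \int[mu]_xi (a xi * str q xi)) -
  (\int[mu]_xi (c xi * ctr q xi) + \int[mu]_xi (c xi * str p xi))).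
  rewrite -RintegralB// -RintegralD// -RintegralB//; [|exact: rintegrableB|exact: rintegrableD].
  by apply: eq_Rintegral => xi _; ring.
have -> : \int[mu]_x (p x * (ctr a x - str c x)) = \int[mu]_x (p x * ctr a x) - \int[mu]_x (p x * str c x).
  by rewrite -RintegralB//; apply: eq_Rintegral => x _; ring.
have -> : \int[mu]_x (q x * (ctr c x + str a x)) = \int[mu]_x (q x * ctr c x) + \int[mu]_x (q x * str a x).
  by rewrite -RintegralD//; apply: eq_Rintegral => x _; ring.
have swap (A B C D : R) : A - B - (C + D) = A - D - (C + B) by ring.
by rewrite (ctr_duality ai ip) (str_duality ai iq) (ctr_duality ci iq) (str_duality ci ip); exact: swap.
Qed.

End Pairing.

(** * Pairing the limit at time zero with Schwartz functions *)

Section LimitAtTimeZero.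
Variables (R : realType) (b : bool) (u v : R -> R).
Local Notation mu := (@lebesgue_measure R).
Hypothesis mu_ : measurable_fun setT u.
Hypothesis mv_ : measurable_fun setT v.
Hypothesis uvi : rintegrable mu setT (weighted_l2 u v).
Implicit Types (p q : R -> R) (x xi : R) (n : nat).

Let cut (f : R -> R) n xi := f xi * \1_(`[- n%:R, n%:R]%classic) xi.

Let rintegral_cut (f : R -> R) n : \int[mu]_xi cut f n xi = \int[mu]_(xi in `[- n%:R, n%:R]) f xi.
Proof.
rewrite [RHS]Rintegral_mkcond; apply: eq_Rintegral => xi _.
by rewrite patch_indic.
Qed.

Let rintegrable_cut (f : R -> R) n :
  rintegrable mu `[- n%:R, n%:R] f -> rintegrable mu setT (cut f n).
Proof.
have mD : measurable (`[- n%:R, n%:R]%classic : set R) by exact: measurable_itv.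
move=> fi; have h := (@integrable_mkcond _ _ R mu _ (EFin \o f) mD).1 fi.
rewrite /rintegrable (_ : EFin \o cut f n = (EFin \o f) \_ `[- n%:R, n%:R]%classic)//.
by apply/funext => xi; rewrite /patch /= /cut indicE; case: (_ \in _); rewrite ?mulr1 ?mulr0.
Qed.

(** The truncated density is integrable on the line, so the multiplication formula applies to it; at
    time zero its inverse transform has real part [osc] of [(u, v)] and imaginary part [osc] of
    [(v, - u)], up to the constant. *)
Lemma osc_pairing p q n : rintegrable mu setT p -> rintegrable mu setT q ->
  \int[mu]_(xi in `[- n%:R, n%:R])
    (u xi * (ctr p xi - str q xi) - v xi * (ctr q xi + str p xi)) =
  \int[mu]_x (p x * osc b u v 0 x n%:R) -
  \int[mu]_x (q x * osc b v (fun xi => - u xi) 0 x n%:R).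
Proof.
move=> ip iq.
have au : rintegrable mu setT (cut u n) by apply: rintegrable_cut; exact: (@rintegrable_itv_re _ u v).
have av : rintegrable mu setT (cut v n) by apply: rintegrable_cut; exact: (@rintegrable_itv_im _ u v).
have h := transform_pairing au av ip iq.
rewrite -rintegral_cut.
transitivity (\int[mu]_xi (cut u n xi * (ctr p xi - str q xi) - cut v n xi * (ctr q xi + str p xi))).
  by apply: eq_Rintegral => xi _; rewrite /cut; ring.
rewrite h; congr (_ - _); apply: eq_Rintegral => x _; congr (_ * _).
- rewrite /ctr /str -RintegralB//; [|exact: rintegrable_cosM|exact: rintegrable_sinM].
  rewrite /osc -rintegral_cut; apply: eq_Rintegral => xi _.
  by rewrite /cut /ostrovsky_phase mul0r addr0 [x * xi]mulrC; ring.
- rewrite /ctr /str -RintegralD//; [|exact: rintegrable_cosM|exact: rintegrable_sinM].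
  rewrite /osc -rintegral_cut; apply: eq_Rintegral => xi _.
  by rewrite /cut /ostrovsky_phase mul0r addr0 [x * xi]mulrC; ring.
Qed.

(* A limit superior, so that measurability does not depend on convergence. *)
Definition initial_lim x : R := fine (limn_esup (fun n => (osc b u v 0 x n%:R)%:E)).

Let measurable_osc n : measurable_fun setT (fun x => osc b u v 0 x n%:R).
Proof. by apply: continuous_measurable_fun; exact: osc_continuous_space. Qed.

Lemma measurable_initial_lim : measurable_fun setT initial_lim.
Proof.
apply: (measurableT_comp (fine_measurable measurableT)).
have := @measurable_fun_limn_esup _ _ R [set: R] (fun n x => (osc b u v 0 x n%:R)%:E).
by apply => // n; apply/measurable_EFinP; exact: measurable_osc.
Qed.

Lemma osc_initial_lim x : uniformly_small_tail b u v x ->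
  osc b u v 0 x N @[N --> +oo] --> initial_lim x.
Proof.
move=> hx; have c : cvg (osc b u v 0 x N @[N --> +oo]) by exact: osc_is_cvg.
rewrite (_ : initial_lim x = lim (osc b u v 0 x N @[N --> +oo]))//.
have cn : osc b u v 0 x n%:R @[n --> \oo] --> lim (osc b u v 0 x N @[N --> +oo]).
  by apply: (cvg_comp _ _ (@cvgr_idn R)); exact: c.
have cE : (osc b u v 0 x n%:R)%:E @[n --> \oo] --> (lim (osc b u v 0 x N @[N --> +oo]))%:E.
  by apply: cvg_EFin => //; exact: nearW.
rewrite /initial_lim is_cvg_limn_esupE; last by apply/cvg_ex; eexists; exact: cE.
by rewrite (cvg_lim _ cE).
Qed.

(** Dominated convergence. With z = [osc] and p^2 <= B |p| rho, the inequality rho |p z| <= p^2 +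
    rho^2 z^2 gives |p z| <= B |p| + rho z^2, and rho z^2 is at most [rho * maxosc], an integrable
    function independent of [n]. *)
Lemma pairing_initial_lim p : rschwartz p ->
  rintegrable mu setT (fun x => p x * initial_lim x) /\
  \int[mu]_x (p x * osc b u v 0 x n%:R) @[n --> \oo] --> \int[mu]_x (p x * initial_lim x).
Proof.
move=> sp; have ip := rschwartz_integrable sp; have mp := rschwartz_measurable sp.
have [B B0 hB] := rschwartz_rho sp.
have mr := @measurable_rho R.
pose g x := ((B * `|p x|)%:E + (rho x)%:E * maxosc b u v x)%E.
have gi : mu.-integrable setT g.
  apply: integrableD => //.
    by apply: (rintegrableZl measurableT B); exact: rintegrable_norm.
  have mM : measurable_fun setT (fun x => (rho x)%:E * maxosc b u v x)%E.
    apply: emeasurable_funM; first exact/measurable_EFinP.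
    exact: measurable_maxosc.
  apply/integrableP; split => //.
  apply: le_lt_trans (ltry (2 * (281 * \int[mu]_xi weighted_l2 u v xi))).
  apply: le_trans (integral_rho_maxosc b mu_ mv_ uvi).
  under eq_integral => x _.
    rewrite gee0_abs; last by rewrite mule_ge0// ?lee_fin ?(ltW (rho_gt0 x))// maxosc_ge0.
    over.
  exact: lexx.
have dom n x : (`|(p x * osc b u v 0 x n%:R)%:E| <= g x)%E.
  have r0 := rho_gt0 x.
  apply: (@le_trans _ _ ((B * `|p x|)%:E + (rho x)%:E * (osc b u v 0 x n%:R ^+ 2)%:E)%E); last first.
    by rewrite leeD2l// lee_wpmul2l ?lee_fin ?(ltW r0)//; exact: maxosc_ge.
  rewrite -EFinM -EFinD lee_fin normrM.
  set z := osc _ _ _ _ _ _; rewrite -[z ^+ 2]real_normK ?num_real//.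
  have p2 : `|p x| ^+ 2 <= B * `|p x| * rho x.
    by rewrite expr2 mulrAC ler_wpM2r.
  have h : 0 <= (`|p x| - rho x * `|z|) ^+ 2 + `|p x| ^+ 2 + (rho x * `|z|) ^+ 2.
    by rewrite !addr_ge0// sqr_ge0.
  rewrite -(ler_pM2r r0); nra.
have cv : {ae mu, forall x, [set: R] x ->
    (p x * osc b u v 0 x n%:R)%:E @[n --> \oo] --> (p x * initial_lim x)%:E}.
  have := ae_uniformly_small_tail b mu_ mv_ uvi.
  apply: filterS; first exact: (ae_filter_ringOfSetsType mu).
  move=> x hx _.
  apply: cvg_EFin; first exact: nearW.
  apply: cvgM; first exact: cvg_cst.
  by apply: (cvg_comp _ _ (@cvgr_idn R)); exact: osc_initial_lim.
have ml := measurable_initial_lim.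
have := @dominated_convergence _ _ R mu setT measurableT
  (fun n x => (p x * osc b u v 0 x n%:R)%:E) (fun x => (p x * initial_lim x)%:E) g.
case=> //.
- by move=> n; apply/measurable_EFinP; apply: measurable_funM => //; exact: measurable_osc.
- by apply/measurable_EFinP; exact: measurable_funM.
- by apply: aeW => x n _; exact: dom.
- move=> fi _ c; split => //.
  apply: fine_cvg; rewrite -(EFin_Rintegral measurableT fi) in c *.
  exact: c.
Qed.

End LimitAtTimeZero.

(** * A function with zero pairing against every Schwartz function vanishes almost everywhere *)

Section Uniqueness.
Variable R : realType.
Local Notation mu := (@lebesgue_measure R).
Implicit Types (a b s x y : R) (h D : R -> R).

Definition mollified_itv a b s x : R := \int[mu]_y (\1_(`[a, b]%classic) y * normal_pdf x s y).

Let rintegrable_normal_pdf m s : rintegrable mu setT (normal_pdf m s).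
Proof. exact: integrable_normal_pdf. Qed.

Let indic_itv_le1 a b y : `|\1_(`[a, b]%classic) y : R| <= 1.
Proof. by rewrite indicE; case: (_ \in _); rewrite ?normr1// normr0. Qed.

Lemma measurable_mollified_itv a b s : 0 < s -> measurable_fun setT (mollified_itv a b s).
Proof.
move=> s0; apply: (measurableT_comp (fine_measurable measurableT)).
apply: (@measurable_fun_fubini_tonelli_F _ _ _ _ _ mu
  (fun z : R * R => (\1_(`[a, b]%classic) z.2 * normal_pdf z.1 s z.2)%:E)) => //=.
- apply/measurable_EFinP; apply: measurable_funM.
    apply: (@measurableT_comp _ _ _ _ _ _ (\1_(`[a, b]%classic) : R -> R)); last exact: measurable_snd.
    by apply: measurable_indic; exact: measurable_itv.
  under eq_fun do rewrite -normal_pdf_shift ?gt_eqF//.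
  apply: (@measurableT_comp _ _ _ _ _ _ (normal_pdf (0 : R) s)); first exact: measurable_normal_pdf.
  by apply: measurable_funB; [exact: measurable_snd|exact: measurable_fst].
- by move=> z; rewrite lee_fin mulr_ge0// normal_pdf_ge0.
Qed.

Lemma mollified_itv_le1 a b s x : `|mollified_itv a b s x| <= 1.
Proof.
rewrite -(Rintegral_normal_pdf x s); apply: le_norm_Rintegral => //.
  exact: (@rintegrableMl _ _ _ mu setT measurableT _ _ 1).
move=> y _; rewrite normrM [`|normal_pdf _ _ _|]ger0_norm ?normal_pdf_ge0//.
by rewrite ler_piMl// normal_pdf_ge0.
Qed.

(** At distance [d] from the endpoints, the indicator satisfies a Lipschitz condition centred at [x]
    with constant 1/d: it changes only beyond distance [d]. *)
Lemma mollified_itv_cvg a b x : x != a -> x != b ->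
  mollified_itv a b n.+1%:R^-1 x @[n --> \oo] --> (\1_(`[a, b]%classic) x : R).
Proof.
move=> xa xb.
have [d d0 [da db]] : exists2 d : R, 0 < d & d <= `|x - a| /\ d <= `|x - b|.
  exists (Num.min `|x - a| `|x - b|).
    by rewrite lt_min !normr_gt0 !subr_eq0 xa xb.
  by rewrite !ge_min !lexx orbT.
have kL y : `|\1_(`[a, b]%classic) y - \1_(`[a, b]%classic) x : R| <= d^-1 * `|y - x|.
  have iE z : \1_(`[a, b]%classic) z = ((a <= z <= b)%R)%:R :> R.
    by rewrite indicE; congr (_%:R : R); congr nat_of_bool; apply/idP/idP; rewrite inE/= in_itv.
  rewrite !iE.
  have [E|ne] := eqVneq (a <= y <= b) (a <= x <= b).
    by rewrite E subrr normr0 mulr_ge0// invr_ge0 ltW.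
  have -> : `|((a <= y <= b)%R)%:R - ((a <= x <= b)%R)%:R : R| = 1.
    by move: ne; case: (a <= y <= b); case: (a <= x <= b) => //= _;
      rewrite ?subr0 ?sub0r ?normrN normr1.
  rewrite mulrC ler_pdivlMr// mul1r.
  move: da db ne.
  have [yx|yx] := ger0P (y - x); case: (leP a y) => ay; case: (leP y b) => yb;
    case: (leP a x) => ax; case: (leP x b) => xb';
    case: (ger0P (x - a)) => xa'; case: (ger0P (x - b)) => xb'' da db //= _; lra.
apply/cvgrPdist_le => e e0.
have L0 : 0 <= d^-1 by rewrite invr_ge0 ltW.
have /cvgrPdist_le /(_ _ e0) : 4 * d^-1 * n.+1%:R^-1 @[n --> \oo] --> (0 : R).
  by rewrite -(mulr0 (4 * d^-1)); apply: cvgM; [exact: cvg_cst|exact: cvg_harmonic].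
apply: filterS => n; rewrite sub0r normrN => hn.
rewrite distrC; apply: le_trans (le_trans _ hn); last exact: ler_norm.
exact: (@approximate_identity _ _ 1).
Qed.

Lemma rschwartz_normal_qgauss y s : 0 < s ->
  rschwartz (fun x => normal_pdf y s x * qgauss 1 0 0 x).
Proof.
move=> s0; rewrite (normal_pdf_qgauss _ s0).
have -> : (fun x => normal_peak s * qgauss (2 * s ^+ 2)^-1 (y / s ^+ 2) (- y ^+ 2 / (2 * s ^+ 2)) x
    * qgauss 1 0 0 x) =
  (fun x => normal_peak s *
    qgauss ((2 * s ^+ 2)^-1 + 1) (y / s ^+ 2) (- y ^+ 2 / (2 * s ^+ 2)) x).
  apply/funext => x; rewrite -mulrA; congr (_ * _); rewrite /qgauss -expRD; congr expR.
  ring.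
apply/rschwartzZ/rschwartz_qgauss.
by rewrite addr_gt0// invr_gt0 mulr_gt0// exprn_gt0.
Qed.

(** The primitive from -oo is identically 0, and by Lebesgue differentiation its derivative is [h]
    almost everywhere. *)
Lemma ae_zero_itv h : rintegrable mu setT h ->
  (forall a b, \int[mu]_(x in `[a, b]) h x = 0) -> {ae mu, forall x, h x = 0}.
Proof.
move=> hi h0.
have lh : locally_integrable [set: R] h.
  by apply: open_integrable_locally => //; exact: openT.
have iy y : mu.-integrable `]-oo, y] (EFin \o h) by apply: integrableS hi.
have hy0 y : \int[mu]_(x in `]-oo, y]) h x = 0.
  have mD : measurable (`]-oo, y]%classic : set R) by exact: measurable_itv.
  have ri : rintegrable mu setT (h \_ `]-oo, y]%classic).
    rewrite /rintegrable (_ : EFin \o _ = (EFin \o h) \_ `]-oo, y]%classic).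
      exact: (@integrable_mkcond _ _ R mu _ (EFin \o h) mD).1.
    by apply/funext => x; rewrite /patch /=; case: (_ \in _).
  rewrite Rintegral_mkcond; have := Rintegral_setT_cvg ri.
  rewrite (_ : (fun n : nat => _) = cst 0).
    by move=> /(cvg_lim (@Rhausdorff R)) <-; exact: lim_cst.
  apply/funext => n; rewrite -Rintegral_mkcondr.
  rewrite (_ : _ `&` _ = `[- n%:R, Num.min n%:R y]%classic) ?h0//.
  apply/seteqP; split => x /=; rewrite !in_itv/= le_min.
    by move=> [/andP[-> ->] ->].
  by move=> /and3P[-> -> ->].
have := FTC1Ny iy lh.
apply: filterS; first exact: (ae_filter_ringOfSetsType mu).
move=> x [_ <-].
by rewrite (funext hy0 : (fun y => _) = cst 0) derive1_cst.
Qed.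

(** Multiplying [D] by a Gaussian makes it integrable. A normal density times this Gaussian is a
    Schwartz test function; integrating its centre over [a, b] yields the mollified indicator, and
    letting the width tend to 0 leaves the integral of [h] over [a, b]. *)
Lemma ae_zero_schwartz D :
  (forall p, rschwartz p -> rintegrable mu setT (fun x => D x * p x)) ->
  (forall p, rschwartz p -> \int[mu]_x (D x * p x) = 0) ->
  {ae mu, forall x, D x = 0}.
Proof.
move=> Di D0.
pose h x := D x * qgauss 1 0 0 x.
have sq : rschwartz (@qgauss R 1 0 0) by exact: rschwartz_qgauss.
have hi : rintegrable mu setT h by exact: Di.
have mh := rintegrable_measurable hi.
suff : {ae mu, forall x, h x = 0}.
  apply: filterS; first exact: (ae_filter_ringOfSetsType mu).
  move=> x /eqP; rewrite mulf_eq0 => /orP[/eqP//|].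
  by rewrite gt_eqF// expR_gt0.
apply: (ae_zero_itv hi) => a b.
have mi : measurable_fun [set: R] (\1_(`[a, b]%classic) : R -> R).
  by apply: measurable_indic; exact: measurable_itv.
have ii : rintegrable mu setT (\1_(`[a, b]%classic) : R -> R).
  exact: (integrable_indic_itv a b true false).
have z s : 0 < s -> \int[mu]_x (h x * mollified_itv a b s x) = 0.
  move=> s0; have s0' : s != 0 by rewrite gt_eqF.
  have pk : 0 < normal_peak s by exact: normal_peak_gt0.
  have mq : rintegrable mu setT (fun x => h x * mollified_itv a b s x).
    apply: (@rintegrableMr _ _ _ mu setT measurableT _ _ 1) => //.
      exact: measurable_mollified_itv.
    by move=> x _; exact: mollified_itv_le1.
  (* Division by the peak value brings the kernel below 1, as [Rintegral_Fubini] requires. *)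
  have mk : measurable_fun setT (fun w : R * R => (normal_peak s)^-1 * normal_pdf w.2 s w.1).
    apply: measurable_funM => //.
    under eq_fun do rewrite -normal_pdf_shift//.
    apply: (@measurableT_comp _ _ _ _ _ _ (normal_pdf (0 : R) s)); first exact: measurable_normal_pdf.
    by apply: measurable_funB; [exact: measurable_fst|exact: measurable_snd].
  have k1 x y : `|(normal_peak s)^-1 * normal_pdf y s x| <= 1.
    rewrite ger0_norm; last by rewrite mulr_ge0 ?normal_pdf_ge0// invr_ge0 ltW.
    by rewrite mulrC ler_pdivrMr// mul1r normal_pdf_ub.
  have := Rintegral_Fubini hi ii mk k1.
  rewrite [RHS](_ : _ = 0); last first.
    transitivity (\int[mu]_(y in setT) (0 : R)); last by rewrite Rintegral_cst// mul0r.
    apply: eq_Rintegral => y _; set I := \int[mu]_x _; suff -> : I = 0 by rewrite mulr0.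
    have sp := rschwartzZ (normal_peak s)^-1 (rschwartz_normal_qgauss y s0).
    rewrite -(D0 _ sp); apply: eq_Rintegral => x _; rewrite /h; ring.
  move=> H; apply: (mulfI (_ : (normal_peak s)^-1 != 0)); first by rewrite invr_eq0 gt_eqF.
  rewrite mulr0 -H -RintegralZl//; apply: eq_Rintegral => x _.
  rewrite mulrCA; congr (_ * _); rewrite -RintegralZl//; last first.
    exact: (@rintegrableMl _ _ _ mu setT measurableT _ _ 1).
  by apply: eq_Rintegral => y _; rewrite [normal_pdf y s x]normal_pdf_sym//; ring.
have cv : {ae mu, forall x, [set: R] x ->
    (h x * mollified_itv a b n.+1%:R^-1 x)%:E @[n --> \oo] --> (h x * \1_(`[a, b]%classic) x)%:E}.
  exists [set a; b]; split.
  - by apply: measurableU; exact: measurable_set1.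
  - by apply: countable_lebesgue_measure0; apply: finite_set_countable; exact: finite_set2.
  - move=> x /= H; apply: contrapT => /not_orP[xa xb]; apply: H => _.
    apply: cvg_EFin; first exact: nearW.
    apply: cvgM; first exact: cvg_cst.
    by apply: mollified_itv_cvg; apply/eqP.
have := @dominated_convergence _ _ R mu setT measurableT
  (fun n x => (h x * mollified_itv a b n.+1%:R^-1 x)%:E)
  (fun x => (h x * \1_(`[a, b]%classic) x)%:E) (fun x => `|h x|%:E).
case=> //.
- move=> n; apply/measurable_EFinP; apply: measurable_funM => //.
  by apply: measurable_mollified_itv; rewrite invr_gt0.
- by apply/measurable_EFinP; exact: measurable_funM.
- exact: rintegrable_norm.
- apply: aeW => x n _; rewrite lee_fin normrM ler_piMr//; exact: mollified_itv_le1.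
move=> _ _ c.
rewrite Rintegral_mkcond (_ : _ \_ _ = fun x => h x * \1_(`[a, b]%classic) x); last first.
  by apply/funext => x; rewrite patch_indic.
have fi : rintegrable mu setT (fun x => h x * \1_(`[a, b]%classic) x).
  exact: (@rintegrableMr _ _ _ mu setT measurableT _ _ 1).
have {}c : \int[mu]_x (h x * mollified_itv a b n.+1%:R^-1 x) @[n --> \oo] -->
    \int[mu]_x (h x * \1_(`[a, b]%classic) x).
  by apply: fine_cvg; rewrite -(EFin_Rintegral measurableT fi) in c *; exact: c.
move: c; rewrite (_ : (fun n => _) = cst 0); last by apply/funext => n; apply: z; rewrite invr_gt0.
move=> /(cvg_lim (@Rhausdorff R)) <-; exact: lim_cst.
Qed.

End Uniqueness.

(** * From the Sobolev norm to the real oscillatory integrals *)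

Section Solution.
Variables (R : realType) (b : bool).
Local Notation mu := (@lebesgue_measure R).
Local Notation c2pi := ((Num.sqrt (2 * pi))^-1 : R).
Implicit Types (s t x xi N : R) (T : (R -> R[i]) -> R[i]) (p q u v : R -> R).

Lemma cvg_complex (X : Type) (F : set_system X) (FF : Filter F) (f g : X -> R) (l m : R) :
  f z @[z --> F] --> l -> g z @[z --> F] --> m ->
  (f z +i* g z : R[i]^o) @[z --> F] --> (l +i* m : R[i]^o).
Proof.
move=> fl gm; apply/cvgrPdist_lt => e e0.
have [er e2] : e = (complex.Re e)%:C /\ 0 < complex.Re e / 2.
  move: e0; case: e => a d; rewrite ltcE/= => /andP[/eqP-> a0]; split => //.
  by rewrite divr_gt0.
move/cvgrPdist_lt : fl => /(_ _ e2) fl; move/cvgrPdist_lt : gm => /(_ _ e2) gm.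
apply: filterS2 fl gm => z fz gz.
rewrite er normc_def ltcR.
apply: (le_lt_trans (normc_le_abs (l - f z) (m - g z))).
by rewrite [ltRHS]splitr ltrD.
Qed.

(** max (1, |xi|)^(1/2) <= (1 + xi^2)^(1/4), and the right-hand exponent is at most s because s >=
    1/4. *)
Lemma weight_le_japanese s xi : 1 / 4 <= s -> (weight xi)^-1 <= japanese_bracket s xi ^+ 2.
Proof.
move=> hs; rewrite /weight invrK /japanese_bracket.
have J1 : 1 <= 1 + xi ^+ 2 by rewrite lerDl sqr_ge0.
have J0 : 0 <= 1 + xi ^+ 2 by lra.
rewrite -powR_mulrn ?powR_ge0// -powRrM.
apply: (@le_trans _ _ ((1 + xi ^+ 2) `^ (2^-1 * 2^-1))); last first.
  by apply: ler_powR => //; lra.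
rewrite powRrM !powR12_sqrt ?sqrtr_ge0// ler_wsqrtr// ge_max.
rewrite -{1}sqrtr1 ler_wsqrtr//= -sqrtr_sqr ler_wsqrtr//; lra.
Qed.

Lemma sobolev_weighted_l2 s T : 1 / 4 <= s -> sobolev s T ->
  forall g, g = density (fourier T) ->
  rintegrable mu setT (weighted_l2 (fun xi => complex.Re (g xi)) (fun xi => complex.Im (g xi))).
Proof.
move=> hs [_ ex fin] g gE; rewrite -gE in fin.
have [[mr mi] _] : represents (fourier T) g by rewrite gE; exact: (xgetPex (fun=> 0) ex).
pose J xi := japanese_bracket s xi * Normc.normc (g xi).
have J0 xi : 0 <= J xi by rewrite mulr_ge0 ?powR_ge0//; case: (g xi) => *; exact: sqrtr_ge0.
have JE xi : J xi ^+ 2 = japanese_bracket s xi ^+ 2 * (complex.Re (g xi) ^+ 2 + complex.Im (g xi) ^+ 2).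
  rewrite exprMn; congr (_ * _).
  by case: (g xi) => a d; rewrite /= sqr_sqrtr// addr_ge0 ?sqr_ge0.
have hJ : (\int[mu]_xi (J xi ^+ 2)%:E < +oo)%E.
  move: fin => /(poweR_lty 2); rewrite powR_Lnorm//; apply: le_lt_trans.
  rewrite le_eqVlt; apply/orP; left; apply/eqP; apply: eq_integral => xi _; rewrite -/(J xi).
  by rewrite /= ger0_norm// powR_mulrn.
have mw : measurable_fun setT
    (weighted_l2 (fun xi => complex.Re (g xi)) (fun xi => complex.Im (g xi))).
  apply: measurable_funM.
    by apply: measurable_funD; apply: measurable_funX.
  by apply: (measurableT_comp (@measurable_inv R)); exact: measurable_weight.
apply/integrableP; split; first exact/measurable_EFinP.
apply: le_lt_trans hJ; apply: ge0_le_integral => //.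
- by apply: measurableT_comp => //; exact/measurable_EFinP.
- apply/measurable_EFinP; rewrite (funext JE); apply: measurable_funM.
    apply: measurable_funX; apply: (measurableT_comp (measurable_powR (s / 2))).
    by apply: measurable_funD => //; exact: measurable_funX.
  by apply: measurable_funD; apply: measurable_funX.
- move=> xi _; rewrite /= lee_fin ger0_norm ?weighted_l2_ge0// JE /weighted_l2 mulrC.
  by rewrite ler_wpM2r ?weight_le_japanese// addr_ge0 ?sqr_ge0.
Qed.

Lemma ostrovsky_truncE T t x N : let g := density (fourier T) in
  ostrovsky_trunc b T t x N =
  (c2pi * osc b (fun xi => complex.Re (g xi)) (fun xi => complex.Im (g xi)) t x N) +i*
  (c2pi * osc b (fun xi => complex.Im (g xi)) (fun xi => - complex.Re (g xi)) t x N).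
Proof.
move=> g; rewrite /ostrovsky_trunc /Cintegral /osc -/g.
have -> : \int[mu]_(xi in `[- N, N]) complex.Re (cis (ostrovsky_phase b t x xi) * g xi) =
  \int[mu]_(xi in `[- N, N]) (complex.Re (g xi) * cos (ostrovsky_phase b t x xi) -
     complex.Im (g xi) * sin (ostrovsky_phase b t x xi)).
  by apply: eq_Rintegral => xi _; case: (g xi) => a d /=; ring.
have -> : \int[mu]_(xi in `[- N, N]) complex.Im (cis (ostrovsky_phase b t x xi) * g xi) =
  \int[mu]_(xi in `[- N, N]) (complex.Im (g xi) * cos (ostrovsky_phase b t x xi) -
     - complex.Re (g xi) * sin (ostrovsky_phase b t x xi)).
  by apply: eq_Rintegral => xi _; case: (g xi) => a d /=; ring.
by apply/eqP; rewrite eq_complex /= !mul0r subr0 addr0 !eqxx.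
Qed.

Lemma weighted_l2_rot u v : weighted_l2 v (fun xi => - u xi) = weighted_l2 u v.
Proof. by apply/funext => xi; rewrite /weighted_l2 sqrrN addrC. Qed.

Section Density.
Variables (u v : R -> R).
Hypothesis mu_ : measurable_fun setT u.
Hypothesis mv_ : measurable_fun setT v.
Hypothesis uvi : rintegrable mu setT (weighted_l2 u v).
Let w := fun xi => - u xi.
Let mw : measurable_fun setT w. Proof. exact: measurableT_comp. Qed.
Let vwi : rintegrable mu setT (weighted_l2 v w). Proof. by rewrite weighted_l2_rot. Qed.
Let l := initial_lim b u v.
Let m := initial_lim b v w.

Lemma pairing_initial_lim_re p q : rschwartz p -> rschwartz q ->
  rintegrable mu setT (fun xi => u xi * (ctr p xi - str q xi) - v xi * (ctr q xi + str p xi)) ->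
  \int[mu]_xi (u xi * (ctr p xi - str q xi) - v xi * (ctr q xi + str p xi)) =
  \int[mu]_x (p x * l x) - \int[mu]_x (q x * m x).
Proof.
move=> sp sq i.
have h := Rintegral_setT_cvg i.
apply: (cvg_unique (@Rhausdorff R) h).
have [_ hp] := pairing_initial_lim b mu_ mv_ uvi sp.
have [_ hq] := pairing_initial_lim b mv_ mw vwi sq.
have ip := rschwartz_integrable sp; have iq := rschwartz_integrable sq.
rewrite (funext (fun n => osc_pairing b mu_ mv_ uvi n ip iq)).
exact: cvgB hp hq.
Qed.

(** The real part for the test function multiplied by - i, that is for the pair (q, - p). *)
Lemma pairing_initial_lim_im p q : rschwartz p -> rschwartz q ->
  rintegrable mu setT (fun xi => u xi * (ctr q xi + str p xi) + v xi * (ctr p xi - str q xi)) ->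
  \int[mu]_xi (u xi * (ctr q xi + str p xi) + v xi * (ctr p xi - str q xi)) =
  \int[mu]_x (q x * l x) + \int[mu]_x (p x * m x).
Proof.
move=> sp sq; have snp := rschwartzN sp.
have E xi : u xi * (ctr q xi + str p xi) + v xi * (ctr p xi - str q xi) =
    u xi * (ctr q xi - str (fun x => - p x) xi) - v xi * (ctr (fun x => - p x) xi + str q xi).
  by rewrite strN// ctrN//; ring.
have [pm _] := pairing_initial_lim b mv_ mw vwi sp.
have BE : \int[mu]_x (- p x * m x) = - \int[mu]_x (p x * m x).
  rewrite -mulN1r -RintegralZl//.
  by apply: eq_Rintegral => x _; rewrite mulN1r mulNr.
move=> i; rewrite (funext E) in i.
transitivity (\int[mu]_xi (u xi * (ctr q xi - str (fun x => - p x) xi) -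
    v xi * (ctr (fun x => - p x) xi + str q xi))).
  by apply: eq_Rintegral => xi _; exact: E.
have subN (A X Y : R) : X = - Y -> A - X = A + Y by move=> ->; rewrite opprK.
rewrite (pairing_initial_lim_re sq snp i); exact: subN BE.
Qed.

End Density.
End Solution.

(** * Convergence to the data *)

Section Representation.
Variables (R : realType) (b : bool) (T : (R -> R[i]) -> R[i]) (g : R -> R[i]).
Local Notation mu := (@lebesgue_measure R).
Local Notation c2pi := ((Num.sqrt (2 * pi))^-1 : R).
Hypothesis Tg : represents (fourier T) g.
Let u xi := complex.Re (g xi).
Let v xi := complex.Im (g xi).
Let w xi := - u xi.
Hypothesis uvi : rintegrable mu setT (weighted_l2 u v).
Implicit Types (x xi : R) (p q : R -> R).

Let mu_ : measurable_fun setT u. Proof. by have [[]] := Tg. Qed.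
Let mv_ : measurable_fun setT v. Proof. by have [[]] := Tg. Qed.
Let mw : measurable_fun setT w. Proof. exact: measurableT_comp. Qed.
Let vwi : rintegrable mu setT (weighted_l2 v w). Proof. by rewrite weighted_l2_rot. Qed.

Definition initial_value x : R[i] :=
  (c2pi * initial_lim b u v x) +i* (c2pi * initial_lim b v w x).

Lemma initial_value_represents : represents T initial_value.
Proof.
split.
  by split; apply: measurable_funM => //; exact: measurable_initial_lim.
move=> phi sphi.
have [p [q [phiE sp sq]]] : exists p q, [/\ phi = (fun x => p x +i* q x), rschwartz p & rschwartz q].
  have [sp sq] := (schwartzP phi).1 sphi.
  exists (fun x => complex.Re (phi x)), (fun x => complex.Im (phi x)); split => //.
  by apply/funext => x; case: (phi x).
rewrite phiE.
set l := initial_lim b u v; set m := initial_lim b v w.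
have [pl _] := pairing_initial_lim b mu_ mv_ uvi sp.
have [ql _] := pairing_initial_lim b mu_ mv_ uvi sq.
have [pm _] := pairing_initial_lim b mv_ mw vwi sp.
have [qm _] := pairing_initial_lim b mv_ mw vwi sq.
have Re_E x : complex.Re (initial_value x * (p x +i* q x)) = c2pi * (p x * l x - q x * m x).
  by rewrite /initial_value /= -/l -/m; ring.
have Im_E x : complex.Im (initial_value x * (p x +i* q x)) = c2pi * (q x * l x + p x * m x).
  by rewrite /initial_value /= -/l -/m; ring.
have reI : rintegrable mu setT (fun x => p x * l x - q x * m x) by exact: (rintegrableB measurableT pl qm).
have imI : rintegrable mu setT (fun x => q x * l x + p x * m x) by exact: (rintegrableD measurableT ql pm).
split.
  split; [under eq_fun do rewrite Re_E|under eq_fun do rewrite Im_E]; exact: rintegrableZl.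
pose A := inverse_fourier_re p q; pose B := inverse_fourier_im p q.
have sAB : schwartz (fun xi => A xi +i* B xi).
  by apply: schwartz_pair; [exact: rschwartz_inverse_fourier_re|exact: rschwartz_inverse_fourier_im].
have -> : T (fun x => p x +i* q x) = fourier T (fun xi => A xi +i* B xi).
  by rewrite /fourier fourier_test_inverse.
have [[gre gim] ->] := Tg.2 _ sAB.
have c0 : c2pi != 0.
  by rewrite invr_eq0 gt_eqF// sqrtr_gt0 mulr_gt0// pi_gt0.
have gRe xi : complex.Re (g xi * (A xi +i* B xi)) =
    c2pi * (u xi * (ctr p xi - str q xi) - v xi * (ctr q xi + str p xi)).
  by rewrite /u /v /A /B /inverse_fourier_re /inverse_fourier_im; case: (g xi) => a d /=; ring.
have gIm xi : complex.Im (g xi * (A xi +i* B xi)) =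
    c2pi * (u xi * (ctr q xi + str p xi) + v xi * (ctr p xi - str q xi)).
  by rewrite /u /v /A /B /inverse_fourier_re /inverse_fourier_im; case: (g xi) => a d /=; ring.
have unscale f h : (forall xi, f xi = c2pi * h xi) -> rintegrable mu setT f -> rintegrable mu setT h.
  move=> fh fi; have := rintegrableZl measurableT (c2pi^-1) fi.
  by under eq_fun do rewrite fh mulKf//.
have scaleE f h : (forall xi, f xi = c2pi * h xi) -> rintegrable mu setT h ->
    \int[mu]_xi f xi = c2pi * \int[mu]_xi h xi.
  by move=> fh hi; rewrite -RintegralZl//; apply: eq_Rintegral => xi _; exact: fh.
have {}gre := unscale _ _ gRe gre; have {}gim := unscale _ _ gIm gim.
have pre := pairing_initial_lim_re b mu_ mv_ uvi sp sq gre.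
have pim := pairing_initial_lim_im b mu_ mv_ uvi sp sq gim.
rewrite /Cintegral; congr (_ +i* _).
- rewrite (scaleE _ _ gRe gre) (scaleE _ _ Re_E reI) pre; congr (_ * _).
  by rewrite (RintegralB measurableT pl qm).
- rewrite (scaleE _ _ gIm gim) (scaleE _ _ Im_E imI) pim; congr (_ * _).
  by rewrite (RintegralD measurableT ql pm).
Qed.

End Representation.

(** * Uniqueness of the representing function *)

Section RepresentationUnique.
Variable R : realType.
Local Notation mu := (@lebesgue_measure R).
Implicit Types (T : (R -> R[i]) -> R[i]) (f F : R -> R[i]).

(** Real test functions separate the two components of the representative, which reduces uniqueness
    to real functions. *)
Lemma represents_real_test T f (p : R -> R) : represents T f -> rschwartz p ->
  [/\ rintegrable mu setT (fun x => complex.Re (f x) * p x),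
      rintegrable mu setT (fun x => complex.Im (f x) * p x) &
      T (fun x => p x +i* 0) =
        (\int[mu]_x (complex.Re (f x) * p x)) +i* (\int[mu]_x (complex.Im (f x) * p x))].
Proof.
move=> [_ Tf] sp.
have [[fr fi] ->] := Tf _ (schwartz_pair sp (@rschwartz0 R)).
have reE x : complex.Re (f x * (p x +i* 0)) = complex.Re (f x) * p x.
  by case: (f x) => a d /=; ring.
have imE x : complex.Im (f x * (p x +i* 0)) = complex.Im (f x) * p x.
  by case: (f x) => a d /=; ring.
split; last by congr (_ +i* _); apply: eq_Rintegral => x _; [exact: reE|exact: imE].
- by rewrite -(funext reE).
- by rewrite -(funext imE).
Qed.

Lemma represents_ae_unique T f F : represents T f -> represents T F ->
  {ae mu, forall x, f x = F x}.
Proof.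
move=> Tf TF.
have ae_eq (h k : R -> R) :
    (forall p, rschwartz p -> [/\ rintegrable mu setT (fun x => h x * p x),
      rintegrable mu setT (fun x => k x * p x) &
      \int[mu]_x (h x * p x) = \int[mu]_x (k x * p x)]) ->
    {ae mu, forall x, h x - k x = 0}.
  move=> H; apply: ae_zero_schwartz => p sp; have [hi ki hk] := H p sp.
    by under eq_fun do rewrite mulrBl; exact: (rintegrableB measurableT hi ki).
  transitivity (\int[mu]_x (h x * p x) - \int[mu]_x (k x * p x)).
    by rewrite -(RintegralB measurableT hi ki); apply: eq_Rintegral => x _; rewrite mulrBl.
  by rewrite hk subrr.
have zr : {ae mu, forall x, complex.Re (f x) - complex.Re (F x) = 0}.
  apply: ae_eq => p sp; have [fr _ E] := represents_real_test Tf sp.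
  by have [Fr _] := represents_real_test TF sp; rewrite E => -[e _].
have zi : {ae mu, forall x, complex.Im (f x) - complex.Im (F x) = 0}.
  apply: ae_eq => p sp; have [_ fi E] := represents_real_test Tf sp.
  by have [_ Fi] := represents_real_test TF sp; rewrite E => -[_ e].
move: zr zi; apply: filterS2; first exact: (ae_filter_ringOfSetsType mu).
move=> x /eqP; rewrite subr_eq0 => /eqP h1 /eqP; rewrite subr_eq0 => /eqP h2.
by apply/eqP; rewrite eq_complex h1 h2 !eqxx.
Qed.

End RepresentationUnique.

(** * The limit as time tends to zero at a fixed point *)

Section TimeLimit.
Variables (R : realType) (b : bool) (T : (R -> R[i]) -> R[i]) (g : R -> R[i]).
Local Notation mu := (@lebesgue_measure R).
Local Notation c2pi := ((Num.sqrt (2 * pi))^-1 : R).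
Hypothesis gE : g = density (fourier T).
Let u xi := complex.Re (g xi).
Let v xi := complex.Im (g xi).
Let w xi := - u xi.
Hypothesis mu_ : measurable_fun setT u.
Hypothesis mv_ : measurable_fun setT v.
Hypothesis uvi : rintegrable mu setT (weighted_l2 u v).
Variable x : R.
Hypothesis hx : uniformly_small_tail b u v x.
Hypothesis hy : uniformly_small_tail b v w x.

Let mw : measurable_fun setT w. Proof. exact: measurableT_comp. Qed.
Let vwi : rintegrable mu setT (weighted_l2 v w). Proof. by rewrite weighted_l2_rot. Qed.

Let U t : R[i]^o := (c2pi * lim (osc b u v t x N @[N --> +oo])) +i*
  (c2pi * lim (osc b v w t x N @[N --> +oo])).

Let trunc_cvg t : ostrovsky_trunc b T t x N @[N --> +oo] --> U t.
Proof.
rewrite (_ : (fun N => _) = fun N => (c2pi * osc b u v t x N) +i* (c2pi * osc b v w t x N)).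
  apply: cvg_complex; (apply: cvgM; [exact: cvg_cst|]).
    exact: (osc_is_cvg hx).
  exact: (osc_is_cvg hy).
by apply/funext => N; rewrite ostrovsky_truncE -gE.
Qed.

Let norm_lim t : ostrovsky_U b t T x = U t.
Proof. exact: (cvg_lim (@norm_hausdorff _ R[i]^o) (@trunc_cvg t)). Qed.

Lemma ostrovsky_U_is_defined t : ostrovsky_U_defined b t T x.
Proof. by apply/cvg_ex; exists (U t); exact: trunc_cvg. Qed.

Lemma ostrovsky_U_cvg :
  (ostrovsky_U b t T x : R[i]^o) @[t --> (0 : R)^'] --> (initial_value b g x : R[i]^o).
Proof.
have E : (fun t => ostrovsky_U b t T x : R[i]^o) = U by apply/funext => t; exact: norm_lim.
rewrite E.
have h : U t @[t --> (0 : R)] --> (initial_value b g x : R[i]^o).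
  apply: cvg_complex; (apply: cvgM; [exact: cvg_cst|]).
  (* At such a point the limit superior in [initial_lim] is the limit in [N] at time zero, so the
     claim becomes continuity at [t = 0]. *)
  - rewrite -(cvg_lim (@Rhausdorff R) (osc_initial_lim hx)).
    exact: (osc_lim_continuous0 mu_ mv_ uvi hx).
  - rewrite -(cvg_lim (@Rhausdorff R) (osc_initial_lim hy)).
    exact: (osc_lim_continuous0 mv_ mw vwi hy).
apply: cvg_trans h; apply: cvg_app; exact: cvg_within.
Qed.

End TimeLimit.

Theorem theorem1p1 (R : realType) (b : bool) (s : R)
    (T : (R -> R[i]) -> R[i]) (hs : 1 / 4 <= s) (hT : sobolev s T) :
  (exists f : R -> R[i], represents T f) /\
  forall f : R -> R[i], represents T f ->
    {ae (@lebesgue_measure R), forall x : R,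
      (\forall t \near (0 : R)^', ostrovsky_U_defined b t T x) /\
      (ostrovsky_U b t T x : R[i]^o) @[t --> (0 : R)^'] --> (f x : R[i]^o)}.
Proof.
have [g gE] : exists g, g = density (fourier T) by eexists.
have Tg : represents (fourier T) g.
  by rewrite gE; have [_ ex _] := hT; exact: (xgetPex (fun=> 0) ex).
have uvi := sobolev_weighted_l2 hs hT gE.
have [mr mi] := Tg.1.
(* The limit at time zero is itself a representative of [T], which gives existence; any other
   representative agrees with it almost everywhere. *)
have rep := initial_value_represents b Tg uvi.
split; first by exists (initial_value b g).
move=> f Tf.
have ae1 := ae_uniformly_small_tail b mr mi uvi.
have mr' : measurable_fun setT (fun xi => - complex.Re (g xi)) by exact: measurableT_comp.
have vwi : rintegrable (@lebesgue_measure R) setT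
    (weighted_l2 (fun xi => complex.Im (g xi)) (fun xi => - complex.Re (g xi))).
  by rewrite weighted_l2_rot.
have ae2 := ae_uniformly_small_tail b mi mr' vwi.
have ae3 := represents_ae_unique Tf rep.
move: ae1 ae2 ae3; apply: filterS3; first exact: (ae_filter_ringOfSetsType (@lebesgue_measure R)).
move=> x h1 h2 ->; split; last exact: (ostrovsky_U_cvg gE mr mi uvi h1 h2).
by apply: nearW => t; exact: (ostrovsky_U_is_defined gE h1 h2).
Qed.
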